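(* There exists a non-compact finite volume hyperbolic Riemann surface $M$ for which $e^{\ell_{M,0}}=(\mathfrak{g}_2/\mathfrak{g}_1)^2$.
   Context: $M=\Gamma\backslash\mathbb{H}$ where $\Gamma\subset\mathrm{PSL}_2(\mathbb{R})$ is a Fuchsian group of the first kind with finite covolume and $n_1\ge1$ cusps. $\ell_{M,0}$ is the length of a shortest closed geodesic on $M$. The determinant $\phi_M$ of the scattering matrix of $M$ is, for $\mathrm{Re}(s)$ large, $\phi_M(s)=\pi^{n_1/2}\left(\frac{\Gamma(s-1/2)}{\Gamma(s)}\right)^{n_1}\sum_{n=1}^\infty\frac{d(n)}{\mathfrak{g}_n^{2s}}$ with real $d(n)\ne0$ and $0<\mathfrak{g}_1<\mathfrak{g}_2<\cdots$; this defines $\mathfrak{g}_1$ and $\mathfrak{g}_2$. *)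

(* Defs.v *)
From HB Require Import structures.
From mathcomp Require Import all_boot all_order all_algebra.
From mathcomp Require Import complex.
From mathcomp Require Import all_classical all_reals all_analysis.

Set Implicit Arguments.
Unset Strict Implicit.
Unset Printing Implicit Defensive.

Import Order.TTheory GRing.Theory Num.Theory.
Import numFieldNormedType.Exports.
Import ComplexField.Normc.

Local Open Scope classical_set_scope.
Local Open Scope ring_scope.
Local Open Scope complex_scope.

Section ComplexAnalysis.
Variable R : realType.

(* x ^ s = exp (s * ln x), for a real base x > 0. *)
Definition cpow (x : R) (s : R[i]) : R[i] :=
  (x `^ complex.Re s)%:C *
  (cos (complex.Im s * ln x) +i* sin (complex.Im s * ln x)).

Definition cint (D : set R) (f : R -> R[i]) : R[i] :=
  Rintegral lebesgue_measure D (fun x => complex.Re (f x)) +i*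
  Rintegral lebesgue_measure D (fun x => complex.Im (f x)).

(* Sum of an absolutely summable family; the value is meaningful only in that
   case, esum being a supremum over finite subsets of D. *)
Definition rsum (T : choiceType) (D : set T) (f : T -> R) : R :=
  fine (\esum_(i in D) (Num.max (f i) 0)%:E) -
  fine (\esum_(i in D) (Num.max (- f i) 0)%:E).

Definition csum (T : choiceType) (D : set T) (f : T -> R[i]) : R[i] :=
  rsum D (fun x => complex.Re (f x)) +i* rsum D (fun x => complex.Im (f x)).

(* Euler's integral, valid for 0 < Re s. *)
Definition cGamma (s : R[i]) : R[i] :=
  cint `]0, +oo[ (fun t => cpow t (s - 1) * (expR (- t))%:C).

End ComplexAnalysis.

Section HyperbolicPlane.
Variable R : realType.
Implicit Types (g : 'M[R]_2) (z w : R[i]) (b : option R).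

Definition upper_half_plane : set R[i] := [set z | 0 < complex.Im z].

Definition SL2 : set 'M[R]_2 := [set g | \det g = 1].

Definition mob g z : R[i] :=
  ((g 0 0)%:C * z + (g 0 1)%:C) / ((g 1 0)%:C * z + (g 1 1)%:C).

(* The boundary R u {oo} of the upper half-plane is option R, with oo = None. *)
Definition mob_bd g b : option R :=
  match b with
  | Some x => if g 1 0 * x + g 1 1 == 0 then None
              else Some ((g 0 0 * x + g 0 1) / (g 1 0 * x + g 1 1))
  | None => if g 1 0 == 0 then None else Some (g 0 0 / g 1 0)
  end.

(* arcosh (1 + |z - w|^2 / (2 Im z Im w)) *)
Definition hdist z w : R :=
  let u := 1 + normc (z - w) ^+ 2 / (2 * complex.Im z * complex.Im w) in
  ln (u + Num.sqrt (u ^+ 2 - 1)).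

Definition area (F : set R[i]) : \bar R :=
  (\int[(lebesgue_measure \x lebesgue_measure)%E]_(p in
      [set p : R * R | F (p.1 +i* p.2)]) (p.2 ^- 2)%:E)%E.

Definition unit_speed_geodesic (eta : R -> R[i]) : Prop :=
  (forall t, upper_half_plane (eta t)) /\
  (forall s t, hdist (eta s) (eta t) = `|s - t|).

End HyperbolicPlane.

Section FuchsianGroups.
Variable R : realType.
Implicit Types (G : set 'M[R]_2) (b : option R).

(* A subgroup of PSL_2(R) is represented by its full preimage in SL_2(R), that
   is, by a subgroup of SL_2(R) containing -1.  Torsion is allowed. *)
Definition fuchsian G : Prop :=
  [/\ G `<=` @SL2 R,
      G 1%:M /\ G (- 1%:M),
      (forall g h, G g -> G h -> G (g *m h)),
      (forall g, G g -> G (invmx g)) &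
      G `<=` isolated G].

(* Orbits lie in the open half-plane, hence an adherent boundary point is
   automatically an accumulation point. *)
Definition limit_set G : set (option R) :=
  [set b | exists2 z, upper_half_plane z &
    match b with
    | Some x => forall e : R, 0 < e ->
                  exists2 g, G g & normc (mob g z - x%:C) < e
    | None => forall B : R, exists2 g, G g & B < normc (mob g z)
    end].

Definition first_kind G : Prop := limit_set G = setT.

Definition fundamental_domain G (F : set R[i]) : Prop :=
  [/\ F `<=` @upper_half_plane R,
      measurable [set p : R * R | F (p.1 +i* p.2)],
      (forall z, upper_half_plane z -> exists2 g, G g & F (mob g z)) &
      (forall g, G g -> g <> 1%:M -> g <> - 1%:M ->
         area (F `&` (mob g @` F)) = 0%E)].

Definition finite_covolume G : Prop :=
  exists2 F, fundamental_domain G F & (area F < +oo)%E.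

Definition parabolic (g : 'M[R]_2) : Prop :=
  [/\ SL2 g, `|\tr g| = 2, g <> 1%:M & g <> - 1%:M].

Definition cusp G b : Prop := exists g, [/\ G g, parabolic g & mob_bd g b = b].

Definition stab G b : set 'M[R]_2 := [set g | G g /\ mob_bd g b = b].

Definition translation (x : R) : 'M[R]_2 := 1%:M + x *: delta_mx 0 1.

(* s maps oo to a cusp a, and s^-1 G_a s is generated by z |-> z + 1. *)
Definition scaling_matrix G (s : 'M[R]_2) : Prop :=
  [/\ SL2 s, cusp G (mob_bd s None) &
      [set invmx s *m g *m s | g in stab G (mob_bd s None)] =
      [set h | exists m : int, h = translation m%:~R \/
                               h = - translation m%:~R]].

(* The points (sigma i) oo form a complete irredundant system of
   representatives of the G-classes of cusps, so that n is the number of cusps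
   of G \ H. *)
Definition cusp_system G n (sigma : 'I_n -> 'M[R]_2) : Prop :=
  [/\ (forall i, scaling_matrix G (sigma i)),
      (forall i j g, G g ->
         mob_bd g (mob_bd (sigma i) None) = mob_bd (sigma j) None -> i = j) &
      (forall b, cusp G b -> exists i, exists2 g, G g &
         mob_bd g (mob_bd (sigma i) None) = b)].

(* A closed geodesic of length L on G \ H, given by a lift to H. *)
Definition closed_geodesic_length G (L : R) : Prop :=
  0 < L /\ exists (eta : R -> R[i]) (g : 'M[R]_2),
    [/\ unit_speed_geodesic eta, G g & forall t, mob g (eta t) = eta (t + L)].

Definition shortest_geodesic_length G (l : R) : Prop :=
  closed_geodesic_length G l /\
  forall L, closed_geodesic_length G L -> l <= L.

End FuchsianGroups.

Section Scattering.
Variables (R : realType) (G : set 'M[R]_2).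

(* The set G_a \ G of cosets G_a g. *)
Definition stab_cosets (a : option R) : set (set 'M[R]_2) :=
  [set [set h *m g | h in stab G a] | g in G].

(* E(z, s) = sum over g in G_a \ G of Im (sigma^-1 g z) ^ s, at the cusp
   a = sigma oo; the summand does not depend on the representative of the
   coset.  Absolutely convergent for 1 < Re s. *)
Definition eisenstein (sigma : 'M[R]_2) (z s : R[i]) : R[i] :=
  csum (stab_cosets (mob_bd sigma None))
    (fun C => cpow (complex.Im (mob (invmx sigma *m xget 1%:M C) z)) s).

(* The constant term of E_i at the cusp j is
   delta_ij y ^ s + phi_ij(s) y ^ (1 - s); this determines phi on 1 < Re s. *)
Definition scattering_matrix n (sigma : 'I_n -> 'M[R]_2)
    (phi : R[i] -> 'M[R[i]]_n) : Prop :=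
  forall s : R[i], 1 < complex.Re s ->
  forall (i j : 'I_n) (y : R), 0 < y ->
    cint `[0, 1] (fun x => eisenstein (sigma i) (mob (sigma j) (x +i* y)) s) =
    (i == j)%:R * cpow y s + phi s i j * cpow y (1 - s).

(* d and g are indexed from 1; their values at 0 are irrelevant. *)
Definition scattering_det_series n (phi : R[i] -> 'M[R[i]]_n)
    (d g : nat -> R) : Prop :=
  [/\ (forall k, (1 <= k)%N -> d k != 0),
      0 < g 1%N,
      (forall k, (1 <= k)%N -> g k < g k.+1) &
      exists s0 : R, forall s : R[i], s0 < complex.Re s ->
        exists2 S : R[i],
          (fun N => \sum_(1 <= k < N)
             (d k)%:C / cpow (g k) (2 * s) : R[i]^o) @ \oo --> (S : R[i]^o) &
          \det (phi s) =
            (pi `^ (n%:R / 2))%:C *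
            (cGamma (s - (2^-1)%:C) / cGamma s) ^+ n * S].

End Scattering.

(* Main.v *)
Require Import Defs.
From mathcomp Require Import all_boot all_order all_algebra.
From mathcomp Require Import complex.
From mathcomp Require Import all_classical all_reals all_analysis.
From mathcomp Require Import measurable_realfun.
From mathcomp Require Import ring lra.

Set Implicit Arguments.
Unset Strict Implicit.
Unset Printing Implicit Defensive.

Import Order.TTheory GRing.Theory Num.Theory.
Import numFieldNormedType.Exports.
Import ComplexField.Normc.

Local Open Scope classical_set_scope.
Local Open Scope ring_scope.
Local Open Scope complex_scope.

(* The witness is generated by the half-turns gS, gU, gV about points on the
   sides of the ideal triangle (0, 1/2, oo).  In PSL_2 it is the free product of
   three groups of order 2, and the quotient has a single cusp, of width 1 at oo.
   The absolute value of the lower left entry of g is the lambda-length between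
   oo and g oo; it is 4 / sqrt 3 for gS and 4 for gU.  Crossing successive
   triangles of the tessellation transforms lambda-lengths by Ptolemy relations
   with positive coefficients, so that every lower left entry is 0 or at least
   4 / sqrt 3 in absolute value, and 4 is the next value.  Reducing within a
   conjugacy class by isometric circles then shows that a hyperbolic trace is at
   least 4 / sqrt 3 = 2 cosh (ln 3 / 2) in absolute value.  Hence
   g_1 = 4 / sqrt 3, g_2 = 4 and e ^ l = 3 = (g_2 / g_1) ^ 2.

   Unfolding the Eisenstein series, with c running over the positive lower left
   entries, its constant term is
     y ^ s + sum_c d(c) c ^ (- 2 s) * int (y / (x ^ 2 + y ^ 2)) ^ s dx,
   and the integral is y ^ (1 - s) sqrt pi Gamma(s - 1/2) / Gamma(s), by Fubini
   from the integrals of u ^ (s - 1) exp(- A u) and of Gaussians.  Finally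
   Gamma(s) <> 0: a zero at s propagates to all s + n, whereas
   Re (q ^ (- i t) Gamma(q + i t)) > 0 for q large with respect to t. *)

(** The numbers come from a Markov-type equation. Let x, y, z be the absolute lower left entries of
    the three half-turns, that is, the lambda-lengths of the sides of the triangle. The corners of
    the triangle cut the horocycle of the single cusp into arcs x / (y z), y / (x z), z / (x y), so
    width 1 means x^2 + y^2 + z^2 = x y z. A half-turn has trace 0, so composing it with the unit
    translation gives trace x, and the shortest geodesic should satisfy x = 2 cosh (l / 2). Imposing
    y = x e^(l / 2), with x and y the two least entries, leaves a quadratic equation in z whose
    discriminant is a positive multiple of e^l - 3. The witness is the boundary case e^l = 3, with a
    double root: (x, y, z) = (4 / sqrt 3, 4, 8 / sqrt 3).

    An induction on words provides the gap in the lower left entries. Discreteness, the stabilizer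
    of infinity, the second entry and the counting of bottom rows all come from applying this gap to
    well chosen products. *)

Section Matrix2.
Variable R : realType.
Implicit Types g h : 'M[R]_2.

Definition mk (a b c d : R) : 'M[R]_2 :=
  \matrix_(i, j) if i == 0 then (if j == 0 then a else b)
                 else (if j == 0 then c else d).

Lemma mkE a b c d :
  (mk a b c d 0 0 = a) * (mk a b c d 0 1 = b) *
  (mk a b c d 1 0 = c) * (mk a b c d 1 1 = d).
Proof. by rewrite !mxE. Qed.

Lemma mkP g : g = mk (g 0 0) (g 0 1) (g 1 0) (g 1 1).
Proof.
apply/matrixP => i j; rewrite mxE.
have E (k : 'I_2) : (k == 0) || (k == 1) by case: k => [[|[|]]].
by have /orP[/eqP->|/eqP->] := E i; have /orP[/eqP->|/eqP->] := E j.
Qed.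

Lemma mk_inj a b c d a' b' c' d' : mk a b c d = mk a' b' c' d' ->
  [/\ a = a', b = b', c = c' & d = d'].
Proof.
by move=> E; split; [move/matrixP: E => /(_ 0 0)|move/matrixP: E => /(_ 0 1)
  |move/matrixP: E => /(_ 1 0)|move/matrixP: E => /(_ 1 1)]; rewrite !mkE.
Qed.

Lemma mulmk a b c d a' b' c' d' : mk a b c d *m mk a' b' c' d' =
  mk (a * a' + b * c') (a * b' + b * d') (c * a' + d * c') (c * b' + d * d').
Proof.
have E (X Y : 'M[R]_2) (i j : 'I_2) :
  (X *m Y) i j = X i 0 * Y 0 j + X i 1 * Y 1 j.
  by rewrite mxE !big_ord_recl big_ord0 addr0; congr (_ + _ * _);
    congr fun_of_matrix; apply/val_inj.
by rewrite [LHS]mkP !E !mkE.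
Qed.

Lemma oppmk a b c d : - mk a b c d = mk (- a) (- b) (- c) (- d).
Proof. by rewrite [LHS]mkP !mxE. Qed.

Lemma mk1 : 1%:M = mk 1 0 0 1.
Proof. by rewrite [LHS]mkP !mxE. Qed.

Lemma detmk a b c d : \det (mk a b c d) = a * d - b * c.
Proof.
rewrite (expand_det_row _ 0) !big_ord_recl big_ord0 /cofactor !det_mx11 !mxE /=.
by rewrite /bump /=; ring.
Qed.

Lemma trmk a b c d : \tr (mk a b c d) = a + d.
Proof.
by rewrite /mxtrace !big_ord_recl big_ord0 addr0 !mxE.
Qed.

Lemma translationE x : translation x = mk 1 x 0 1.
Proof.
by rewrite /translation [LHS]mkP !mxE /= !(mulr0, mulr1, addr0, add0r).
Qed.

Lemma SL2_unit g : SL2 g -> g \in unitmx.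
Proof. by rewrite unitmxE => ->; rewrite unitr1. Qed.

Lemma invmk a b c d : a * d - b * c = 1 -> invmx (mk a b c d) = mk d (- b) (- c) a.
Proof.
move=> D; have U : mk a b c d \in unitmx by rewrite unitmxE detmk D unitr1.
have E : mk a b c d *m mk d (- b) (- c) a = 1%:M.
  by rewrite mulmk mk1; congr mk; rewrite -?D; ring.
by rewrite -[RHS](mulKmx U) E mulmx1.
Qed.

End Matrix2.

(** * The group and its lower left entries *)

Section HalfTurnGroup.
Variable R : realType.
Implicit Types g h : 'M[R]_2.
Local Notation r := (Num.sqrt 3 : R).

Lemma sqrt3_sqr : r ^+ 2 = 3. Proof. by rewrite sqr_sqrtr. Qed.
Lemma sqrt3_sq : r * r = 3. Proof. by rewrite -expr2 sqrt3_sqr. Qed.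
Lemma sqrt3_gt : 17 / 10 < r.
Proof.
rewrite -[ltLHS]ger0_norm ?divr_ge0//.
by rewrite -sqrtr_sqr ltr_sqrt//; lra.
Qed.

Lemma sqrt3_lt : r < 7 / 4.
Proof.
rewrite -[ltRHS]ger0_norm ?divr_ge0//.
by rewrite -sqrtr_sqr ltr_sqrt//; lra.
Qed.

(** The fixed points are i sqrt 3 / 4, 1 / 2 + i / 4 and (3 + i sqrt 3) / 8, on the sides (0, oo),
    (1/2, oo) and (0, 1/2) respectively. *)
Definition gS : 'M[R]_2 := mk 0 (- (r / 4)) (4 * r / 3) 0.
Definition gU : 'M[R]_2 := mk 2 (- (5 / 4)) 4 (- 2).
Definition gV : 'M[R]_2 := mk r (- (r / 2)) (8 * r / 3) (- r).

(** The fourth letter is the default value [- 1%:M] of [nth], so that words directly produce a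
    subgroup of SL_2 containing -1. *)
Definition gen (i : 'I_4) : 'M[R]_2 := nth (- 1%:M) [:: gS; gU; gV] i.

Definition word (w : seq 'I_4) : 'M[R]_2 := foldl (fun g i => g *m gen i) 1%:M w.

Definition G3 : set 'M[R]_2 := [set g | exists w, g = word w].

Lemma word_rcons w i : word (rcons w i) = word w *m gen i.
Proof. by rewrite /word foldl_rcons. Qed.

Lemma word_cat u w : word (u ++ w) = word u *m word w.
Proof.
elim/last_ind: w => [|w i IH]; first by rewrite cats0 mulmx1.
by rewrite -rcons_cat !word_rcons IH mulmxA.
Qed.

Lemma G3M g h : G3 g -> G3 h -> G3 (g *m h).
Proof. by move=> [u ->] [w ->]; exists (u ++ w); rewrite word_cat. Qed.

Lemma G3_1 : G3 1%:M. Proof. by exists [::]. Qed.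

Lemma G3gen i : G3 (gen i).
Proof. by exists [:: i]; rewrite /word /= mul1mx. Qed.

Lemma G3S : G3 gS. Proof. exact: (@G3gen (@Ordinal 4 0 isT)). Qed.
Lemma G3U : G3 gU. Proof. exact: (@G3gen (@Ordinal 4 1 isT)). Qed.
Lemma G3V : G3 gV. Proof. exact: (@G3gen (@Ordinal 4 2 isT)). Qed.
Lemma G3N1 : G3 (- 1%:M). Proof. exact: (@G3gen (@Ordinal 4 3 isT)). Qed.

Lemma G3N g : G3 g -> G3 (- g).
Proof. by move=> gG; rewrite -[g]mul1mx -mulNmx; apply: G3M => //; exact: G3N1. Qed.

Lemma G3_ind (P : 'M[R]_2 -> Prop) : P 1%:M ->
  (forall g, P g -> P (- g)) -> (forall g, P g -> P (g *m gS)) ->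
  (forall g, P g -> P (g *m gU)) -> (forall g, P g -> P (g *m gV)) ->
  forall g, G3 g -> P g.
Proof.
move=> P1 PN PS PU PV _ [w ->]; elim/last_ind: w => [//|w i IH].
rewrite word_rcons; case: i => [[|[|[|[|//]]]] ?] /=; rewrite /gen/=.
- exact: PS.
- exact: PU.
- exact: PV.
- by rewrite mulmxN mulmx1; exact: PN.
Qed.

Lemma gS_sqr : gS *m gS = - 1%:M.
Proof. by rewrite mulmk mk1 oppmk; congr mk; field: sqrt3_sq. Qed.
Lemma gU_sqr : gU *m gU = - 1%:M.
Proof. by rewrite mulmk mk1 oppmk; congr mk; field. Qed.
Lemma gV_sqr : gV *m gV = - 1%:M.
Proof. by rewrite mulmk mk1 oppmk; congr mk; field: sqrt3_sq. Qed.

Lemma G3_SL2 g : G3 g -> \det g = 1.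
Proof.
have E (h k : 'M[R]_2) : \det h = 1 -> \det k = 1 -> \det (h *m k) = 1.
  by move=> h1 k1; rewrite det_mulmx h1 k1 mulr1.
elim/G3_ind => [|h h1|h h1|h h1|h h1]; rewrite ?det1//.
- by rewrite -scaleN1r detZ h1 mulr1 sqrrN expr1n.
- by apply: E => //; rewrite detmk; field: sqrt3_sq.
- by apply: E => //; rewrite detmk; field: sqrt3_sq.
- by apply: E => //; rewrite detmk; field: sqrt3_sq.
Qed.

Lemma G3unit g : G3 g -> g \in unitmx.
Proof. by move=> /G3_SL2/SL2_unit. Qed.

(** A generator k squares to -1, hence (h k)^-1 = - k h^-1, and membership of the inverse passes
    along words. *)
Lemma G3V' g : G3 g -> G3 (invmx g).
Proof.
have E (h k : 'M[R]_2) : G3 h -> G3 (invmx h) -> G3 k -> k *m k = - 1%:M ->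
    G3 (invmx (h *m k)).
  move=> hG hi kG k2.
  have -> : invmx (h *m k) = - k *m invmx h.
    have U := G3unit (G3M hG kG).
    rewrite -[RHS](mulKmx U) mulNmx !mulmxN -mulmxA (mulmxA k) k2 mulNmx mul1mx.
    by rewrite !mulmxN !opprK mulmxV ?mulmx1//; exact: G3unit.
  by apply: G3M => //; exact: G3N.
suff : G3 g -> G3 g /\ G3 (invmx g) by move=> H /H[].
elim/G3_ind => [|h [hG hi]|h [hG hi]|h [hG hi]|h [hG hi]].
- by rewrite invmx1; split; exact: G3_1.
- rewrite (_ : invmx (- h) = - invmx h); first by split; exact: G3N.
  rewrite -[RHS](mulKmx (G3unit (G3N hG))) mulmxN mulNmx opprK mulmxV ?mulmx1//.
  exact: G3unit.
- by split; [apply: G3M => //; exact: G3S|apply: E gS_sqr => //; exact: G3S].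
- by split; [apply: G3M => //; exact: G3U|apply: E gU_sqr => //; exact: G3U].
- by split; [apply: G3M => //; exact: G3V|apply: E gV_sqr => //; exact: G3V].
Qed.

Lemma G3inv_mk a b c d : G3 (mk a b c d) -> G3 (mk d (- b) (- c) a).
Proof.
by move=> H; move: (G3V' H); rewrite invmk// -detmk; exact: G3_SL2.
Qed.

Lemma translationM (x y : R) : translation x *m translation y = translation (x + y).
Proof. by rewrite !translationE mulmk; congr mk; ring. Qed.

(** The product of the half-turns about the three sides goes once round the cusp. *)
Lemma G3T1 : G3 (translation 1).
Proof.
have -> : translation 1 = gU *m gV *m gS :> 'M[R]_2.
  by rewrite translationE !mulmk; congr mk; field: sqrt3_sq.
by apply: G3M; [apply: G3M; [exact: G3U|exact: G3V]|exact: G3S].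
Qed.

Lemma G3T (m : int) : G3 (translation m%:~R).
Proof.
have N n : G3 (translation n%:R).
  elim: n => [|n IH].
    by rewrite /translation scale0r addr0; exact: G3_1.
  by rewrite -natr1 -translationM; apply: G3M => //; exact: G3T1.
case: m => n; first exact: N.
rewrite NegzE mulrNz.
have := G3V' (N n.+1); rewrite !translationE invmk; last by ring.
by congr G3; congr mk; ring.
Qed.

(* The rows of reduced words: a, b, c are the lambda-lengths from infinity to
   the vertices of the ideal triangle reached, and the side is the last one
   crossed. *)
Inductive side := sN | sS | sU | sV.

Inductive reduced : side -> R -> R -> R -> Prop :=
| red_start : reduced sN 0 (4 * r / 3) 4
| red_S o a b c : o <> sS -> reduced o a b c -> reduced sS b a (2 * b + r * a)
| red_U o a b c : o <> sU -> reduced o a b c ->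
    reduced sU c ((a + 2 * c) * r / 3) a
| red_V o a b c : o <> sV -> reduced o a b c ->
    reduced sV ((b + r * c) / 2) c b.

(** The Ptolemy relation that produced the vertex opposite to the last side crossed; its
    coefficients are quotients of the side lengths 4 / sqrt 3, 4 and 8 / sqrt 3. The initial
    triangle happens to satisfy the relation of [sS], which is therefore shared by [sN]. *)
Definition side_rel o a b c :=
  match o with
  | sN | sS => c = 2 * a + r * b
  | sU => b = (2 * a + c) * r / 3
  | sV => a = (c + r * b) / 2
  end.

(** Relative sign of the entries c and d of a bottom row: the pole - d / c lies beyond the last side
    crossed, on the negative axis for S and on the positive axis for U and V. *)
Definition side_sign o : R := match o with sN | sS => 1 | _ => -1 end.

Lemma reduced_rel o a b c : reduced o a b c -> side_rel o a b c.
Proof.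
case=> {o a b c}[|o a b c _ _|o a b c _ _|o a b c _ _] /=; by field: sqrt3_sq.
Qed.

(** The first three cases are the triangles with infinity among their vertices. Away from them a new
    length combines two lengths already at least 4 / sqrt 3, with positive coefficients whose sum
    exceeds 1, so the bound persists. *)
Lemma reduced_bound o a b c : reduced o a b c ->
  [\/ [/\ a = 0, b = 4 * r / 3 & c = 4],
      [/\ a = 4 * r / 3, b = 0 & c = 8 * r / 3],
      [/\ a = 4, b = 8 * r / 3 & c = 0] |
      [/\ 4 * r / 3 <= a, 4 * r / 3 <= b & 4 * r / 3 <= c]].
Proof.
have g := sqrt3_gt; have l := sqrt3_lt; have q := sqrt3_sq.
have M (x : R) : 4 * r / 3 <= x -> 4 <= r * x by nra.
have M1 (x : R) : 0 <= x -> 17 / 10 * x <= r * x by nra.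
elim=> {o a b c}[|o a b c _ _ IH|o a b c _ _ IH|o a b c _ _ IH].
- by constructor 1.
- case: IH => [[-> -> _]|[-> -> _]|[-> -> _]|[ha hb hc]].
  + by constructor 2; split; ring.
  + by constructor 1; split; field: q.
  + by constructor 4; split; lra.
  + by constructor 4; split => //; have := M1 a; lra.
- case: IH => [[-> _ ->]|[-> _ ->]|[-> _ ->]|[ha hb hc]].
  + by constructor 3; split; field: q.
  + by constructor 4; split; nra.
  + by constructor 1; split; field: q.
  + by constructor 4; split => //; have := M a ha; have := M c hc; lra.
- case: IH => [[_ -> ->]|[_ -> ->]|[_ -> ->]|[ha hb hc]].
  + by constructor 4; split; nra.
  + by constructor 3; split; field: q.
  + by constructor 2; split; field: q.
  + by constructor 4; split => //; have := M c hc; lra.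
Qed.

(** The sign [e] is the one lost in PSL_2. The factor r / 4 turns the lambda-length to the image of
    0 into the entry d: the length is 4 r / 3 when d = 1. *)
Definition red_row c d := exists o x y z (e : bool),
  [/\ reduced o x y z, c = (-1) ^+ e * x &
      d = (-1) ^+ e * side_sign o * y * r / 4].

Lemma reduced_N x y z : reduced sN x y z -> [/\ x = 0, y = 4 * r / 3 & z = 4].
Proof. by move E : sN => o H; case: H E. Qed.
Lemma reduced_S x y z : reduced sS x y z -> exists2 o, o <> sS & exists2 c, reduced o y x c & z = 2 * x + r * y.
Proof.
move E : sS => o H; case: H E => // o' a b c oS H _.
by exists o' => //; exists c.
Qed.

Lemma reduced_U x y z : reduced sU x y z -> exists2 o, o <> sU & exists2 b, reduced o z b x & y = (z + 2 * x) * r / 3.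
Proof.
move E : sU => o H; case: H E => // o' a b c oS H _.
by exists o' => //; exists b.
Qed.

Lemma reduced_V x y z : reduced sV x y z -> exists2 o, o <> sV & exists2 a, reduced o a z y & x = (z + r * y) / 2.
Proof.
move E : sV => o H; case: H E => // o' a b c oS H _.
by exists o' => //; exists a.
Qed.

(** Appending S crosses a new side unless S was the last letter; in that case S^2 = -1 leads back to
    the previous triangle, and the sign is readjusted to the side by which that triangle was
    entered. *)
Lemma red_row_S c d : red_row c d -> red_row (d * (4 * r / 3)) (- (r / 4) * c).
Proof.
have q := sqrt3_sq.
have sg (e : bool) : (-1) ^+ (~~ e) = - (-1) ^+ e :> R by rewrite -signrN.
move=> [ sd [x [y [z [e [H -> ->]]]]]]; have E := reduced_rel H.
case: sd H E => H.
- have [-> -> _] := reduced_N H => _.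
  exists sS, (4 * r / 3), 0, (2 * (4 * r / 3) + r * 0), e.
  split; [|by rewrite /=; field: q..].
  by apply: red_S; [|exact: red_start].
- have [sd oS [w Hw ->]] := reduced_S H => _.
  have E := reduced_rel Hw.
  case: sd oS Hw E => // _ Hw /=.
  + have [-> -> _] := reduced_N Hw => _.
    exists sN, 0, (4 * r / 3), 4, (~~ e); rewrite sg.
    by split; [exact: red_start|rewrite /=; field: q..].
  + by exists sU, y, x, w, e; split => //=; field: q.
  + by exists sV, y, x, w, e; split => //=; field: q.
- exists sS, y, x, (2 * y + r * x), (~~ e); split; first by apply: (red_S _ H).
    by rewrite sg /=; field: q.
  by rewrite sg /=; field: q.
- exists sS, y, x, (2 * y + r * x), (~~ e); split; first by apply: (red_S _ H).
    by rewrite sg /=; field: q.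
  by rewrite sg /=; field: q.
Qed.

(** Up to sign, 2 c + 4 d is the length to the third vertex of the current triangle. This is exactly
    [side_rel] for the last side crossed, hence the distinction of cases; the same holds for V
    below. *)
Lemma red_row_U c d : red_row c d ->
  red_row (c * 2 + d * 4) (- (5 / 4) * c - 2 * d).
Proof.
have q := sqrt3_sq.
have sg (e : bool) : (-1) ^+ (~~ e) = - (-1) ^+ e :> R by rewrite -signrN.
move=> [ sd [x [y [z [e [H -> ->]]]]]]; have := reduced_rel H.
case: sd H => H.
- have [-> -> _] := reduced_N H => _.
  exists sU, 4, ((0 + 2 * 4) * r / 3), 0, e.
  split; [|by rewrite /=; field: q..].
  by apply: red_U; [|exact: red_start].
- move=> /= zE.
  exists sU, z, ((x + 2 * z) * r / 3), x, e; split; first by apply: (red_U _ H).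
    by rewrite zE /=; field: q.
  by rewrite zE /=; field: q.
- have [sd oS [w Hw ->]] := reduced_U H => _.
  have := reduced_rel Hw.
  case: sd oS Hw => // _ Hw /=.
  + have [-> -> ->] := reduced_N Hw => _.
    exists sN, 0, (4 * r / 3), 4, (~~ e); rewrite sg.
    by split; [exact: red_start|rewrite /=; field: q..].
  + move=> xE; exists sS, z, w, x, (~~ e); rewrite sg.
    by split => //=; rewrite xE; field: q.
  + move=> zE; exists sV, z, w, x, (~~ e); rewrite sg.
    by split => //=; rewrite zE; field: q.
- move=> /= xE.
  exists sU, z, ((x + 2 * z) * r / 3), x, e; split; first by apply: (red_U _ H).
    by rewrite xE /=; field: q.
  by rewrite xE /=; field: q.
Qed.

Lemma red_row_V c d : red_row c d ->
  red_row (c * r + d * (8 * r / 3)) (- (r / 2) * c - r * d).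
Proof.
have q := sqrt3_sq.
have sg (e : bool) : (-1) ^+ (~~ e) = - (-1) ^+ e :> R by rewrite -signrN.
move=> [ sd [x [y [z [e [H -> ->]]]]]]; have := reduced_rel H.
case: sd H => H.
- have [-> -> _] := reduced_N H => _.
  exists sV, ((4 * r / 3 + r * 4) / 2), 4, (4 * r / 3), e.
  split; [|by rewrite /=; field: q..].
  by apply: red_V; [|exact: red_start].
- move=> /= zE.
  exists sV, ((y + r * z) / 2), z, y, e; split; first by apply: (red_V _ H).
    by rewrite zE /=; field: q.
  by rewrite zE /=; field: q.
- move=> /= yE.
  exists sV, ((y + r * z) / 2), z, y, (~~ e); rewrite sg.
  split; first by apply: (red_V _ H).
    by rewrite yE /=; field: q.
  by rewrite yE /=; field: q.
- have [sd oS [w Hw ->]] := reduced_V H => _.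
  have := reduced_rel Hw.
  case: sd oS Hw => // _ Hw /=.
  + have [-> -> ->] := reduced_N Hw => _.
    exists sN, 0, (4 * r / 3), 4, (~~ e); rewrite sg.
    by split; [exact: red_start|rewrite /=; field: q..].
  + move=> yE; exists sS, w, z, y, (~~ e); rewrite sg.
    by split => //=; rewrite yE; field: q.
  + move=> zE; exists sU, w, z, y, e.
    by split => //=; rewrite zE; field: q.
Qed.

Lemma mulmk_row g (a b c d : R) :
  ((g *m mk a b c d) 1 0 = g 1 0 * a + g 1 1 * c) *
  ((g *m mk a b c d) 1 1 = g 1 0 * b + g 1 1 * d).
Proof. by split; rewrite [in LHS](mkP g) mulmk !mkE. Qed.

Lemma G3_red_row g : G3 g -> red_row (g 1 0) (g 1 1).
Proof.
have q := sqrt3_sq.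
have sg (e : bool) : (-1) ^+ (~~ e) = - (-1) ^+ e :> R by rewrite -signrN.
elim/G3_ind => {g} [|h|h|h|h].
- exists sN, 0, (4 * r / 3), 4, false; split; first by constructor.
    by rewrite !mxE mulr0.
  by rewrite !mxE /=; field: q.
- move=> [ sd [x [y [z [e [H c_ d_]]]]]]; exists sd, x, y, z, (~~ e).
  by rewrite !mxE sg; split => //; rewrite ?c_ ?d_; ring.
- move/red_row_S; rewrite !mulmk_row.
  by congr red_row; ring.
- move/red_row_U; rewrite !mulmk_row.
  by congr red_row; ring.
- move/red_row_V; rewrite !mulmk_row.
  by congr red_row; ring.
Qed.

Lemma G3_row g : G3 g ->
  (g 1 0 = 0 /\ `|g 1 1| = 1) \/ 4 * r / 3 <= `|g 1 0|.
Proof.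
have q := sqrt3_sq; have gt := sqrt3_gt.
move=> /G3_red_row [ sd [x [y [z [e [H -> ->]]]]]].
have s1 : `|side_sign sd| = 1 by case: (sd) => /=; rewrite ?normrN normr1.
rewrite !normrM !normrX !normrN !normr1 !expr1n !mul1r s1 mul1r.
rewrite (ger0_norm (sqrtr_ge0 _)).
case: (reduced_bound H) => [[-> -> _]|[-> -> _]|[-> -> _]|[xk _ _]].
- left; rewrite mulr0 !normrM normfV !(ger0_norm (sqrtr_ge0 _)) !ger0_norm//.
  by split => //; field: q.
- by right; rewrite ger0_norm//; lra.
- by right; rewrite ger0_norm//; have := sqrt3_lt; lra.
- by right; rewrite ger0_norm//; lra.
Qed.

Lemma G3_mk_row a b c d : G3 (mk a b c d) ->
  [\/ c = 0 /\ d = 1, c = 0 /\ d = - 1 | 4 * r / 3 <= `|c|].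
Proof.
move=> /G3_row; rewrite !mkE => -[[-> /eqP]|]; last by constructor 3.
by rewrite eqr_norml ler01 andbT => /orP[]/eqP->; [constructor 1|constructor 2].
Qed.

(** * Stabilizer of infinity and the second lower left entry *)

Lemma sqrt3_scale_le x y : (r * x <= r * y) = (x <= y).
Proof. by rewrite ler_pM2l// sqrtr_gt0. Qed.

Lemma G3_row_cases g : G3 g ->
  [\/ g 1 0 = 0 /\ g 1 1 = 1, g 1 0 = 0 /\ g 1 1 = - 1,
      4 * r / 3 <= g 1 0 | g 1 0 <= - (4 * r / 3)].
Proof.
rewrite {1}[g]mkP => /G3_mk_row[H|H|]; [by constructor 1|by constructor 2|].
by rewrite ler_normr => /orP[|H]; [constructor 3|constructor 4; lra].
Qed.

(** With T the translation by x, the lower left entries of S T S and S T U are 16 x / 3 and 8 r (1 +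
    2 x) / 3. The gap for the first gives x = 0 or |x| >= sqrt 3 / 4; for the second it gives x >= -
    1 / 4, and the inverse of T gives x <= 1 / 4. *)
Lemma G3_unipotent_small x : -1/2 <= x <= 1/2 -> G3 (mk 1 x 0 1) -> x = 0.
Proof.
have gt := sqrt3_gt; have lt := sqrt3_lt; have q := sqrt3_sq.
have SS y : G3 (mk 1 y 0 1) -> [\/ y = 0, r / 4 <= y | y <= - (r / 4)].
  move=> yG; have := G3_row_cases (G3M (G3M G3S yG) G3S).
  rewrite !mulmk !mkE => -[[H _]|[H _]|H|H].
  - constructor 1; apply/eqP; have : y * 16 = 0 by rewrite -[RHS](mulr0 3) -H; field: q.
    by move/eqP; rewrite mulf_eq0 => /orP[//|/eqP]; lra.
  - constructor 1; apply/eqP; have : y * 16 = 0 by rewrite -[RHS](mulr0 3) -H; field: q.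
    by move/eqP; rewrite mulf_eq0 => /orP[//|/eqP]; lra.
  - by constructor 2; nra.
  - by constructor 3; nra.
have SU y : -1/2 <= y <= 1/2 -> G3 (mk 1 y 0 1) -> -1/4 <= y.
  move=> yh yG; have := G3_row_cases (G3M (G3M G3S yG) G3U).
  rewrite !mulmk !mkE => -[[H1 H2]|[H1 H2]|H|H].
  (* The entry vanishes at y = - 1 / 2, where the lower right entry is - r / 3 instead of 1 or
     -1. *)
  - exfalso; have E : y = -1/2 by apply: (mulfI (_ : r != 0)); [rewrite gt_eqF//; lra|lra].
    by move: H2; rewrite E; lra.
  - exfalso; have E : y = -1/2 by apply: (mulfI (_ : r != 0)); [rewrite gt_eqF//; lra|lra].
    by move: H2; rewrite E; lra.
  - suff : r * (-1/4) <= r * y by rewrite sqrt3_scale_le.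
    by lra.
  - exfalso; have : r * y <= r * (-3/4) by lra.
    by rewrite sqrt3_scale_le; lra.
move=> xh xG; have xG' : G3 (mk 1 (- x) 0 1) by have := G3inv_mk xG; rewrite oppr0.
have xh' : -1/2 <= - x <= 1/2 by lra.
have H1 := SU _ xh xG; have H2 := SU _ xh' xG'.
by case: (SS _ xG) => [//|xr|xr]; exfalso; lra.
Qed.

Lemma mul_translation_mk x (a b c d : R) :
  translation x *m mk a b c d = mk (a + x * c) (b + x * d) c d.
Proof. by rewrite translationE mulmk; congr mk; ring. Qed.

Lemma mul_mk_translation x (a b c d : R) :
  mk a b c d *m translation x = mk a (a * x + b) c (c * x + d).
Proof. by rewrite translationE mulmk; congr mk; ring. Qed.

Lemma G3_unipotent x : G3 (mk 1 x 0 1) -> exists m : int, x = m%:~R.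
Proof.
move=> xG; exists (Num.floor (x + 1 / 2)).
set m := Num.floor _.
have : G3 (mk 1 (x - m%:~R) 0 1).
  have := G3M xG (G3T (- m)); rewrite mul_mk_translation.
  by congr (G3 (mk _ _ _ _)); rewrite ?mulrNz; ring.
move/G3_unipotent_small => E; apply/eqP; rewrite -subr_eq0; apply/eqP/E.
have := floor_le (x + 1 / 2); have := lt_succ_floor (x + 1 / 2).
by rewrite -/m intrD1; lra.
Qed.

Lemma G3_lower0 g : G3 g -> g 1 0 = 0 ->
  exists m : int, g = translation m%:~R \/ g = - translation m%:~R.
Proof.
move=> gG g0; have := G3_SL2 gG; have := G3_row_cases gG.
have q := sqrt3_gt.
rewrite [g]mkP !mkE g0 detmk mulr0 subr0 => -[[_ d1]|[_ d1]| |]; last 2 first.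
- by lra.
- by lra.
- rewrite d1 mulr1 => a1.
  have H : G3 (mk 1 (g 0 1) 0 1) by move: gG; rewrite {1}[g]mkP g0 d1 a1.
  have [m mE] := G3_unipotent H; exists m; left.
  by rewrite mE a1 translationE.
- rewrite d1 mulrN1 => a1.
  have H : G3 (mk 1 (- g 0 1) 0 1).
    by move: (G3N gG); rewrite {1}[g]mkP g0 d1 oppmk opprK oppr0 a1.
  have [m mE] := G3_unipotent H; exists m; right.
  by rewrite translationE oppmk -mE opprK oppr0 -a1 opprK.
Qed.

Lemma invmx_mk g : \det g = 1 ->
  invmx g = mk (g 1 1) (- g 0 1) (- g 1 0) (g 0 0).
Proof.
by move=> D; rewrite [in LHS](mkP g) invmk// -[RHS]D [in RHS](mkP g) detmk.
Qed.

(** The determinant of the two bottom rows is the lower left entry of h g^-1, so the gap separates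
    elements lying in different cosets of the stabilizer of infinity. *)
Lemma G3_rows g h : G3 g -> G3 h ->
  (exists m : int, h = translation m%:~R *m g \/ h = - (translation m%:~R *m g)) \/
  4 * r / 3 <= `|h 1 0 * g 1 1 - h 1 1 * g 1 0|.
Proof.
move=> gG hG; have := G3_row (G3M hG (G3V' gG)).
have E : (h *m invmx g) 1 0 = h 1 0 * g 1 1 - h 1 1 * g 1 0.
  by rewrite invmx_mk ?G3_SL2// mulmk_row; ring.
move=> [[H _]|]; last by rewrite E; right.
left; have [m mE] := G3_lower0 (G3M hG (G3V' gG)) H; exists m.
case: mE => {}E; [left|right].
  by rewrite -E mulmxKV// G3unit.
by rewrite -mulNmx -E mulmxKV// G3unit.
Qed.

(** A translation brings the pole p = - d / c into ]0, 1], and p = 1 yields the entry of S.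
    Otherwise the products with S keep p at distance at least 1 / c from 0 and 1; then the products
    with V and with T S V S force 3 / 8 + 1 / (2 c) <= p <= 5 / 8 - 1 / (2 c), whence c >= 4. *)
Lemma G3_second_row g : G3 g -> `|g 1 0| < 4 ->
  g 1 0 = 0 \/ `|g 1 0| = 4 * r / 3.
Proof.
wlog c0 : g / 0 <= g 1 0.
  move=> H gG; case: (leP 0 (g 1 0)) => [|/ltW] c0; first exact: H.
  have := H (- g) _ (G3N gG); rewrite !mxE oppr_ge0 normrN => /(_ c0) H' /H'.
  by case=> [/eqP|]; [rewrite oppr_eq0 => /eqP; left|right].
rewrite (ger0_norm c0) => gG c4.
have [->|cn0] := eqVneq (g 1 0) 0; first by left.
right; set c := g 1 0 in c0 c4 cn0 *.
have cp : 0 < c by rewrite lt_neqAle eq_sym cn0.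
have gt := sqrt3_gt; have lt := sqrt3_lt; have q := sqrt3_sq.
(* The extra - 1 places the new d in [- c, 0[ rather than in [0, c[. *)
have := G3M gG (G3T (- Num.floor (g 1 1 / c) - 1)).
rewrite {1}[g]mkP mul_mk_translation -/c.
set d := _ + g 1 1.
have [dl du] : - c <= d /\ d < 0.
  have := floor_le (g 1 1 / c); have := lt_succ_floor (g 1 1 / c).
  rewrite /d !intrD !mulrNz.
  set f := (Num.floor _)%:~R; rewrite ltr_pdivrMr// ler_pdivlMr// => H1 H2.
  by split; lra.
move: (g 0 0) (_ + g 0 1) => a b hG.
have hT := G3M hG G3T1; move: hT; rewrite mul_mk_translation.
set e := c * 1 + d; move: (a * 1 + b) => b' hT.
have ce : e = c + d by rewrite /e mulr1.
have hS := G3_row_cases (G3M hG G3S).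
have hTS := G3_row_cases (G3M hT G3S).
have hV := G3_row_cases (G3M hG G3V).
have hTV := G3_row_cases (G3M (G3M (G3M hT G3S) G3V) G3S).
have r0 : 0 < r by lra.
have rI x y : r * x = r * y -> x = y by move=> /(mulfI (lt0r_neq0 r0)).
have rL x y : r * x <= r * y -> x <= y by rewrite sqrt3_scale_le.
have d1 : d <= -1.
  move: hS; rewrite !mulmk !mkE => -[[H _]|[H _]|H|H].
  - by have := rI d 0 ltac:(lra); lra.
  - by have := rI d 0 ltac:(lra); lra.
  - by have := rL 1 d ltac:(lra); lra.
  - by apply: rL; lra.
have [e0|e1] : c * r = 4 \/ 1 <= e.
  move: hTS; rewrite !mulmk !mkE => -[[H1 H2]|[H1 H2]|H|H].
  - by left; nra.
  - by left; lra.
  - by right; apply: rL; lra.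
  - by have := rL e (-1) ltac:(lra); lra.
  by rewrite -e0; field: q.
have h1 : c + 8 * d / 3 <= -4 / 3.
  move: hV; rewrite !mulmk !mkE => -[[H1 H2]|[H1 H2]|H|H].
  - by have := rI (c + 8 * d / 3) 0 ltac:(lra); nra.
  - by have := rI (c + 8 * d / 3) 0 ltac:(lra); nra.
  - by have := rL (4 / 3) (c + 8 * d / 3) ltac:(lra); lra.
  - by apply: rL; lra.
have h2 : 3 * c / 4 - 2 * e <= -1.
  move: hTV; rewrite !mulmk !mkE.
  set u := (_ * 0 + _ * (4 * r / 3)); set w := (_ * - (r / 4) + _).
  have -> : u = r * (4 * (3 * c / 4 - 2 * e) / 3) by rewrite /u; field: q.
  have -> : w = r * (c / 2 - e) by rewrite /w; field: q.
  move=> [[H1 H2]|[H1 H2]|H|H].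
  - by have := rI (4 * (3 * c / 4 - 2 * e) / 3) 0 ltac:(lra); nra.
  - by have := rI (4 * (3 * c / 4 - 2 * e) / 3) 0 ltac:(lra); nra.
  - by have := rL (4/3) (4 * (3 * c / 4 - 2 * e) / 3) ltac:(lra); lra.
  - by have := rL (4 * (3 * c / 4 - 2 * e) / 3) (-4/3) ltac:(lra); lra.
by lra.
Qed.

(** * Traces and reduction within a conjugacy class *)

Lemma conj_translation_mk x (a b c d : R) :
  translation x *m mk a b c d *m translation (- x) =
  mk (a + x * c) ((a + x * c) * - x + (b + x * d)) c (d - x * c).
Proof. by rewrite mul_translation_mk mul_mk_translation; congr mk; ring. Qed.

Lemma invmx_conj k h g : G3 k -> G3 h ->
  k *m (h *m g *m invmx h) *m invmx k = (k *m h) *m g *m invmx (k *m h).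
Proof.
move=> kG hG; suff -> : invmx (k *m h) = invmx h *m invmx k by rewrite !mulmxA.
rewrite -[RHS](mulKmx (G3unit (G3M kG hG))) !mulmxA.
by rewrite !mulmxK ?G3unit.
Qed.

Lemma invmx_translation (x : R) : invmx (translation x) = translation (- x).
Proof. by rewrite !translationE invmk; [rewrite oppr0|ring]. Qed.

(* One step of a reduction in the conjugacy class: if D = tr^2 - 4 is small,
   the isometric circle of S or of U, up to translation, contains the fixed
   points. *)
Lemma G3_conj_step (q : R) g : 3 / 4 <= q -> G3 g -> g 1 0 != 0 ->
  4 <= (\tr g) ^+ 2 -> (\tr g) ^+ 2 - 4 <= 4 * q / 3 ->
  exists2 h, G3 h & `|(h *m g *m invmx h) 1 0| <= q * `|g 1 0|.
Proof.
move=> q34 gG c0 t4 tq.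
have D := G3_SL2 gG; have c2 : 16 / 3 <= (g 1 0) ^+ 2.
  have := sqrt3_gt; have := sqrt3_lt; have := sqrt3_sq.
  by case: (G3_row_cases gG) => [[/eqP]|[/eqP]||]; rewrite ?(negPf c0)// => H; nra.
move: gG c0 t4 tq D c2; rewrite [g]mkP !mkE trmk detmk.
move: (g 0 0) (g 0 1) (g 1 0) (g 1 1) => {g} a b c d gG c0 t4 tq D c2.
have q3 := sqrt3_sq.
(* The midpoint of the fixed points, shifted into [- 3 / 8, 5 / 8]: the isometric circles of S and
   of U meet above 3 / 8. *)
pose x := (a - d) / (2 * c) + (- Num.floor ((a - d) / (2 * c) + 3 / 8))%:~R.
set m := (- _ : int) in x.
have xh : -3 / 8 <= x <= 5 / 8.
  have := floor_le ((a - d) / (2 * c) + 3 / 8).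
  have := lt_succ_floor ((a - d) / (2 * c) + 3 / 8).
  by rewrite /x /m mulrNz intrD1; lra.
have hE := conj_translation_mk m%:~R a b c d.
have TG := G3T m.
have hG : G3 (translation m%:~R *m mk a b c d *m translation (- m%:~R)).
  by rewrite -mulrNz; apply: G3M; [apply: G3M => //|]; exact: G3T.
move: hE hG; set a' := a + _; set b' := (_ + (b + _)); set d' := (d - _).
move=> hE hG.
have ad : a' = d' + 2 * x * c by rewrite /a' /d' /x; field.
have td : a' + d' = a + d by rewrite /a' /d'; ring.
have D' : a' * d' - b' * c = 1 by rewrite -detmk -hE G3_SL2.
have bc : b' * c = ((a + d) ^+ 2 - 4) / 4 - (x * c) ^+ 2.
  have -> : b' * c = a' * d' - 1 by rewrite -D'; ring.
  by rewrite -td ad; field.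
(* After multiplication by c the new entry depends only on b' c and (a' - d') c, that is, on (x
   c)^2, x c^2, c^2 and tr^2 - 4. *)
have hk k : G3 k ->
    `|(k *m mk a' b' c d' *m invmx k) 1 0 * c| <= q * c ^+ 2 ->
    exists2 h, G3 h & `|(h *m mk a b c d *m invmx h) 1 0| <= q * `|c|.
  move=> kG; rewrite -hE -invmx_translation invmx_conj// => kc.
  exists (k *m translation m%:~R); first exact: G3M.
  have cn0 : 0 < `|c| by rewrite normr_gt0.
  by rewrite -(ler_pM2r cn0) -normrM -mulrA -normrM -expr2 (ger0_norm (sqr_ge0 _)).
have D1p : 0 <= (a + d) ^+ 2 - 4 by lra.
move: ((a + d) ^+ 2 - 4) tq bc D1p => D1 tq bc D1p.
have cp := sqr_ge0 c.
(* The conjugation by S costs at most 16 / 3 * (3 / 8)^2 = 3 / 4 times c^2. The term 4 (tr^2 - 4) <=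
   16 q / 3 occurring with U is absorbed because c^2 >= 16 / 3; this is where the threshold 16 / 3
   for tr^2 comes from. *)
have A1 : 3 / 4 * c ^+ 2 <= q * c ^+ 2 by rewrite ler_wpM2r.
have A3 : q * (16 / 3) <= q * c ^+ 2 by rewrite ler_wpM2l//; lra.
have [x38|x38] := leP x (3 / 8).
- apply: (hk _ G3S); rewrite invmx_mk ?G3_SL2//; last exact: G3S.
  rewrite !mulmk !mkE.
  have -> : ((4 * r / 3 * a' + 0 * c) * 0 + (4 * r / 3 * b' + 0 * d') * - (4 * r / 3)) * c = - (16 / 3 * (b' * c)).
    by field: q3.
  rewrite bc ler_norml exprMn.
  have x2 : x ^+ 2 <= 9 / 64 by nra.
  have A2 : x ^+ 2 * c ^+ 2 <= 9 / 64 * c ^+ 2 by rewrite ler_wpM2r.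
  have A4 : 0 <= x ^+ 2 * c ^+ 2 by rewrite mulr_ge0 ?sqr_ge0.
  by apply/andP; split; lra.
- apply: (hk _ G3U); rewrite invmx_mk ?G3_SL2//; last exact: G3U.
  rewrite !mulmk !mkE.
  set L := (X in `|X|).
  have -> : L = 16 * ((x - 1 / 2) ^+ 2 * c ^+ 2) - 4 * D1.
    have -> : L = 4 * c ^+ 2 - 8 * (a' - d') * c - 16 * (b' * c) by rewrite /L; ring.
    by rewrite bc ad; field.
  have x2 : (x - 1 / 2) ^+ 2 <= 1 / 64 by nra.
  have A2 : (x - 1 / 2) ^+ 2 * c ^+ 2 <= 1 / 64 * c ^+ 2 by rewrite ler_wpM2r.
  have A4 : 0 <= (x - 1 / 2) ^+ 2 * c ^+ 2 by rewrite mulr_ge0 ?sqr_ge0.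
  by rewrite ler_norml; apply/andP; split; lra.
Qed.

(** Each step multiplies the lower left entry by at most q < 1, whereas a nonzero entry is at least
    4 / sqrt 3, so the descent has to reach 0. The value 4 of the squared trace is included in order
    to treat parabolic elements, hence cusps, by the same reduction. *)
Lemma G3_conj_lower0 g : G3 g -> 4 <= (\tr g) ^+ 2 < 16 / 3 ->
  exists2 h, G3 h & (h *m g *m invmx h) 1 0 = 0.
Proof.
move=> gG /andP[t4 t16].
(* The least factor that the reduction step allows; it is below 1 because tr^2 < 16 / 3. *)
pose q := Num.max (3 / 4) (3 * ((\tr g) ^+ 2 - 4) / 4).
have q34 : 3 / 4 <= q by rewrite le_max lexx.
have q1 : q < 1 by rewrite gt_max; apply/andP; split; lra.
have tq : (\tr g) ^+ 2 - 4 <= 4 * q / 3.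
  have : 3 * ((\tr g) ^+ 2 - 4) / 4 <= q by rewrite le_max lexx orbT.
  by lra.
have trJ h : G3 h -> \tr (h *m g *m invmx h) = \tr g.
  by move=> hG; rewrite -mulmxA mxtrace_mulC mulmxKV// G3unit.
apply: contrapT => H.
have N h : G3 h -> (h *m g *m invmx h) 1 0 != 0.
  by move=> hG; apply/eqP => E; apply: H; exists h.
have I n : exists2 h, G3 h & `|(h *m g *m invmx h) 1 0| <= q ^+ n * `|g 1 0|.
  elim: n => [|n [h hG hn]].
    by exists 1%:M; [exact: G3_1|rewrite invmx1 mul1mx mulmx1 expr0 mul1r].
  have jG : G3 (h *m g *m invmx h) by apply: G3M; [exact: G3M|exact: G3V'].
  have [k kG kn] := @G3_conj_step q _ q34 jG (N h hG) ltac:(rewrite trJ//) ltac:(rewrite trJ//).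
  exists (k *m h); first exact: G3M.
  rewrite -invmx_conj//; apply: le_trans kn _.
  by rewrite exprS -mulrA ler_wpM2l//; lra.
have [n nq] : exists n, q ^+ n * `|g 1 0| < 1.
  have : (fun n => q ^+ n * `|g 1 0|) @ \oo --> 0 * `|g 1 0|.
    by apply: cvgMl; apply: cvg_expr; rewrite ger0_norm; lra.
  rewrite mul0r => /cvgr_lt/(_ 1 ltr01)[n _ nH].
  by exists n; apply: nH => /=.
have [h hG hn] := I n.
have jG : G3 (h *m g *m invmx h) by apply: G3M; [exact: G3M|exact: G3V'].
have [[/eqP]|] := G3_row jG; first by rewrite (negPf (N h hG)).
by have := sqrt3_gt; lra.
Qed.

Lemma G3_trace g : G3 g -> 4 < (\tr g) ^+ 2 -> 16 / 3 <= (\tr g) ^+ 2.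
Proof.
move=> gG t4; rewrite leNgt; apply/negP => t16.
have [h hG h0] := G3_conj_lower0 gG ltac:(rewrite (ltW t4) t16//).
have jG : G3 (h *m g *m invmx h) by apply: G3M; [exact: G3M|exact: G3V'].
have E : \tr (h *m g *m invmx h) = \tr g.
  by rewrite -mulmxA mxtrace_mulC mulmxKV// G3unit.
have [m] := G3_lower0 jG h0; move: t4; rewrite -E => t4.
case => H; move: t4; rewrite H translationE ?oppmk trmk; first by lra.
by lra.
Qed.

End HalfTurnGroup.

(** * Fundamental domain and limit set *)

Section MobiusAction.
Variable R : realType.
Implicit Types (g h : 'M[R]_2) (z w : R[i]).

(** The squared modulus of the automorphy factor c z + d. *)
Definition den g z : R :=
  (g 1 0 * complex.Re z + g 1 1) ^+ 2 + (g 1 0 * complex.Im z) ^+ 2.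

Lemma den_gt0 g z : \det g = 1 -> 0 < complex.Im z -> 0 < den g z.
Proof.
rewrite [g]mkP detmk /den !mkE => D z0.
rewrite lt0r paddr_eq0 ?sqr_ge0// addr_ge0 ?sqr_ge0// andbT !sqrf_eq0.
apply/negP => /andP[/eqP H1]; rewrite mulf_eq0 (gt_eqF z0) orbF => /eqP c0.
by move: H1 D; rewrite c0 mul0r add0r => ->; rewrite !mulr0 subrr => /eqP; rewrite eq_sym oner_eq0.
Qed.

Lemma mobE g z : \det g = 1 -> 0 < complex.Im z ->
  mob g z = ((g 0 0 * complex.Re z + g 0 1) * (g 1 0 * complex.Re z + g 1 1) +
             g 0 0 * g 1 0 * complex.Im z ^+ 2) / den g z +i*
            (complex.Im z / den g z).
Proof.
move=> D z0; have := den_gt0 D z0.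
case: z z0 => x y /= y0; move: D; rewrite [g]mkP detmk /mob /den !mkE /=.
move: (g 0 0) (g 0 1) (g 1 0) (g 1 1) => a b c d D n0.
apply/esym/(canRL (mulfK _)).
  rewrite eq_complex /= !(mul0r, subr0, addr0, add0r).
  apply/negP => /andP[/eqP H1 /eqP H2]; move: n0; rewrite H1 H2.
  by rewrite expr0n addr0 ltxx.
have nn := lt0r_neq0 n0.
have bc : b * c = a * d - 1 by rewrite -D; ring.
by apply/eqP; rewrite eq_complex /=; apply/andP; split; apply/eqP; field: bc.
Qed.

Lemma mob_Im g z : \det g = 1 -> 0 < complex.Im z ->
  complex.Im (mob g z) = complex.Im z / den g z.
Proof. by move=> D z0; rewrite mobE. Qed.

Lemma mob_Im_gt0 g z : \det g = 1 -> 0 < complex.Im z ->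
  0 < complex.Im (mob g z).
Proof. by move=> D z0; rewrite mob_Im// divr_gt0// den_gt0. Qed.

Lemma mob1 z : mob 1%:M z = z.
Proof.
by rewrite /mob mk1 !mkE mul0r add0r mul1r addr0 divr1.
Qed.

Lemma mob_translation x z : mob (translation x) z = z + x%:C.
Proof.
by rewrite /mob translationE !mkE mul0r add0r mul1r divr1.
Qed.

Lemma mobN g z : mob (- g) z = mob g z.
Proof.
by rewrite /mob !mxE !rmorphN /= !mulNr -!opprD invrN mulrNN.
Qed.

Lemma mobM g h z : \det g = 1 -> \det h = 1 -> 0 < complex.Im z ->
  mob (g *m h) z = mob g (mob h z).
Proof.
have nz (k : 'M[R]_2) w : \det k = 1 -> 0 < complex.Im w -> (k 1 0)%:C * w + (k 1 1)%:C != 0 :> R[i].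
  move=> D w0; have := den_gt0 D w0; case: w w0 => x y /= _; rewrite /den /=.
  apply: contraTneq => /eqP; rewrite eq_complex /= !(mul0r, subr0, addr0, add0r).
  by move=> /andP[/eqP -> /eqP ->]; rewrite expr0n addr0 ltxx.
move=> Dg Dh z0; have n1 := nz h z Dh z0.
have n2 := nz g _ Dg (mob_Im_gt0 Dh z0).
have n3 : ((g *m h) 1 0)%:C * z + ((g *m h) 1 1)%:C != 0.
  by apply: nz => //; rewrite det_mulmx Dg Dh mulr1.
move: n2 n3; rewrite /mob [g]mkP [h]mkP mulmk !mkE !rmorphD !rmorphM /=.
move: n1; move: ((g 0 0)%:C) ((g 0 1)%:C) ((g 1 0)%:C) ((g 1 1)%:C).
move: ((h 0 0)%:C) ((h 0 1)%:C) ((h 1 0)%:C) ((h 1 1)%:C).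
move=> a b c d a' b' c' d' n1 n2 n3.
field; rewrite n1 ?andbT /=; apply: (contraNneq _ n3) => H; apply/eqP; rewrite -H; ring.
Qed.

(** The cocycle relation is read off from the imaginary parts in [mobM], which avoids expanding the
    squares. *)
Lemma denM g h z : \det g = 1 -> \det h = 1 -> 0 < complex.Im z ->
  den (g *m h) z = den g (mob h z) * den h z.
Proof.
move=> Dg Dh z0.
have Dgh : \det (g *m h) = 1 by rewrite det_mulmx Dg Dh mulr1.
have := mob_Im Dgh z0; rewrite mobM// mob_Im ?mob_Im_gt0// mob_Im//.
have d1 := den_gt0 Dh z0; have d2 := den_gt0 Dgh z0.
have d3 := den_gt0 Dg (mob_Im_gt0 Dh z0).
move=> H; apply: (mulfI (lt0r_neq0 (divr_gt0 z0 (mulr_gt0 d2 (mulr_gt0 d3 d1))))).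
transitivity (complex.Im z / (den g (mob h z) * den h z)).
  by field; rewrite !lt0r_neq0.
transitivity (complex.Im z / den (g *m h) z); last by field; rewrite !lt0r_neq0.
by rewrite -H; field; rewrite !lt0r_neq0.
Qed.

Lemma den_N g z : den (- g) z = den g z.
Proof. by rewrite /den !mxE; ring. Qed.

Lemma den_translation g x z : den (translation x *m g) z = den g z.
Proof. by rewrite /den [g]mkP mul_translation_mk !mkE. Qed.

End MobiusAction.

(** * Separation and local finiteness of bottom rows *)

Section BottomRows.
Variable R : realType.
Implicit Types (g h : 'M[R]_2) (z w : R[i]).
Local Notation r := (Num.sqrt 3 : R).
Local Notation G3 := (@G3 R).

(* A pair (c, p) encodes the bottom row (c, c p). *)
Definition rows : set (R * R) :=
  [set q | 0 < q.1 /\ exists g, [/\ G3 g, g 1 0 = q.1 & g 1 1 = q.1 * q.2]].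

(** The right-hand side is the absolute determinant of two bottom rows. If the gap fails, the rows
    agree up to sign, and positivity of c removes the sign. *)
Lemma rows_sep (q q' : R * R) : rows q -> rows q' -> q <> q' ->
  4 * r / 3 <= q.1 * q'.1 * `|q.2 - q'.2|.
Proof.
case: q q' => [c p] [c' p'] /= [/= c0 [g [gG g0 g1]]] [/= c0' [h [hG h0 h1]]] ne.
have [[m hm]|] := G3_rows hG gG; last first.
  rewrite g0 g1 h0 h1 => H; apply: le_trans H _.
  have -> : c * (c' * p') - c * p * c' = - (c * c' * (p - p')) by ring.
  by rewrite normrN normrM ger0_norm// mulr_ge0// ltW.
exfalso; apply: ne.
have E : exists2 e : R, `|e| = 1 & g 1 0 = e * h 1 0 /\ g 1 1 = e * h 1 1.
  case: hm => ->; rewrite {1 3}[h]mkP mul_translation_mk.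
    by exists 1; rewrite ?normr1// !mkE !mul1r.
  by exists (-1); rewrite ?normrN1// oppmk !mkE !mulN1r.
case: E => e e1; rewrite g0 g1 h0 h1 => -[E1 E2].
have ce : c = c'.
  by rewrite -(ger0_norm (ltW c0)) E1 normrM e1 mul1r ger0_norm// ltW.
have e_1 : e = 1.
  by apply: (mulIf (lt0r_neq0 c0')); rewrite -E1 mul1r.
rewrite ce; congr (_, _); apply: (mulfI (lt0r_neq0 c0')).
by rewrite -{1}ce E2 e_1 mul1r.
Qed.

Lemma rows_ge q : rows q -> 4 * r / 3 <= q.1.
Proof.
move=> [q0 [g [gG g0 _]]].
have [[H _]|] := G3_row gG; first by move: q0; rewrite -g0 H ltxx.
by rewrite g0 ger0_norm// ltW.
Qed.

(** The number, counted from A, of the cell of length X^-2 containing p. By [rows_sep], two distinct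
    rows with c <= X have their p more than X^-2 apart and never share a cell, which turns
    separation into counting. *)
Definition row_index (X A : R) (q : R * R) : nat := Num.truncn ((q.2 - A) * X ^+ 2).

Lemma row_index_inj X A q q' : rows q -> rows q' -> q.1 <= X -> q'.1 <= X ->
  A <= q.2 -> A <= q'.2 -> row_index X A q = row_index X A q' -> q = q'.
Proof.
move=> qr qr' qX qX' qA qA' E; apply: contrapT => ne.
have := rows_sep qr qr' ne.
have := sqrt3_gt R; have q0 := rows_ge qr; have q0' := rows_ge qr'.
move=> r1 H.
have X0 : 0 < X by lra.
have p0 : 0 <= (q.2 - A) * X ^+ 2 by rewrite mulr_ge0 ?sqr_ge0// subr_ge0.
have p0' : 0 <= (q'.2 - A) * X ^+ 2 by rewrite mulr_ge0 ?sqr_ge0// subr_ge0.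
have := truncn_itv p0; have := truncn_itv p0'; rewrite -/(row_index _ _ _).
rewrite -/(row_index _ _ q') -/(row_index X A q) E -natr1.
move: (_%:R) => n /andP[a1 a2] /andP[b1 b2].
have : q.1 * q'.1 * `|q.2 - q'.2| <= X ^+ 2 * `|q.2 - q'.2|.
  by rewrite ler_wpM2r// expr2 ler_pM//; lra.
have : X ^+ 2 * `|q.2 - q'.2| < 1.
  rewrite -{1}(ger0_norm (sqr_ge0 X)) -normrM ltr_norml.
  by apply/andP; split; lra.
by lra.
Qed.

Lemma row_index_lt X A B q : 0 <= X -> A <= q.2 -> q.2 < B ->
  (row_index X A q < (Num.truncn ((B - A) * X ^+ 2)).+1)%N.
Proof.
move=> X0 qA qB; rewrite /row_index ltnS; apply: le_truncn.
by rewrite ler_wpM2r ?sqr_ge0// lerB// ltW.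
Qed.

Lemma finite_set_inj (T : pointedType) (D : set T) (f : T -> nat) N :
  {in D &, injective f} -> (forall x, D x -> (f x < N)%N) -> finite_set D.
Proof.
move=> fI fN; apply: (@sub_finite_set _ _
  ((fun n => xget point (D `&` f @^-1` [set n])) @` [set k | (k < N)%N])).
  move=> x Dx; exists (f x); first exact: fN.
  have [] := @xgetPex _ point (D `&` f @^-1` [set f x]); first by exists x.
  by move=> H1 H2; apply: fI; rewrite ?inE.
by apply: finite_image; exact: finite_II.
Qed.

Lemma rows_finite X A B :
  finite_set [set q | [/\ rows q, q.1 <= X, A <= q.2 & q.2 < B]].
Proof.
have [X0|X0] := ltP X 0.
  rewrite (_ : [set _ | _] = set0)//; apply/seteqP; split => // q [/rows_ge qr qX _ _].
  by have := sqrt3_gt R; lra.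
apply: (@finite_set_inj _ _ (row_index X A)
  (Num.truncn ((B - A) * X ^+ 2)).+1).
  move=> q q'; rewrite !inE => -[? ? ? ?] [? ? ? ?].
  exact: (@row_index_inj X A).
by move=> q [_ _ ? ?]; exact: row_index_lt.
Qed.

Lemma finite_set_argmin (T : eqType) (D : set T) (f : T -> R) :
  finite_set D -> D !=set0 -> exists2 x, D x & forall y, D y -> f x <= f y.
Proof.
move=> /finite_seqP[s ->] [x0 /= x0s].
have H : exists2 x, x \in s & forall y, y \in s -> f x <= f y; last first.
  by case: H => x xs xm; exists x.
elim: s x0 x0s => // a s IH x0 _.
case: s IH => [_|b s IH].
  by exists a; rewrite ?mem_head// => y; rewrite inE => /eqP ->.
have [x xs xm] := IH b (mem_head _ _).
have [ax|/ltW xa] := leP (f a) (f x).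
  exists a; first exact: mem_head.
  by move=> y; rewrite in_cons => /orP[/eqP ->//|/xm]; exact: le_trans.
exists x; first by rewrite in_cons xs orbT.
by move=> y; rewrite in_cons => /orP[/eqP ->//|/xm].
Qed.

Lemma G3_rowsP g : G3 g -> g 1 0 != 0 -> rows (`|g 1 0|, g 1 1 / g 1 0).
Proof.
move=> gG g0; split => /=; first by rewrite normr_gt0.
have [c0|c0] := ltP 0 (g 1 0).
  by exists g; rewrite ger0_norm ?(ltW c0)//; split => //; field.
exists (- g); rewrite ler0_norm// !mxE; split; [exact: G3N|by []|].
by field.
Qed.

(** The value of [den] in the coordinates (c, p), namely |c (z + p)|^2. *)
Definition rnorm (q : R * R) z : R :=
  q.1 ^+ 2 * ((complex.Re z + q.2) ^+ 2 + complex.Im z ^+ 2).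

Lemma den_rnorm g z : g 1 0 != 0 -> den g z = rnorm (`|g 1 0|, g 1 1 / g 1 0) z.
Proof.
by move=> g0; rewrite /den /rnorm /= real_normK ?num_real//; field.
Qed.

Lemma rnorm_den q z : rows q -> exists2 g, G3 g & den g z = rnorm q z.
Proof.
move=> [q0 [g [gG g0 g1]]]; exists g => //.
by rewrite /den /rnorm g0 g1; ring.
Qed.

(** Only rows with |c z + d| < 1 compete with the identity. They satisfy c <= 1 / y and |x + p| < 1,
    so there are finitely many of them. *)
Lemma G3_den_min z : 0 < complex.Im z ->
  exists2 g, G3 g & forall h, G3 h -> den g z <= den h z.
Proof.
case: z => x y /= y0; set z := x +i* y.
pose D := [set q | [/\ rows q, q.1 <= y^-1, - x - 1 <= q.2 & q.2 < - x + 2]].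
have smallD h : G3 h -> den h z < 1 ->
    exists2 q, D q & den h z = rnorm q z.
  move=> hG h1.
  have h0 : h 1 0 != 0.
    apply/eqP => h0; have [[_ h11]|] := G3_row hG; last first.
      by rewrite h0 normr0; have := sqrt3_gt R; lra.
    move: h1; rewrite /den /= h0 !mul0r add0r expr0n addr0.
    by rewrite -real_normK ?num_real// h11 expr1n ltxx.
  exists (`|h 1 0|, h 1 1 / h 1 0); last exact: den_rnorm.
  have hR := G3_rowsP hG h0; move: h1; rewrite den_rnorm//.
  move: hR; move: (`|_|) (_ / _) => c p hR; rewrite /rnorm /= => H.
  have c1 := rows_ge hR; rewrite /= in c1; have r1 := sqrt3_gt R.
  have c0 : 0 <= c by lra.
  have cy : c ^+ 2 * y ^+ 2 < 1.
    apply: le_lt_trans H; rewrite mulrDr lerDr mulr_ge0 ?sqr_ge0//.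
  have cx : c ^+ 2 * (x + p) ^+ 2 < 1.
    by apply: le_lt_trans H; rewrite mulrDr lerDl mulr_ge0 ?sqr_ge0.
  have xp : (x + p) ^+ 2 < 1 by nra.
  split => //=; [|by nra|by nra].
  rewrite -[y^-1]mul1r ler_pdivlMr//; nra.
have [[h hG h1]|H] := pselect (exists2 h, G3 h & den h z < 1); last first.
  exists 1%:M; first exact: G3_1.
  move=> h hG; rewrite {1}/den mk1 !mkE /= !mul0r add0r expr0n addr0 expr1n.
  by rewrite leNgt; apply/negP => ?; apply: H; exists h.
have [q0 q0D qE] := smallD h hG h1.
have := finite_set_argmin (rnorm ^~ z) (@rows_finite y^-1 (- x - 1) (- x + 2)).
case; first by exists q0.
move=> q [qr q1 q2 q3] qm; have [g gG gE] := rnorm_den z qr.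
exists g => // k kG; rewrite gE; have [k1|k1] := ltP (den k z) 1.
  by have [q' q'D ->] := smallD k kG k1; exact: qm.
by apply: le_trans k1; apply: ltW; apply: le_lt_trans h1; rewrite qE; exact: qm.
Qed.

End BottomRows.

(** * The Ford domain and its area *)

Section FordDomain.
Variable R : realType.
Implicit Types (g h : 'M[R]_2) (z w : R[i]).
Local Notation r := (Num.sqrt 3 : R).
Local Notation G3 := (@G3 R).

(** The part of a strip of width 1 outside all isometric circles. *)
Definition ford : set R[i] := [set z | [/\ 0 < complex.Im z,
  `|complex.Re z| <= 1 / 2 & forall g, G3 g -> 1 <= den g z]].

(** A minimum of |c z + d| is a point of maximal height in the orbit, and by the cocycle relation
    [den] is at least 1 there. A translation on the left does not change the height and adjusts the
    real part. *)
Lemma ford_cover z : 0 < complex.Im z -> exists2 g, G3 g & ford (mob g z).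
Proof.
move=> z0; have [g gG gm] := G3_den_min z0.
have gd := G3_SL2 gG; have w0 := mob_Im_gt0 gd z0.
set w := mob g z in w0; pose m : int := - Num.floor (complex.Re w + 1 / 2).
have Td : \det (translation m%:~R) = 1 :> R by rewrite translationE detmk; ring.
exists (translation m%:~R *m g); first by apply: G3M => //; exact: G3T.
split; first by rewrite mob_Im_gt0// det_mulmx Td gd mulr1.
  rewrite mobM// mob_translation -/w /= raddfD /=.
  have := floor_le (complex.Re w + 1 / 2); have := lt_succ_floor (complex.Re w + 1 / 2).
  by rewrite /m mulrNz intrD1 ler_norml => H1 H2; apply/andP; split; lra.
move=> h hG; have hd := G3_SL2 hG.
have TG := G3T R m.
have := gm _ (G3M hG (G3M TG gG)).
rewrite denM//; last by rewrite det_mulmx Td gd mulr1.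
rewrite den_translation => H.
by rewrite -(ler_pM2r (den_gt0 gd z0)) mul1r.
Qed.

Lemma den_G3S z : den (gS R) z = 16 / 3 * (complex.Re z ^+ 2 + complex.Im z ^+ 2).
Proof. by rewrite /den !mkE; field: (sqrt3_sq R). Qed.

Lemma ford_Im z : ford z -> 3 / 64 <= complex.Im z ^+ 2.
Proof.
move=> [z0 zr zd].
have H1 := zd _ (G3S R); rewrite den_G3S in H1.
have H2 := zd _ (G3U R); rewrite /den !mkE in H2.
have H3 := zd _ (G3M (G3U R) (G3T1 R)); rewrite mul_mk_translation /den !mkE in H3.
move: zr; rewrite ler_norml => /andP[zl zr].
have [z38|z38] := leP (complex.Re z) (3 / 8); last by nra.
have [z38'|z38'] := leP (- 3 / 8) (complex.Re z); last by nra.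
by nra.
Qed.

Lemma measurable_den_level g (P : set R) : measurable P ->
  measurable [set p : R * R | P (den g (p.1 +i* p.2))].
Proof.
move=> mP; rewrite -[X in measurable X]setTI.
have mf : measurable_fun setT (fun p : R * R => den g (p.1 +i* p.2)).
  rewrite /den /=; apply: measurable_funD; apply: measurable_funX.
    by apply: measurable_funD => //; apply: measurable_funM.
  by apply: measurable_funM.
exact: (mf measurableT P mP).
Qed.

Lemma measurable_ford : measurable [set p : R * R | ford (p.1 +i* p.2)].
Proof.
rewrite (_ : [set _ | _] = ([set p : R * R | 0 < p.2] `&`
   [set p | `|p.1| <= 1 / 2]) `&`
   \bigcap_(w : seq 'I_4) [set p : R * R | 1 <= den (word R w) (p.1 +i* p.2)]).
  apply: measurableI; first apply: measurableI.
  - rewrite -[X in measurable X]setTI.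
    by apply: (measurable_snd measurableT [set y : R | 0 < y]); rewrite -set_itvoy.
  - rewrite -[X in measurable X]setTI.
    apply: (measurable_fst measurableT [set y : R | `|y| <= 1 / 2]).
    rewrite (_ : [set _ | _] = `[- (1 / 2), 1 / 2]%classic)//.
    by apply/seteqP; split => y /=; rewrite in_itv /= ler_norml.
  (* Intersecting over words makes the intersection countable; integers that code no word repeat the
     condition of the empty word. *)
  - rewrite (_ : \bigcap_(w : seq 'I_4) _ = \bigcap_(n : nat)
      [set p : R * R | 1 <= den (word R (odflt [::] (unpickle n))) (p.1 +i* p.2)]).
      apply: bigcapT_measurable => n.
      set w := (X in word R X).
      apply: (@measurable_den_level (word R w) [set x : R | 1 <= x]).
      by rewrite -set_itvcy.
    apply/seteqP; split => p H.
      by move=> n _; exact: H.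
    by move=> w _; have := H (pickle w) I; rewrite pickleK.
apply/seteqP; split => p.
  by move=> [/= p0 p1 pd]; split => // w _ /=; apply: pd; exists w.
by move=> [[/= p0 p1] pd]; split => // g [w ->]; exact: pd.
Qed.

(** Compares the suprema over simple functions below the restricted integrands, and so applies to an
    overlap of translates whose measurability has not been established. *)
Lemma area_sub (A B : set R[i]) : A `<=` B -> (area A <= area B)%E.
Proof.
move=> AB; rewrite /area.
have y0 (p : R * R) : (0 <= (p.2 ^- 2)%:E)%E by rewrite lee_fin invr_ge0 sqr_ge0.
rewrite !ge0_integralE//; apply: le_ereal_sup => _ [f /= fA <-]; exists f => //=.
move=> p; apply: le_trans (fA p) _; rewrite /patch.
case: ifPn => [|_]; last by case: ifP.
by rewrite inE => Ap; rewrite mem_set//; exact: AB.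
Qed.

Lemma area_ge0 (A : set R[i]) : (0 <= area A)%E.
Proof. by apply: integral_ge0 => p _; rewrite lee_fin invr_ge0 sqr_ge0. Qed.

Lemma measurable_invsqr_snd :
  measurable_fun [set: R * R] (fun p : R * R => (p.2 ^- 2)%:E).
Proof.
apply/measurable_EFinP.
rewrite (_ : (fun _ => _) = (fun x : R => x `^ (-1)) \o (fun p : R * R => p.2 ^+ 2)).
  apply: measurableT_comp; first exact: measurable_powR.
  exact: measurable_funX.
by apply/funext => p /=; rewrite powR_inv1// sqr_ge0.
Qed.

Lemma area_null (A : set R[i]) :
  measurable [set p : R * R | A (p.1 +i* p.2)] ->
  (lebesgue_measure \x lebesgue_measure)%E [set p : R * R | A (p.1 +i* p.2)] = 0%E ->
  area A = 0%E.
Proof.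
move=> mA A0; rewrite /area; apply: null_set_integral => //.
exact: measurable_funS measurable_invsqr_snd.
Qed.

(** A vertical line meets the circle in at most two points. *)
Lemma area_circle g : \det g = 1 -> g 1 0 != 0 -> area [set z | den g z = 1] = 0%E.
Proof.
move=> Dg g0; apply: area_null.
  exact: (@measurable_den_level g [set 1]).
rewrite /product_measure1; apply: integral0_eq => x _ /=.
apply: countable_lebesgue_measure0.
pose k := Num.sqrt ((1 - (g 1 0 * x + g 1 1) ^+ 2) / g 1 0 ^+ 2).
apply: (@sub_countable _ _ _ [set k; - k]).
  apply: subset_card_le => y; rewrite /xsection /= inE /= /den /= => H.
  have E : y ^+ 2 = (1 - (g 1 0 * x + g 1 1) ^+ 2) / g 1 0 ^+ 2.
    by rewrite -H; field.
  have : y ^+ 2 == k ^+ 2 by rewrite /k sqr_sqrtr -E ?sqr_ge0.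
  by rewrite eqf_sqr => /orP[]/eqP ->; [left|right].
by apply: finite_set_countable.
Qed.

Lemma area_vertical (x : R) : area [set z | complex.Re z = x] = 0%E.
Proof.
have E : [set p : R * R | complex.Re (p.1 +i* p.2) = x] = [set x] `*` setT.
  by apply/seteqP; split => p /=; [|case].
apply: area_null; rewrite /= E; first exact: measurableX.
by rewrite product_measure1E//= lebesgue_measure_set1 mul0e.
Qed.

(** If z = g w with both points in the domain, then |c z + d|^2 for g^-1 at z and for g at w are
    both at least 1 and have product 1. Hence z lies on an isometric circle or, when g is a
    translation, on a vertical edge of the strip. *)
Lemma ford_overlap g : G3 g -> g <> 1%:M -> g <> - 1%:M ->
  area (ford `&` (mob g @` ford)) = 0%E.
Proof.
move=> gG g1 g1'; have Dg := G3_SL2 gG.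
have Dg' := G3_SL2 (G3V' gG).
have key z : ford z -> (mob g @` ford) z ->
    den (invmx g) z = 1 /\ exists2 w, ford w & z = mob g w.
  move=> zF [w wF wz]; have [z0 _ zd] := zF; have [w0 _ wd] := wF.
  split; last by exists w.
  apply/eqP; rewrite eq_le zd ?andbT; last exact: G3V'.
  have := wd _ gG; have : den (invmx g) z * den g w = 1.
    rewrite -wz -denM// mulVmx ?G3unit// /den mk1 !mkE.
    by rewrite !mul0r add0r expr1n expr0n addr0.
  have := den_gt0 Dg w0; have := den_gt0 Dg' z0; nra.
have [g0|g0] := eqVneq (g 1 0) 0; last first.
  apply/eqP; rewrite eq_le area_ge0 andbT.
  rewrite -(@area_circle (invmx g)) ?area_sub//.
    by move=> z [zF zg]; have [] := key z zF zg.
  by rewrite invmx_mk// !mkE oppr_eq0.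
have [m gm] := G3_lower0 gG g0.
have mobg z : mob g z = z + m%:~R%:C.
  by case: gm => ->; rewrite ?mobN mob_translation.
have m0 : m != 0.
  apply/eqP => m0; move: gm; rewrite m0 /translation scale0r addr0.
  by case=> [/g1|/g1'].
have sub (x : R) : (forall w, ford w -> ford (w + m%:~R%:C) -> complex.Re (w + m%:~R%:C) = x) ->
    area (ford `&` (mob g @` ford)) = 0%E.
  move=> H; apply/eqP; rewrite eq_le area_ge0 andbT -(area_vertical x) area_sub//.
  by move=> z [zF [w wF wz]]; move: zF; rewrite -wz mobg => zF /=; exact: H.
have [mp|mn] := ltP 0 m.
  apply: (sub (1 / 2)) => -[x y] [/= _ + _] [/= _ + _].
  have : 1 <= m%:~R :> R by rewrite -[1]/(1%:~R) ler_int.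
  by rewrite !ler_norml => H /andP[H1 H2] /andP[H3 H4]; lra.
apply: (sub (- (1 / 2))) => -[x y] [/= _ + _] [/= _ + _].
have : m%:~R <= -1 :> R by rewrite -[-1]/((-1)%:~R) ler_int; move: m0 mn; case: (m) => [[|k]|k].
by rewrite !ler_norml => H /andP[H1 H2] /andP[H3 H4]; lra.
Qed.

Lemma integral_invsqr (h : R) : 0 < h ->
  (\int[lebesgue_measure]_(y in `[h, +oo[) (y ^- 2)%:E = (h^-1)%:E)%E.
Proof.
move=> h0; rewrite (@ge0_continuous_FTC2y _ _ (fun y => - y^-1) _ 0).
- by rewrite EFinN oppeK add0e.
- by move=> y hy; rewrite invr_ge0 sqr_ge0.
- apply: continuous_in_subspaceT => y; rewrite inE /= in_itv /= andbT => hy.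
  apply: cvgV; first by rewrite expf_neq0// gt_eqF// (lt_le_trans h0).
  exact: exprn_continuous.
- rewrite -oppr0; apply: cvgN; apply/cvgrVy.
    by near=> y; rewrite invr_gt0.
  rewrite [X in X @ _ --> _](_ : _ = id); first exact: cvg_id.
  by apply/funext => y; exact: invrK.
- move=> y hy; have y0 : y != 0 by rewrite gt_eqF// (lt_trans h0).
  by apply: derivableN; exact: derivableV.
- apply: cvgN; apply: cvg_at_right_filter; apply: cvgV; first by rewrite gt_eqF.
  exact: cvg_id.
- move=> y; rewrite in_itv /= andbT => hy.
  have y0 : y != 0 by rewrite gt_eqF// (lt_trans h0).
  rewrite derive1E deriveN; last exact: derivableV.
  rewrite -[GRing.inv]/(fun x : R => (id x)^-1) deriveV//.
  by rewrite derive_id scaleNr opprK [_ *: _]mulr1.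
Unshelve. all: by end_near. Qed.

Lemma ford_area : (area ford < +oo)%E.
Proof.
(* A rational number below sqrt 3 / 8. *)
pose h : R := 1 / 5.
pose I : set R := `[- (1 / 2), 1 / 2]%classic.
have mI : measurable I by exact: measurable_itv.
pose B : set (R * R) := I `*` `[h, +oo[%classic.
have mB : measurable B by apply: measurableX => //; exact: measurable_itv.
apply: (@le_lt_trans _ _ (\int[(lebesgue_measure \x lebesgue_measure)%E]_(p in B) (p.2 ^- 2)%:E)%E).
  apply: ge0_subset_integral => //.
  - exact: measurable_ford.
  - exact: measurable_funS measurable_invsqr_snd.
  - by move=> p _; rewrite lee_fin invr_ge0 sqr_ge0.
  - move=> p pF; have H := ford_Im pF; move: pF => [/= p0 p1 _]; split => /=.
      by rewrite /I /= in_itv /= -ler_norml.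
    by rewrite in_itv /= andbT /h; move: H => /=; nra.
rewrite integral_mkcond fubini_tonelli1; last 2 first.
- apply/(measurable_restrictT _ mB).
  exact: measurable_funS measurable_invsqr_snd.
- by move=> p; rewrite erestrict_ge0// => q _; rewrite lee_fin invr_ge0 sqr_ge0.
rewrite (_ : (\int[_]_x _)%E =
  (\int[lebesgue_measure]_(x in I) (h^-1)%:E)%E).
  rewrite integral_cst; last exact: mI.
  rewrite [X in (_ * X)%E](_ : _ = lebesgue_measure I)//.
  rewrite /I lebesgue_measure_itv/= lte_fin.
  case: ifPn => _; last by rewrite mule0.
  by rewrite -EFinD -EFinM ltry.
rewrite [RHS]integral_mkcond; apply: eq_integral => x _.
rewrite /fubini_F patchE; case: ifPn => xI.
  rewrite -(@integral_invsqr h); last by rewrite /h.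
  rewrite [RHS]integral_mkcond; apply: eq_integral => y _.
  rewrite !patchE /=; congr (if _ then _ else _).
  move: xI; rewrite inE => xI.
  by apply/idP/idP; rewrite !inE; [case|].
rewrite integral0_eq// => y _; rewrite patchE ifF//.
by apply: contraNF xI; rewrite !inE => -[].
Qed.

End FordDomain.

(** * Discreteness and finite covolume *)

Section FuchsianFirstKind.
Variable R : realType.
Implicit Types (g h : 'M[R]_2) (z w : R[i]).
Local Notation r := (Num.sqrt 3 : R).
Local Notation G3 := (@G3 R).

Lemma mx_ballP (x y : 'M[R]_2) (e : R) : ball x e y ->
  forall i j, `|x i j - y i j| < e.
Proof. by move=> [_ xy] i j; exact: xy. Qed.

Lemma G3_isolated : G3 `<=` isolated G3.
Proof.
move=> x xG; split; first by rewrite inE.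
pose M := `|x 1 0| + `|x 1 1|.
have M0 : 0 < M.
  rewrite lt0r addr_ge0// andbT paddr_eq0// !normr_eq0.
  apply/negP => /andP[/eqP x0 /eqP x1]; have := G3_SL2 xG.
  by rewrite [x]mkP detmk x0 x1 !mulr0 subrr => /eqP; rewrite eq_sym oner_eq0.
(* The bound (M + 1)^-1 keeps the determinant with the bottom row of x below 1, hence below the gap,
   so that a neighbour is T^m x or - T^m x; the bound M / 2 then excludes all of these except x. *)
pose e := Num.min (M / 2) (M + 1)^-1.
have M1 : 0 < (M + 1)^-1 by rewrite invr_gt0; lra.
have e0 : 0 < e by rewrite lt_min; apply/andP; split; [lra|].
have eM : e <= M / 2 by rewrite ge_min lexx.
have eM1 : e * M < 1.
  apply: (@le_lt_trans _ _ ((M + 1)^-1 * M)).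
    by rewrite ler_wpM2r ?ge_min ?lexx ?orbT// ltW.
  by rewrite mulrC ltr_pdivrMr; lra.
exists (ball x e); first exact: nbhsx_ballx.
apply/seteqP; split => [g [/mx_ballP gx gG]|g ->]; last by split => //; exact: ballxx.
have := gx 0 0; have := gx 0 1; have := gx 1 0; have := gx 1 1.
have [|H] := G3_rows xG gG; last first.
  move=> H11 H10 _ _; exfalso.
  have : g 1 0 * x 1 1 - g 1 1 * x 1 0 =
    - (x 1 0 - g 1 0) * x 1 1 + (x 1 1 - g 1 1) * x 1 0 by ring.
  move=> E; move: H; rewrite E => H.
  have := sqrt3_gt R; have := ler_normD (- (x 1 0 - g 1 0) * x 1 1) ((x 1 1 - g 1 1) * x 1 0).
  rewrite !normrM normrN.
  have : `|x 1 0 - g 1 0| * `|x 1 1| <= e * `|x 1 1| by rewrite ler_wpM2r// ltW.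
  have : `|x 1 1 - g 1 1| * `|x 1 0| <= e * `|x 1 0| by rewrite ler_wpM2r// ltW.
  move: eM1; rewrite mulrDr; lra.
case=> m [] ->; last first.
  rewrite {2 4 6 8}[x]mkP mul_translation_mk oppmk !mkE.
  rewrite !opprK -!mulr2n !normrMn => H1 H2 _ _; exfalso; move: eM H1 H2; rewrite /M; lra.
have [->|m0] := eqVneq m 0.
  by move=> _ _ _ _; rewrite translationE -mk1 mul1mx.
have m1 : 1 <= `|m%:~R| :> R.
  by rewrite -intr_norm -[1]/(1%:~R) ler_int; case: (m) m0 => [[|n]|n].
rewrite {2 4 6 8}[x]mkP mul_translation_mk !mkE !opprD !addrA !addrN !add0r !normrN !normrM.
move=> _ _ H1 H2; exfalso.
have : `|x 1 0| <= `|m%:~R| * `|x 1 0| by rewrite ler_peMl.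
have : `|x 1 1| <= `|m%:~R| * `|x 1 1| by rewrite ler_peMl.
move: eM H1 H2; rewrite /M; lra.
Qed.

Lemma G3_fuchsian : fuchsian G3.
Proof.
split.
- by move=> g /G3_SL2.
- by split; [exact: G3_1|exact: G3N1].
- exact: G3M.
- exact: G3V'.
- exact: G3_isolated.
Qed.

Lemma G3_finite_covolume : finite_covolume G3.
Proof.
exists (@ford R); last exact: ford_area.
split.
- by move=> z [].
- exact: measurable_ford.
- exact: ford_cover.
- by move=> g gG g1 g1'; exact: ford_overlap.
Qed.

End FuchsianFirstKind.

(** * The limit set *)

Section LimitSet.
Variable R : realType.
Implicit Types (g h : 'M[R]_2) (z w : R[i]).
Local Notation G3 := (@G3 R).

Lemma normc_ge_Re (z : R[i]) : `|complex.Re z| <= normc z.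
Proof.
case: z => x y /=; rewrite -sqrtr_sqr ler_sqrt ?lerDl ?sqr_ge0//.
by rewrite addr_ge0 ?sqr_ge0.
Qed.

Lemma normc_real (x : R) : normc x%:C = `|x|.
Proof. by rewrite /= expr0n addr0 sqrtr_sqr. Qed.

(** Near a real x, move x + iy into the Ford domain by some g. Its image has height at least 1 / 5,
    so |c x + d|^2 <= 5 y. For y small this excludes c = 0 and puts the cusp - d / c = g^-1 oo close
    to x; orbit points of i accumulate at every cusp. *)
Lemma G3_first_kind : first_kind G3.
Proof.
rewrite /first_kind; apply/seteqP; split => // -[x|] _; last first.
  exists 'i; first by rewrite /upper_half_plane /=.
  move=> B; exists (translation (Num.bound B)%:~R); first exact: G3T.
  rewrite mob_translation; apply: lt_le_trans (normc_ge_Re _).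
  rewrite /= add0r; apply: lt_le_trans (unstable.ltr_bound B) _.
  by rewrite ler_norm.
exists 'i; first by rewrite /upper_half_plane /=.
move=> e e0; pose y : R := Num.min (e ^+ 2 / 5) (1 / 10).
have y0 : 0 < y by rewrite lt_min !divr_gt0 ?exprn_gt0.
have ye : y <= e ^+ 2 / 5 by rewrite ge_min lexx.
have y10 : y <= 1 / 10 by rewrite ge_min lexx orbT.
have z0 : 0 < complex.Im (x +i* y) by [].
have [g gG gF] := ford_cover z0.
have := ford_Im gF; rewrite mob_Im ?G3_SL2//; have := den_gt0 (G3_SL2 gG) z0.
have -> : den g (x +i* y) = (g 1 0 * x + g 1 1) ^+ 2 + (g 1 0 * y) ^+ 2 by [].
rewrite -[complex.Im _]/y; have := G3_row_cases gG.
have := G3_SL2 gG; have := G3inv_mk; have := gG.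
rewrite [g]mkP !mkE detmk.
move: (g 0 0) (g 0 1) (g 1 0) (g 1 1) => a b c d {gF gG} gG /(_ _ _ _ _ _ gG) iG D rc d0 H.
set q := (_ + _) in d0 H.
have q5 : q <= 5 * y.
  have : 1 / 5 <= y / q.
    have u0 : 0 < y / q by rewrite divr_gt0.
    by move: H u0; move: (y / q) => u; nra.
  by rewrite ler_pdivlMr//; lra.
have gt := sqrt3_gt R.
have c1 : 2 <= `|c|.
  case: rc => [[c0 d1]|[c0 d1]|?|?].
  - by move: q5; rewrite /q c0 d1; lra.
  - by move: q5; rewrite /q c0 d1; lra.
  - by rewrite ger0_norm; lra.
  - by rewrite ler0_norm; lra.
have cn0 : c != 0 by rewrite -normr_eq0; lra.
have xp : `|x + d / c| <= e / 2.
  have E : x + d / c = (c * x + d) / c by field.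
  rewrite E normrM normfV ler_pdivrMr; last by lra.
  apply: (@le_trans _ _ e); last by nra.
  rewrite -(@ler_pXn2r _ 2)// ?nnegrE//; last exact: ltW.
  rewrite real_normK ?num_real//; apply: (@le_trans _ _ q); last by lra.
  by rewrite /q lerDl sqr_ge0.
(* The point g^-1 (i + n) differs from - d / c by 1 / (c (a - c (n + i))); this n makes the
   difference at most e / 8. *)
pose n := Num.bound (`|a| + 4 / e).
exists (mk d (- b) (- c) a *m translation n%:~R); first by apply: G3M => //; exact: G3T.
have nb : `|a| + 4 / e < n%:R by exact: unstable.ltr_bound.
pose w : R[i] := (d%:C * 'i + (d * n%:R - b)%:C) /
  ((- c)%:C * 'i + (- c * n%:R + a)%:C).
have -> : mob (mk d (- b) (- c) a *m translation n%:~R) 'i = w.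
  by rewrite mul_mk_translation /mob !mkE.
have v0 : a%:C - c%:C * (n%:R%:C + 'i) != 0.
  rewrite eq_complex /= negb_and; apply/orP; right.
  by rewrite !(mul0r, mul1r, mulr1, mulr0, addr0, add0r, subr0, sub0r) oppr_eq0.
have cC0 : c%:C != 0 by rewrite eq_complex /= negb_and cn0.
have -> : w - x%:C = (c%:C * (a%:C - c%:C * (n%:R%:C + 'i)))^-1 - (x + d / c)%:C.
  have dE : d%:C * a%:C - b%:C * c%:C = 1 by rewrite -!rmorphM -rmorphB mulrC D.
  rewrite /w !(rmorphD, rmorphM, rmorphN, fmorphV) /=.
  move: dE cC0 v0; move: (a%:C) (b%:C) (c%:C) (d%:C) (x%:C) (n%:R%:C) => A B C D' X N dE cC0 v0.
  have dE' : D' * A = 1 + B * C by rewrite -dE; ring.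
  by field: dE'; rewrite cC0 v0.
apply: le_lt_trans (le_normcD _ _) _; rewrite normcN normc_real normcV normcM normc_real.
have e4 : 0 < 4 / e by rewrite divr_gt0.
have an : 4 / e <= normc (a%:C - c%:C * (n%:R%:C + 'i)).
  apply: le_trans (normc_ge_Re _) => /=.
  rewrite !(mul0r, mul1r, mulr1, mulr0, addr0, add0r, subr0, sub0r).
  have : `|c| * n%:R <= `|a - c * n%:R| + `|a|.
    rewrite -{1}(@ger0_norm _ n%:R)// -normrM.
    have := ler_normD (- (a - c * n%:R)) a; rewrite normrN.
    by have -> : - (a - c * n%:R) + a = c * n%:R by ring.
  have : 2 * n%:R <= `|c| * n%:R by rewrite ler_wpM2r.
  have := normr_ge0 a; lra.
have : (`|c| * normc (a%:C - c%:C * (n%:R%:C + 'i)))^-1 <= e / 8.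
  rewrite -[e / 8]invrK lef_pV2 ?posrE ?invr_gt0; last 2 first.
  - by rewrite mulr_gt0//; lra.
  - by rewrite divr_gt0.
  have -> : (e / 8)^-1 = 2 * (4 / e) by field; rewrite gt_eqF.
  by rewrite ler_pM//; lra.
lra.
Qed.

End LimitSet.

(** * Cusps and closed geodesics *)

Section Cusps.
Variable R : realType.
Implicit Types (g h : 'M[R]_2).
Local Notation G3 := (@G3 R).

Lemma mob_bdM g h (b : option R) : \det g = 1 -> \det h = 1 ->
  mob_bd (g *m h) b = mob_bd g (mob_bd h b).
Proof.
rewrite [g]mkP [h]mkP mulmk !detmk.
move: (g 0 0) (g 0 1) (g 1 0) (g 1 1) => a b0 c d.
move: (h 0 0) (h 0 1) (h 1 0) (h 1 1) => a' b' c' d' Dg Dh.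
case: b => [x|] /=; rewrite !mkE.
- have [E|E] := eqVneq (c' * x + d') 0.
    have n : a' * x + b' != 0.
      apply/eqP => E'; have : a' * (c' * x + d') - c' * (a' * x + b') = 1 by rewrite -Dh; ring.
      by rewrite E E' !mulr0 subrr => /eqP; rewrite eq_sym oner_eq0.
    have -> : (c * a' + d * c') * x + (c * b' + d * d') = c * (a' * x + b').
      by transitivity (c * (a' * x + b') + d * (c' * x + d')); [ring|rewrite E mulr0 addr0].
    have -> : (a * a' + b0 * c') * x + (a * b' + b0 * d') = a * (a' * x + b').
      by transitivity (a * (a' * x + b') + b0 * (c' * x + d')); [ring|rewrite E mulr0 addr0].
    rewrite mulf_eq0 (negPf n) orbF /= !mkE; case: ifPn => // c0.
    by congr Some; field; rewrite c0 n.
  rewrite /= !mkE.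
  have -> : (c * a' + d * c') * x + (c * b' + d * d') =
      (c * ((a' * x + b') / (c' * x + d')) + d) * (c' * x + d') by field.
  have -> : (a * a' + b0 * c') * x + (a * b' + b0 * d') =
      (a * ((a' * x + b') / (c' * x + d')) + b0) * (c' * x + d') by field.
  rewrite mulf_eq0 (negPf E) orbF; case: ifPn => // n.
  by congr Some; rewrite -mulf_div divff// mulr1.
- have [E|E] := eqVneq c' 0.
    have n : a' != 0.
      apply/eqP => E'; move: Dh; rewrite E E' mul0r mulr0 subrr => /eqP.
      by rewrite eq_sym oner_eq0.
    rewrite /= !mkE E !mulr0 !addr0 mulf_eq0 (negPf n) orbF; case: ifPn => // c0.
    by congr Some; field; rewrite c0 n.
  rewrite /= !mkE.
  have -> : c * a' + d * c' = (c * (a' / c') + d) * c' by field.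
  have -> : a * a' + b0 * c' = (a * (a' / c') + b0) * c' by field.
  rewrite mulf_eq0 (negPf E) orbF; case: ifPn => // n.
  by congr Some; rewrite -mulf_div divff// mulr1.
Qed.

Lemma mob_bd1 (b : option R) : mob_bd 1%:M b = b.
Proof.
case: b => [x|] /=; rewrite mk1 !mkE ?eqxx//.
by rewrite mul0r add0r oner_eq0 mul1r addr0 divr1.
Qed.

Lemma mob_bd_None g : (mob_bd g None = None) <-> g 1 0 = 0.
Proof. by rewrite /=; split; case: eqP. Qed.

Lemma mob_bdN g (b : option R) : mob_bd (- g) b = mob_bd g b.
Proof.
case: b => [x|] /=; rewrite !mxE ?oppr_eq0; last by rewrite invrN mulrNN.
by rewrite !mulNr -!opprD oppr_eq0 invrN mulrNN.
Qed.

Lemma G3_stab_None g : stab G3 None g <->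
  exists m : int, g = translation m%:~R \/ g = - translation m%:~R.
Proof.
split; first by move=> [gG /mob_bd_None]; exact: G3_lower0.
move=> [m [->|->]]; split; rewrite ?mob_bdN; try apply/mob_bd_None.
- exact: G3T.
- by rewrite translationE mkE.
- by apply: G3N; exact: G3T.
- by rewrite translationE mkE.
Qed.

Lemma parabolic_T1 : parabolic (translation (1 : R)).
Proof.
split.
- by rewrite /SL2 /= translationE detmk; ring.
- by rewrite translationE trmk -[1 + 1]/(2%:R) normr_nat.
- rewrite translationE mk1 => /mk_inj[_ /eqP]; by rewrite oner_eq0.
- rewrite translationE mk1 oppmk => /mk_inj[_ /eqP]; by rewrite oppr0 oner_eq0.
Qed.

Lemma G3_scaling : scaling_matrix G3 1%:M.
Proof.
split; rewrite ?mob_bd1.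
- by rewrite /SL2 /= det1.
- exists (translation 1); split; first exact: G3T1.
    exact: parabolic_T1.
  by apply/mob_bd_None; rewrite translationE mkE.
- rewrite invmx1; apply/seteqP; split => g.
    by move=> [h /G3_stab_None hG <-]; rewrite mul1mx mulmx1.
  by move=> /G3_stab_None gG; exists g => //; rewrite mul1mx mulmx1.
Qed.

(** A parabolic element has squared trace 4, so the reduction conjugates it to a nontrivial
    translation up to sign, whose only fixed point on the boundary is infinity. *)
Lemma G3_cusps (b : option R) : cusp G3 b -> exists2 g, G3 g & mob_bd g None = b.
Proof.
move=> [g [gG [gd gt g1 g1'] gb]].
have t4 : (\tr g) ^+ 2 = 4.
  by rewrite -[LHS]real_normK ?num_real// gt; ring.
have [h hG h0] := G3_conj_lower0 gG ltac:(rewrite t4; lra).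
have jG : G3 (h *m g *m invmx h) by apply: G3M; [exact: G3M|exact: G3V'].
have hd := G3_SL2 hG; have hiG := G3V' hG; have hid := G3_SL2 hiG.
exists (invmx h) => //.
have bh : mob_bd (invmx h) (mob_bd h b) = b.
  by rewrite -mob_bdM// mulVmx ?G3unit// mob_bd1.
suff -> : None = mob_bd h b by [].
have fix_b : mob_bd (h *m g *m invmx h) (mob_bd h b) = mob_bd h b.
  by rewrite -mob_bdM ?G3_SL2// mulmxKV ?G3unit// mob_bdM// gb.
have [m jm] := G3_lower0 jG h0.
have gE : g = invmx h *m (h *m g *m invmx h) *m h.
  by rewrite !mulmxA mulVmx ?G3unit// mul1mx mulmxKV// G3unit.
have m0 : m != 0.
  apply/eqP => m0; case: jm; rewrite m0 /translation scale0r addr0 => E.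
    by apply: g1; rewrite gE E mulmx1 mulVmx// G3unit.
  by apply: g1'; rewrite gE E mulmxN mulNmx mulmx1 mulVmx// G3unit.
case: (mob_bd h b) fix_b => // x.
have -> : mob_bd (h *m g *m invmx h) (Some x) = Some (x + m%:~R).
  case: jm => ->; rewrite ?mob_bdN translationE /= !mkE.
    by rewrite mul0r add0r oner_eq0 mul1r divr1.
  by rewrite mul0r add0r oner_eq0 mul1r divr1.
by case=> /eqP; rewrite -subr_eq0 addrAC subrr add0r intr_eq0 (negPf m0).
Qed.

Lemma G3_cusp_system : cusp_system G3 (fun _ : 'I_1 => 1%:M).
Proof.
split.
- by move=> _; exact: G3_scaling.
- by move=> i j g _ _; rewrite !ord1.
- move=> b /G3_cusps[g gG gb]; exists ord0, g => //.
  by rewrite mob_bd1.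
Qed.

End Cusps.

(** * Translation lengths and the shortest geodesic *)

Section Geodesics.
Variable R : realType.
Implicit Types (g h : 'M[R]_2) (z w : R[i]).
Local Notation r := (Num.sqrt 3 : R).
Local Notation G3 := (@G3 R).

Definition cosh_dist z w : R :=
  1 + ((complex.Re z - complex.Re w) ^+ 2 + (complex.Im z - complex.Im w) ^+ 2) /
      (2 * complex.Im z * complex.Im w).

Lemma hdistE z w : hdist z w =
  ln (cosh_dist z w + Num.sqrt (cosh_dist z w ^+ 2 - 1)).
Proof.
case: z w => [x y] [x' y']; rewrite /hdist /cosh_dist /=.
by rewrite sqr_sqrtr// addr_ge0 ?sqr_ge0.
Qed.

Lemma cosh_dist_ge1 z w : 0 < complex.Im z -> 0 < complex.Im w -> 1 <= cosh_dist z w.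
Proof.
move=> z0 w0; rewrite /cosh_dist lerDl divr_ge0 ?addr_ge0 ?sqr_ge0//.
by rewrite !mulr_ge0// ltW.
Qed.

Lemma cosh_hdist z w : 0 < complex.Im z -> 0 < complex.Im w ->
  expR (hdist z w) + expR (- hdist z w) = 2 * cosh_dist z w.
Proof.
move=> z0 w0; rewrite hdistE; have := cosh_dist_ge1 z0 w0.
move: (cosh_dist z w) => u u1; set v := Num.sqrt _.
have v2 : v ^+ 2 = u ^+ 2 - 1 by rewrite sqr_sqrtr//; nra.
have v0 : 0 <= v by exact: sqrtr_ge0.
rewrite expRN lnK ?posrE; last by lra.
have n0 : u + v != 0 by rewrite gt_eqF//; lra.
apply: (mulIf n0); rewrite mulrDl mulVf//.
by transitivity (2 * u ^+ 2 + 2 * u * v + (v ^+ 2 - (u ^+ 2 - 1))); [ring|rewrite v2; ring].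
Qed.

(** The squared modulus of c z^2 + (d - a) z - b, the quadratic form whose roots are the fixed
    points of g. *)
Definition fixed_form g z : R :=
  (g 1 0 * (complex.Re z ^+ 2 - complex.Im z ^+ 2) +
   (g 1 1 - g 0 0) * complex.Re z - g 0 1) ^+ 2 +
  (2 * g 1 0 * complex.Re z * complex.Im z + (g 1 1 - g 0 0) * complex.Im z) ^+ 2.

Lemma cosh_dist_mob g z : \det g = 1 -> 0 < complex.Im z ->
  cosh_dist z (mob g z) = 1 + fixed_form g z / (2 * complex.Im z ^+ 2).
Proof.
move=> D z0; have := den_gt0 D z0; rewrite /cosh_dist mobE// /fixed_form /den.
case: z z0 => x y /= y0; move: D; rewrite [g]mkP detmk !mkE.
move: (g 0 0) (g 0 1) (g 1 0) (g 1 1) => a b c d D n0.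
have bc : b * c = a * d - 1 by rewrite -D; ring.
congr (1 + _); field: bc; rewrite !lt0r_neq0//.
Qed.

(** By Cayley-Hamilton g^2 = (tr g) g - 1, which multiplies b, c and d - a by the trace. *)
Lemma fixed_form_sqr g z : \det g = 1 ->
  fixed_form (g *m g) z = (\tr g) ^+ 2 * fixed_form g z.
Proof.
by move=> D; rewrite /fixed_form [g]mkP mulmk trmk !mkE; ring.
Qed.

(** Along the geodesic g moves a point by L and g^2 moves it by 2 L. Since squaring g multiplies
    [fixed_form] by tr^2, cosh (2 L) - 1 = tr^2 (cosh L - 1), and dividing by cosh L - 1 gives tr^2
    = 2 cosh L + 2. *)
Lemma translation_length g (eta : R -> R[i]) L : \det g = 1 -> 0 < L ->
  unit_speed_geodesic eta -> (forall t, mob g (eta t) = eta (t + L)) ->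
  (\tr g) ^+ 2 = expR L + expR (- L) + 2.
Proof.
move=> D L0 [eU ed] eg.
have z0 : 0 < complex.Im (eta 0) by exact: eU.
have w0 : 0 < complex.Im (eta L) by exact: eU.
have v0 : 0 < complex.Im (eta (L + L)) by exact: eU.
have gz : mob g (eta 0) = eta L by rewrite eg add0r.
have ggz : mob (g *m g) (eta 0) = eta (L + L) by rewrite mobM// gz eg.
have := cosh_hdist z0 w0; rewrite ed sub0r normrN ger0_norm ?(ltW L0)//.
have := cosh_hdist z0 v0; rewrite ed sub0r normrN ger0_norm; last by lra.
rewrite -ggz -gz !cosh_dist_mob// ?det_mulmx ?D ?mulr1//.
rewrite fixed_form_sqr// !opprD !expRD.
set k := fixed_form g _ / _; rewrite -(mulrA _ (fixed_form _ _)) -/k.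
have : expR L * expR (- L) = 1 by rewrite -expRD subrr expR0.
have : 1 < expR L by rewrite expR_gt1.
move: (expR L) (expR (- L)) => e f e1 ef H2 H1.
have kE : 2 * k = e + f - 2 by lra.
have k0 : 2 * k != 0.
  rewrite kE gt_eqF//.
  have : e * (e + f - 2) = (e - 1) ^+ 2 by transitivity (e ^+ 2 + e * f - 2 * e); [ring|rewrite ef; ring].
  have : 0 < (e - 1) ^+ 2 by rewrite exprn_gt0//; lra.
  by nra.
apply: (mulIf k0); transitivity (e * e + f * f - 2); first by rewrite H2; ring.
by rewrite kE; transitivity (e * e + f * f + 2 * (e * f) - 4); [rewrite ef|]; ring.
Qed.

Lemma G3_length_ge L : closed_geodesic_length G3 L -> ln 3 <= L.
Proof.
move=> [L0 [eta [g [eU gG eg]]]]; have tE := translation_length (G3_SL2 gG) L0 eU eg.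
have e1 : 1 < expR L by rewrite expR_gt1.
have ef : expR L * expR (- L) = 1 by rewrite -expRD subrr expR0.
have sq : expR L * (expR L + expR (- L) - 2) = (expR L - 1) ^+ 2.
  by transitivity (expR L ^+ 2 + expR L * expR (- L) - 2 * expR L); [ring|rewrite ef; ring].
have sq0 : 0 < (expR L - 1) ^+ 2 by rewrite exprn_gt0//; lra.
have t4 : 4 < (\tr g) ^+ 2 by rewrite tE; nra.
have := G3_trace gG t4; rewrite tE => H.
have e3 : 3 <= expR L by nra.
by rewrite -(expRK L) ler_ln ?posrE//; lra.
Qed.

(** The geodesic from - 3 / 4 to - 1 / 4, the fixed points of S T : z -> - 3 / (16 (z + 1)). It is
    the image of t -> i e^t under an isometry. *)
Definition axis (t : R) : R[i] :=
  (- (3 + expR t ^+ 2) / (4 * (1 + expR t ^+ 2))) +i*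
  (expR t / (2 * (1 + expR t ^+ 2))).

Lemma axis_unit_speed : unit_speed_geodesic axis.
Proof.
have p0 t : 0 < 1 + expR t ^+ 2 :> R by have := sqr_ge0 (expR t); lra.
have U t : 0 < complex.Im (axis t).
  by rewrite /= divr_gt0 ?expR_gt0// mulr_gt0.
split=> // s t.
have cE : cosh_dist (axis s) (axis t) = (expR s / expR t + expR t / expR s) / 2.
  rewrite /cosh_dist /=; have := p0 s; have := p0 t.
  have := expR_gt0 s; have := expR_gt0 t; move: (expR s) (expR t) => e f f0 e0 pf pe.
  by field; rewrite !lt0r_neq0.
rewrite hdistE cE -!expRN -!expRD.
wlog st : s t {cE} / t <= s.
  move=> H; case: (leP t s) => [|/ltW] st; first exact: H.
  by rewrite distrC -H// [X in X / 2]addrC.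
rewrite (ger0_norm (_ : 0 <= s - t)) ?subr_ge0//.
rewrite -(opprB s t); have := expRD (s - t) (- (s - t)); rewrite subrr expR0.
have : expR (- (s - t)) <= expR (s - t) by rewrite ler_expR; lra.
move E : (expR (s - t)) => e; move: (expR (- (s - t))) => f fe ef.
have -> : ((e + f) / 2) ^+ 2 - 1 = ((e - f) / 2) ^+ 2.
  by transitivity (((e + f) / 2) ^+ 2 - e * f); [rewrite -ef|]; field.
rewrite sqrtr_sqr ger0_norm; last by lra.
have -> : (e + f) / 2 + (e - f) / 2 = e by field.
by rewrite -E expRK.
Qed.

Lemma G3_shortest : shortest_geodesic_length G3 (ln 3).
Proof.
split; last exact: G3_length_ge.
split; first by rewrite ln_gt0//; lra.
exists axis, (gS R *m translation 1); split; first exact: axis_unit_speed.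
  by apply: G3M; [exact: G3S|exact: G3T1].
move=> t; have [U _] := axis_unit_speed; have := U t; rewrite /upper_half_plane /= => y0.
rewrite mobE//; last by apply: G3_SL2; apply: G3M; [exact: G3S|exact: G3T1].
rewrite mul_mk_translation /den !mkE /axis /= expRD lnK ?posrE//.
have := expR_gt0 t; move: (expR t) => e e0.
have := sqrt3_sq R; have : 0 < r by have := sqrt3_gt R; lra.
move: r => q q0 q2.
have e1 : 1 + e ^+ 2 != 0 by rewrite gt_eqF//; nra.
have e9 : 1 + (e * 3) ^+ 2 != 0 by rewrite gt_eqF//; nra.
have n3 : (q * - (3 + e ^+ 2) + 4 * q * (1 + e ^+ 2)) ^+ 2 * 36 +
    (4 * q * e) ^+ 2 * 9 != 0.
  rewrite gt_eqF//; apply: ltr_wpDl.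
    by apply: mulr_ge0 => //; exact: sqr_ge0.
  by rewrite mulr_gt0// exprn_gt0// !mulr_gt0.
by apply/eqP; rewrite eq_complex /=; apply/andP; split; apply/eqP;
  field: q2; rewrite e1 e9 n3.
Qed.

End Geodesics.

(** * The Gamma function *)

Section AffineChange.
Variable R : realType.
Local Notation mu := (@lebesgue_measure R).
Variables A B : R.
Hypothesis A0 : 0 < A.

Definition affine (x : measurableTypeR R) : measurableTypeR R := A * x + B.

Lemma measurable_affine : measurable_fun [set: measurableTypeR R] affine.
Proof. by apply: measurable_funD => //; apply: measurable_funM. Qed.

Let k : {nonneg R} := NngNum (ltW A0).

Let P : {measure set (measurableTypeR R) -> \bar R} :=
  measure_function_pushforward__canonical__measure_function_Measure mu measurable_affine.

(** Lebesgue measure is determined by its values on the intervals ]a, b]; the factor A compensates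
    the length of their preimages. *)
Let PE (X : set R) : measurable X -> mu X = mscale k P X.
Proof.
move=> mX; apply: lebesgue_measure_unique => // _ [[a b]] _ <-.
transitivity (A%:E * mu (affine @^-1` `]a, b]%classic))%E; last by [].
rewrite (_ : affine @^-1` _ = [set` `](a - B) / A, (b - B) / A]]); last first.
  apply/seteqP; split => x /=; rewrite /affine !in_itv /=.
    by rewrite ltr_pdivrMr// ler_pdivlMr// ltrBlDr lerBrDr mulrC.
  by rewrite ltr_pdivrMr// ler_pdivlMr// ltrBlDr lerBrDr mulrC.
rewrite !lebesgue_measure_itv /= !lte_fin ltr_pM2r ?invr_gt0// ltrD2r.
case: ifPn => // _; last by rewrite mule0.
rewrite -!EFinB -EFinM; congr EFin; field.
by rewrite gt_eqF.
Qed.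

Lemma ge0_integral_affine (f : R -> \bar R) : measurable_fun setT f ->
  (forall x, 0 <= f x)%E ->
  (\int[mu]_x f x = A%:E * \int[mu]_x f (A * x + B)%R)%E.
Proof.
move=> mf f0; transitivity (\int[mscale k P]_x f x)%E.
  by apply: eq_measure_integral => X mX _; exact: PE.
rewrite ge0_integral_mscale//; congr (_ * _)%E.
rewrite ge0_integral_pushforward//; last exact: measurable_affine.
Qed.

Lemma integrable_affine (f : R -> R) : mu.-integrable setT (EFin \o f) ->
  mu.-integrable setT (fun x => (f (A * x + B))%:E).
Proof.
move=> /integrableP[mf fi]; apply/integrableP; split.
  exact: (measurableT_comp mf measurable_affine).
have := ge0_integral_affine (measurableT_comp (@abse_measurable R setT) mf) (fun x => abse_ge0 _).
rewrite /= => E; move: fi; rewrite /= E.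
have : (0 <= \int[mu]_x `|(f (A * x + B)%R)%:E|)%E by apply: integral_ge0.
case: (\int[mu]_x _)%E => [q _ _|_|//]; first exact: ltry.
by rewrite gt0_muley// lte_fin.
Qed.

Lemma Rintegral_affine (f : R -> R) : mu.-integrable setT (EFin \o f) ->
  Rintegral mu setT f = A * Rintegral mu setT (fun x => f (A * x + B)).
Proof.
move=> fi; have gi := integrable_affine fi.
have [mf _] := integrableP _ _ _ fi.
rewrite /Rintegral integralE [in RHS]integralE.
rewrite (ge0_integral_affine (measurable_funepos mf))//.
rewrite (ge0_integral_affine (measurable_funeneg mf))//.
have P1 := integrable_pos_fin_num measurableT gi.
have P2 := integrable_neg_fin_num measurableT gi.
have -> : (\int[mu]_x (EFin \o f)^\+ (A * x + B)%R =
    \int[mu]_x (fun x => (f (A * x + B)%R)%:E)^\+ x)%E.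
  by apply: eq_integral => x _; rewrite ?funeposE ?funenegE.
have -> : (\int[mu]_x (EFin \o f)^\- (A * x + B)%R =
    \int[mu]_x (fun x => (f (A * x + B)%R)%:E)^\- x)%E.
  by apply: eq_integral => x _; rewrite ?funeposE ?funenegE.
move: P1 P2; move: (\int[_]_x _)%E (\int[_]_x _)%E => p q.
by move: p q => [p| |] [q| |] //= _ _; rewrite mulrBr.
Qed.

End AffineChange.

(** * Complex powers of positive reals *)

Section ComplexPower.
Variable R : realType.
Implicit Types (x y : R) (s w : R[i]).

Lemma cpowE x s : cpow x s =
  (x `^ complex.Re s * cos (complex.Im s * ln x)) +i*
  (x `^ complex.Re s * sin (complex.Im s * ln x)).
Proof.
by apply/eqP; rewrite /cpow eq_complex /= !mul0r subr0 addr0 !eqxx.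
Qed.

Lemma cpowM x y s : 0 < x -> 0 < y -> cpow (x * y) s = cpow x s * cpow y s.
Proof.
move=> x0 y0; rewrite !cpowE powRM ?ltW// lnM ?posrE// mulrDr cosD sinD.
by apply/eqP; rewrite eq_complex /=; apply/andP; split; apply/eqP; ring.
Qed.

Lemma cpowD x s w : 0 < x -> cpow x (s + w) = cpow x s * cpow x w.
Proof.
move=> x0; rewrite !cpowE; case: s w => [a b] [a' b'] /=.
rewrite powRD; last by rewrite (gt_eqF x0) implybT.
rewrite mulrDl cosD sinD.
by apply/eqP; rewrite eq_complex /=; apply/andP; split; apply/eqP; ring.
Qed.

Lemma cpow0 x : cpow x 0 = 1.
Proof.
by apply/eqP; rewrite cpowE eq_complex /= powRr0 !mul0r cos0 sin0 mulr0 mul1r !eqxx.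
Qed.

Lemma cpow1 s : cpow 1 s = 1.
Proof.
by apply/eqP; rewrite cpowE eq_complex /= powR1 ln1 mulr0 cos0 sin0 mulr0 mul1r !eqxx.
Qed.

Lemma cpowN x s : 0 < x -> cpow x (- s) = (cpow x s)^-1.
Proof.
move=> x0; have : cpow x s * cpow x (- s) = 1 by rewrite -cpowD// subrr cpow0.
move=> E; apply: (mulfI (_ : cpow x s != 0)).
  by apply: contra_eq_neq E => ->; rewrite mul0r eq_sym oner_eq0.
rewrite E divff//.
by apply: contra_eq_neq E => ->; rewrite mul0r eq_sym oner_eq0.
Qed.

Lemma cpow_neq0 x s : 0 < x -> cpow x s != 0.
Proof.
move=> x0; have : cpow x s * cpow x (- s) = 1 by rewrite -cpowD// subrr cpow0.
by move=> E; apply: contra_eq_neq E => ->; rewrite mul0r eq_sym oner_eq0.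
Qed.

Lemma cpowV x s : 0 < x -> cpow x^-1 s = cpow x (- s).
Proof.
move=> x0; rewrite cpowN//; apply: (mulfI (cpow_neq0 s x0)).
by rewrite -cpowM ?invr_gt0// divff ?gt_eqF// cpow1 divff// cpow_neq0.
Qed.

Lemma cpow_real x y : cpow x y%:C = (x `^ y)%:C.
Proof. by apply/eqP; rewrite cpowE eq_complex /= mul0r cos0 sin0 mulr0 mulr1 !eqxx. Qed.

Lemma cpowr1 x : 0 < x -> cpow x 1 = x%:C.
Proof. by move=> x0; rewrite (cpow_real x 1) powRr1// ltW. Qed.

Lemma Re_cpow_le x s : `|complex.Re (cpow x s)| <= x `^ complex.Re s.
Proof.
rewrite cpowE /= normrM ger0_norm ?powR_ge0//.
by rewrite ler_piMr ?powR_ge0// cos_max.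
Qed.

Lemma Im_cpow_le x s : `|complex.Im (cpow x s)| <= x `^ complex.Re s.
Proof.
rewrite cpowE /= normrM ger0_norm ?powR_ge0//.
by rewrite ler_piMr ?powR_ge0// sin_max.
Qed.

Lemma measurable_Re_cpow s : measurable_fun [set: R] (fun x => complex.Re (cpow x s)).
Proof.
under eq_fun do rewrite cpowE /=.
apply: measurable_funM; first exact: measurable_powR.
apply: measurableT_comp; first by apply: continuous_measurable_fun; exact: continuous_cos.
by apply: measurable_funM => //; exact: measurable_ln.
Qed.

Lemma measurable_Im_cpow s : measurable_fun [set: R] (fun x => complex.Im (cpow x s)).
Proof.
under eq_fun do rewrite cpowE /=.
apply: measurable_funM; first exact: measurable_powR.
apply: measurableT_comp; first by apply: continuous_measurable_fun; exact: continuous_sin.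
by apply: measurable_funM => //; exact: measurable_ln.
Qed.

End ComplexPower.

(** * Integrals of complex-valued functions *)

Section ComplexIntegral.
Variable R : realType.
Local Notation mu := (@lebesgue_measure R).
Implicit Types (D : set R) (f g : R -> R[i]) (c : R[i]).

Definition cintble D f :=
  mu.-integrable D (fun x => (complex.Re (f x))%:E) /\
  mu.-integrable D (fun x => (complex.Im (f x))%:E).

Lemma integrable_eqr (D : set R) (f g : R -> \bar R) : measurable (D : set (measurableTypeR R)) ->
  mu.-integrable D f -> (forall x, D x -> f x = g x) -> mu.-integrable D g.
Proof.
by move=> mD fi fg; apply: eq_integrable fi => // x; rewrite inE => /fg.
Qed.

Lemma eq_cint D f g : {in D, f =1 g} -> cint D f = cint D g.
Proof.
by move=> fg; rewrite /cint; congr (_ +i* _); apply: eq_Rintegral => x xD; rewrite fg.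
Qed.

Lemma eq_cintble D f g : measurable (D : set (measurableTypeR R)) -> {in D, f =1 g} -> cintble D f -> cintble D g.
Proof.
move=> mD fg [h1 h2]; split.
  by apply: (integrable_eqr mD h1) => x xD; rewrite fg ?inE.
by apply: (integrable_eqr mD h2) => x xD; rewrite fg ?inE.
Qed.

Lemma cintbleZ D c f : measurable (D : set (measurableTypeR R)) -> cintble D f -> cintble D (fun x => c * f x).
Proof.
move=> mD [h1 h2]; case: c => a b; split.
  have h := integrableB mD (integrableZl mD a h1) (integrableZl mD b h2).
  apply: (integrable_eqr mD h).
  by move=> x _; case: (f x).
have h := integrableD mD (integrableZl mD a h2) (integrableZl mD b h1).
apply: (integrable_eqr mD h).
by move=> x _; case: (f x).
Qed.

Lemma cintZ D c f : measurable (D : set (measurableTypeR R)) -> cintble D f ->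
  cint D (fun x => c * f x) = c * cint D f.
Proof.
move=> mD [h1 h2]; case: c => a b; rewrite /cint.
have Z k u : mu.-integrable D (EFin \o u) -> mu.-integrable D (EFin \o (fun x => k * u x)).
  by move=> ui; apply: (integrable_eqr mD (integrableZl mD k ui)) => x _; rewrite /= EFinM.
apply/eqP; rewrite eq_complex /= -!RintegralZl//; apply/andP; split; apply/eqP.
  rewrite -RintegralB//; [|exact: Z..].
  by apply: eq_Rintegral => x _; case: (f x).
rewrite -RintegralD//; [|exact: Z..].
by apply: eq_Rintegral => x _; case: (f x).
Qed.

Lemma cint_patch D f : cint D f = cint setT (fun x => if x \in D then f x else 0).
Proof.
rewrite /cint; congr (_ +i* _); rewrite Rintegral_mkcond; apply: eq_Rintegral => x _;
  by rewrite patchE; case: ifP.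
Qed.

Lemma cintble_patch D f : measurable (D : set (measurableTypeR R)) -> cintble D f ->
  cintble setT (fun x => if x \in D then f x else 0).
Proof.
move=> mD [/(integrable_mkcond _ mD) h1 /(integrable_mkcond _ mD) h2]; split.
  by apply: (integrable_eqr measurableT h1) => x _; rewrite patchE; case: ifP.
by apply: (integrable_eqr measurableT h2) => x _; rewrite patchE; case: ifP.
Qed.

Lemma cint_affine (A B : R) f : 0 < A -> cintble setT f ->
  cint setT f = A%:C * cint setT (fun x => f (A * x + B)).
Proof.
move=> A0 [h1 h2]; rewrite /cint (Rintegral_affine B A0 h1) (Rintegral_affine B A0 h2).
by apply/eqP; rewrite eq_complex /= !mul0r subr0 addr0 !eqxx.
Qed.

Lemma cintble_affine (A B : R) f : 0 < A -> cintble setT f ->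
  cintble setT (fun x => f (A * x + B)).
Proof.
by move=> A0 [h1 h2]; split;
  [exact: (integrable_affine B A0 h1)|exact: (integrable_affine B A0 h2)].
Qed.

Lemma cintble_bound D f (h : R -> R) : measurable (D : set (measurableTypeR R)) ->
  measurable_fun D (fun x => complex.Re (f x)) ->
  measurable_fun D (fun x => complex.Im (f x)) ->
  (forall x, D x -> `|complex.Re (f x)| <= h x /\ `|complex.Im (f x)| <= h x) ->
  mu.-integrable D (EFin \o h) -> cintble D f.
Proof.
move=> mD m1 m2 fh hi; split; apply: (le_integrable mD _ _ hi).
- exact/measurable_EFinP.
- move=> x xD /=; rewrite lee_fin; have [+ _] := fh x xD.
  by move/le_trans; apply; exact: ler_norm.
- exact/measurable_EFinP.
- move=> x xD /=; rewrite lee_fin; have [_ +] := fh x xD.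
  by move/le_trans; apply; exact: ler_norm.
Qed.

End ComplexIntegral.

(** * Gamma integrals with a scale parameter *)

Section GammaIntegrals.
Variable R : realType.
Local Notation mu := (@lebesgue_measure R).
Implicit Types (s w : R[i]) (A p u : R).
Let D : set (measurableTypeR R) := `]0, +oo[%classic.
Let mD : measurable D. Proof. exact: measurable_itv. Qed.

Lemma integrable_expRN A : 0 < A ->
  mu.-integrable `]0, +oo[ (fun u => (expR (- (A * u)))%:E).
Proof.
move=> A0; have h := integrableZl measurableT A^-1 (integrable_exponential_pdf A0).
have {}h := integrableS measurableT mD (@subsetT _ D) h.
apply: (integrable_eqr mD h) => u; rewrite /D /= in_itv /= andbT => u0.
rewrite exponential_pdfE ?ltW// mulNr -EFinM; congr EFin.
by rewrite mulrA mulVf ?mul1r// gt_eqF.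
Qed.

(** The p-th power of v <= exp v for v = A u / p. With A / 2 in place of A, it lets half of the
    exponential decay absorb the power of u. *)
Lemma powR_expR_le A p u : 0 < A -> 0 < p -> 0 < u ->
  u `^ p <= (p / A) `^ p * expR (A * u).
Proof.
move=> A0 p0 u0; have E : u = (p / A) * (A * u / p).
  by field; rewrite !gt_eqF.
rewrite {1}E powRM; last 2 first.
- by rewrite divr_ge0 ?ltW.
- by rewrite divr_ge0 ?mulr_ge0 ?ltW.
rewrite ler_wpM2l ?powR_ge0//.
have -> : expR (A * u) = expR (A * u / p) `^ p.
  by rewrite -expRM; congr expR; field; rewrite gt_eqF.
rewrite ge0_ler_powR ?nnegrE ?expR_ge0// ?(ltW p0)//; first by rewrite divr_ge0 ?mulr_ge0 ?ltW.
by apply: le_trans (expR_ge1Dx _); rewrite lerDr.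
Qed.

Lemma integrable_gamma A p : 0 < A -> 0 < p ->
  mu.-integrable `]0, +oo[ (fun u => (u `^ p * expR (- (A * u)))%:E).
Proof.
move=> A0 p0; have A2 : 0 < A / 2 by rewrite divr_gt0.
have h := integrableZl mD ((p / (A / 2)) `^ p) (integrable_expRN A2).
apply: (le_integrable mD _ _ h).
  apply/measurable_EFinP; apply: measurable_funTS; apply: measurable_funM.
    exact: measurable_powR.
  apply: measurableT_comp => //; apply: measurable_funN.
  by apply: measurable_funM.
move=> u; rewrite /D /= in_itv /= andbT => u0; rewrite lee_fin !ger0_norm; last 2 first.
- by rewrite mulr_ge0 ?powR_ge0 ?expR_ge0.
- by rewrite mulr_ge0 ?powR_ge0 ?expR_ge0.
have -> : expR (- (A / 2 * u)) = expR (A / 2 * u) * expR (- (A * u)).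
  by rewrite -expRD; congr expR; field.
by rewrite mulrA ler_wpM2r ?expR_ge0// powR_expR_le.
Qed.

Lemma cintble_gamma A s : 0 < A -> 1 < complex.Re s ->
  cintble `]0, +oo[ (fun u => cpow u (s - 1) * (expR (- (A * u)))%:C).
Proof.
move=> A0 s1; apply: (@cintble_bound _ _ _ (fun u => u `^ (complex.Re s - 1) * expR (- (A * u)))).
- exact: measurable_itv.
- apply: measurable_funTS; rewrite (_ : (fun _ => _) = (fun u => complex.Re (cpow u (s - 1)) * expR (- (A * u)))).
    apply: measurable_funM; first exact: measurable_Re_cpow.
    by apply: measurableT_comp => //; apply: measurable_funN; apply: measurable_funM.
  by apply/funext => u; case: (cpow _ _) => a b /=; rewrite mulr0 subr0.
- apply: measurable_funTS; rewrite (_ : (fun _ => _) = (fun u => complex.Im (cpow u (s - 1)) * expR (- (A * u)))).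
    apply: measurable_funM; first exact: measurable_Im_cpow.
    by apply: measurableT_comp => //; apply: measurable_funN; apply: measurable_funM.
  by apply/funext => u; case: (cpow _ _) => a b /=; rewrite mulr0 add0r.
- move=> u _; have -> : complex.Re s - 1 = complex.Re (s - 1) by case: (s).
  have := Re_cpow_le u (s - 1); have := Im_cpow_le u (s - 1).
  case: (cpow _ _) => a b /=; rewrite !mulr0 subr0 add0r => h1 h2.
  by rewrite !normrM !(ger0_norm (expR_ge0 _)) !ler_wpM2r ?expR_ge0.
- by apply: integrable_gamma => //; rewrite subr_gt0.
Qed.

(** The substitution t = A u. The parameter A is later taken to be 1 + x^2, and also serves as a
    variable in which to take differences. *)
Lemma cGamma_scale A s : 0 < A -> 1 < complex.Re s ->
  cint `]0, +oo[ (fun u => cpow u (s - 1) * (expR (- (A * u)))%:C) =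
  cGamma s * cpow A (- s).
Proof.
move=> A0 s1; rewrite /cGamma; under [in RHS]eq_cint => u _ do rewrite -[u in expR (- u)]mul1r.
have h1 := cintble_gamma ltr01 s1; have hA := cintble_gamma A0 s1.
rewrite [cint _ (fun u => _ * (expR (- (1 * u)))%:C)]cint_patch.
rewrite (cint_affine 0 A0 (cintble_patch mD h1)) cpowN//.
rewrite [LHS]cint_patch.
have -> : (fun x => if A * x + 0 \in `]0, +oo[%classic then
    cpow (A * x + 0) (s - 1) * (expR (- (1 * (A * x + 0))))%:C else 0) =
  (fun x => cpow A (s - 1) * (if x \in `]0, +oo[%classic then cpow x (s - 1) * (expR (- (A * x)))%:C else 0)).
  apply/funext => x; rewrite addr0 mul1r.
  have -> : (A * x \in `]0, +oo[%classic) = (x \in `]0, +oo[%classic).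
    by rewrite !mem_setE !in_itv /= !andbT pmulr_rgt0.
  case: ifPn => [|_]; last by rewrite mulr0.
  rewrite mem_setE in_itv /= andbT => x0.
  by rewrite cpowM// mulrA.
rewrite cintZ//; last exact: cintble_patch.
have As : cpow A s = A%:C * cpow A (s - 1).
  by rewrite -(cpowr1 A0) -cpowD// addrC subrK.
have AC : A%:C != 0 :> R[i] by rewrite eq_complex /= eqxx andbT gt_eqF.
by rewrite As; field; rewrite cpow_neq0.
Qed.

End GammaIntegrals.

(** * Exchange of the Gamma and Gaussian integrals *)

Section GammaRatio.
Variable R : realType.
Local Notation mu := (@lebesgue_measure R).
Implicit Types (s w : R[i]) (A p u x : R).
Let D : set (measurableTypeR R) := `]0, +oo[%classic.
Let mD : measurable D. Proof. exact: measurable_itv. Qed.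

Lemma integrable_gauss_scaled u : 0 < u ->
  mu.-integrable setT (fun x => (expR (- (u * x ^+ 2)))%:E).
Proof.
move=> u0; have s0 : 0 < Num.sqrt u by rewrite sqrtr_gt0.
apply: (integrable_eqr _ (integrable_affine 0 s0 (@integrableT_gauss R))) => // x _.
by rewrite /gauss_fun addr0 exprMn sqr_sqrtr// ltW.
Qed.

Lemma integral_gauss_scaled u : 0 < u ->
  Rintegral mu setT (fun x => expR (- (u * x ^+ 2))) = Num.sqrt pi * u `^ (- 2^-1).
Proof.
move=> u0; have s0 : 0 < Num.sqrt u by rewrite sqrtr_gt0.
have := Rintegral_affine 0 s0 (@integrableT_gauss R).
rewrite {1}/Rintegral integralT_gauss /= => ->.
rewrite powRN powR12_sqrt ?ltW// mulrAC divff ?gt_eqF// mul1r.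
by apply: eq_Rintegral => x _; rewrite /gauss_fun addr0 exprMn sqr_sqrtr// ltW.
Qed.

Lemma Rintegral_swap (f : R * R -> R) :
  (mu \x mu)%E.-integrable setT (EFin \o f) ->
  (forall x, mu.-integrable setT (fun u => (f (x, u))%:E)) ->
  (forall u, mu.-integrable setT (fun x => (f (x, u))%:E)) ->
  Rintegral mu setT (fun x => Rintegral mu setT (fun u => f (x, u))) =
  Rintegral mu setT (fun u => Rintegral mu setT (fun x => f (x, u))).
Proof.
move=> fi f1 f2; rewrite /Rintegral; congr fine.
have := Fubini fi => /= E.
transitivity (\int[mu]_x \int[mu]_u (f (x, u))%:E)%E.
  by apply: eq_integral => x _; rewrite fineK// integrable_fin_num.
rewrite E; apply: eq_integral => u _; rewrite fineK// integrable_fin_num//.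
Qed.

(** Stated for a real q, to be applied to the real and imaginary parts of u^(s - 1). Integrating the
    absolute value over x first leaves at most a multiple of u^(p - 1/2) exp(- u), whose
    integrability is ensured by p > 1 / 2. *)
Lemma gamma_kernel_swap (q : R -> R) p : 1 / 2 < p -> measurable_fun [set: R] q ->
  (forall u, 0 < u -> `|q u| <= u `^ p) ->
  Rintegral mu setT (fun x => Rintegral mu D (fun u => q u * expR (- ((1 + x ^+ 2) * u)))) =
  Rintegral mu D (fun u => q u * expR (- u) * (Num.sqrt pi * u `^ (- 2^-1))).
Proof.
move=> p2 mq qp.
pose f (z : R * R) := (q \_ D) z.2 * expR (- ((1 + z.1 ^+ 2) * z.2)).
have mqD : measurable_fun setT (q \_ D).
  by apply/(measurable_restrictT _ mD); exact: measurable_funTS.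
have mf : measurable_fun setT f.
  apply: measurable_funM; first exact: measurableT_comp.
  apply: measurableT_comp => //; apply: measurable_funN; apply: measurable_funM => //.
  by apply: measurable_funD => //; apply: measurable_funX.
have p0 : 0 < p by lra.
have qD u : `|(q \_ D) u| = (`|q u| : R) * \1_D u.
  rewrite patchE indicE; case: ifPn; first by rewrite mulr1.
  by rewrite mulr0 normr0.
have f1 x : mu.-integrable setT (fun u => (f (x, u))%:E).
  have x1 : 0 < 1 + x ^+ 2 by have := sqr_ge0 x; lra.
  have h := (integrable_mkcond _ mD).1 (integrable_gamma x1 p0).
  apply: (le_integrable measurableT _ _ h).
    by apply/measurable_EFinP; apply: (measurableT_comp mf).
  move=> u _; rewrite /f /= patchE /= patchE; case: ifPn => [|_]; last by rewrite mul0r lexx.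
  rewrite inE /D /= in_itv /= andbT => u0.
  by rewrite lee_fin !normrM ler_wpM2r// (ger0_norm (powR_ge0 _ _)) qp.
have f2 u : mu.-integrable setT (fun x => (f (x, u))%:E).
  rewrite /f /= patchE; case: ifPn => [|_]; last first.
    have h := integrable0 mu [set: R].
    by apply: (integrable_eqr measurableT h) => x _; rewrite mul0r.
  rewrite inE /D /= in_itv /= andbT => u0.
  apply: (integrable_eqr _ (integrableZl measurableT (q u * expR (- u)) (integrable_gauss_scaled u0))) => // x _.
  rewrite -EFinM -mulrA -expRD; congr (_ * expR _)%:E; ring.
have fi : (mu \x mu)%E.-integrable setT (EFin \o f).
  apply/integrable21ltyP; first exact/measurable_EFinP.
  have p12 : 0 < p - 2^-1 by lra.
  have h := integrableZl measurableT (Num.sqrt pi)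
    ((integrable_mkcond _ mD).1 (integrable_gamma (@ltr01 R) p12)).
  apply: le_lt_trans (integrable_lty measurableT h).
  apply: ge0_le_integral => //.
  - by move=> u _; exact: integral_ge0.
  - apply: (measurable_fun_fubini_tonelli_G (m1 := mu) (abse \o (EFin \o f))).
      by apply: measurableT_comp => //; exact/measurable_EFinP.
    by move=> z; exact: abse_ge0.
  - by have [] := integrableP _ _ _ h.
  move=> u _; rewrite patchE; case: ifPn => uD; last first.
    rewrite mule0 integral0_eq// => x _.
    by rewrite /f /= patchE (negPf uD) mul0r normr0.
  move: (uD); rewrite inE /D /= in_itv /= andbT => u0.
  have gi := integrable_gauss_scaled u0.
  have E : (\int[mu]_x (expR (- (u * x ^+ 2)%R))%:E = (Num.sqrt pi * u `^ (- 2^-1))%:E)%E.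
    by rewrite -integral_gauss_scaled// /Rintegral fineK// integrable_fin_num.
  have -> : (\int[mu]_x `|f (x, u)|%:E =
      \int[mu]_x ((`|q u| * expR (- u))%:E * (expR (- (u * x ^+ 2)%R))%:E))%E.
    apply: eq_integral => x _; rewrite /f /= patchE uD normrM (ger0_norm (expR_ge0 _)).
    by rewrite -EFinM -mulrA -expRD; congr (_ * expR _)%:E; ring.
  rewrite integralZl//.
  rewrite E -!EFinM lee_fin mul1r.
  have -> : u `^ (p - 2^-1) = u `^ p * u `^ (- 2^-1).
    by rewrite powRD// (gt_eqF u0) implybT.
  have := qp u u0; have : 0 <= expR (- u) * (Num.sqrt pi * u `^ (- 2^-1)).
    by rewrite !mulr_ge0 ?expR_ge0 ?sqrtr_ge0 ?powR_ge0.
  move: (Num.sqrt pi) (u `^ (- 2^-1)) (expR (- u)) (u `^ p) => a b c d H1 H2.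
  have := ler_wpM2r H1 H2; lra.
transitivity (Rintegral mu setT (fun x => Rintegral mu setT (fun u => f (x, u)))).
  apply: eq_Rintegral => x _; rewrite Rintegral_mkcond; apply: eq_Rintegral => u _.
  by rewrite /f /= !patchE; case: ifP => // _; rewrite mul0r.
rewrite (Rintegral_swap fi f1 f2) [RHS]Rintegral_mkcond; apply: eq_Rintegral => u _.
rewrite patchE; case: ifPn => uD; last first.
  by rewrite /Rintegral integral0_eq// => x _; rewrite /f /= patchE (negPf uD) mul0r.
move: (uD); rewrite inE /D /= in_itv /= andbT => u0.
rewrite -(integral_gauss_scaled u0) -(RintegralZl _ _ (integrable_gauss_scaled u0))//.
apply: eq_Rintegral => x _; rewrite /f /= patchE uD -mulrA -expRD; congr (_ * expR _); ring.
Qed.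

End GammaRatio.

(** * The integral of (1 + x^2)^(- s) *)

Section BetaIntegral.
Variable R : realType.
Local Notation mu := (@lebesgue_measure R).
Implicit Types (s w : R[i]) (x u : R).
Let D : set (measurableTypeR R) := `]0, +oo[%classic.
Let mD : measurable D. Proof. exact: measurable_itv. Qed.

Definition kern x : R := (1 + x ^+ 2)^-1.

Lemma kern_gt0 x : 0 < kern x.
Proof. by rewrite invr_gt0; have := sqr_ge0 x; lra. Qed.

Lemma kern_le1 x : kern x <= 1.
Proof. by rewrite invf_le1; have := sqr_ge0 x; lra. Qed.

Lemma measurable_kern : measurable_fun [set: R] kern.
Proof.
rewrite (_ : kern = (fun x : R => x `^ (-1)) \o (fun x => 1 + x ^+ 2)).
  apply: measurableT_comp; first exact: measurable_powR.
  by apply: measurable_funD => //; apply: measurable_funX.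
by apply/funext => x /=; rewrite powR_inv1//; have := sqr_ge0 x; lra.
Qed.

Lemma integrable_kern : mu.-integrable setT (EFin \o kern).
Proof.
apply/integrableP; split; first by apply/measurable_EFinP; exact: measurable_kern.
under eq_integral do rewrite /= ger0_norm ?ltW ?kern_gt0//.
rewrite ge0_symfun_integralT//=.
- rewrite (_ : [set x | _] = `[0, +oo[%classic); last first.
    by apply/seteqP; split => x /=; rewrite in_itv /= andbT.
  by rewrite integral0y_oneDsqr -EFinM ltry.
- by move=> x; rewrite ltW// kern_gt0.
- exact: continuous_oneDsqrV.
- by move=> x; rewrite /kern /= sqrrN.
Qed.

Lemma measurable_cpow_Re (h : R -> R) s : measurable_fun [set: R] h ->
  measurable_fun [set: R] (fun x => complex.Re (cpow (h x) s)).
Proof. by move=> mh; apply: (measurableT_comp (measurable_Re_cpow s) mh). Qed.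

Lemma measurable_cpow_Im (h : R -> R) s : measurable_fun [set: R] h ->
  measurable_fun [set: R] (fun x => complex.Im (cpow (h x) s)).
Proof. by move=> mh; apply: (measurableT_comp (measurable_Im_cpow s) mh). Qed.

Definition kern_int s : R[i] := cint setT (fun x => cpow (kern x) s).

Lemma cintble_kern s : 1 < complex.Re s -> cintble setT (fun x => cpow (kern x) s).
Proof.
move=> s1; have mT := @measurableT _ (measurableTypeR R).
apply: (@cintble_bound _ _ _ kern) => //.
- exact: measurable_cpow_Re measurable_kern.
- exact: measurable_cpow_Im measurable_kern.
- move=> x _; have k0 := kern_gt0 x.
  have H : kern x `^ complex.Re s <= kern x.
    have -> : complex.Re s = 1 + (complex.Re s - 1) by ring.
    rewrite powRD; last by rewrite (gt_eqF k0) implybT.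
    rewrite (powRr1 (ltW k0)) ler_piMr//; first exact: ltW.
    have s0 : 0 <= complex.Re s - 1 by lra.
    have := ge0_ler_powR s0 (_ : kern x \in Num.nneg) (_ : 1 \in Num.nneg) (kern_le1 x).
    by rewrite powR1; apply; rewrite nnegrE// ltW.
  by split; apply: le_trans H; [exact: Re_cpow_le|exact: Im_cpow_le].
- exact: integrable_kern.
Qed.

Lemma gamma_ratio s : 2 < complex.Re s ->
  cGamma s * kern_int s = (Num.sqrt pi)%:C * cGamma (s - (2^-1)%:C).
Proof.
move=> s2; have s1 : 1 < complex.Re s by lra.
have Re2 : complex.Re (s - (2^-1)%:C) = complex.Re s - 2^-1 by case: (s).
rewrite /kern_int -cintZ//; last exact: cintble_kern.
have E1 x : cGamma s * cpow (kern x) s =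
    cint D (fun u => cpow u (s - 1) * (expR (- ((1 + x ^+ 2) * u)))%:C).
  have x0 : 0 < 1 + x ^+ 2 by have := sqr_ge0 x; lra.
  by rewrite cGamma_scale// cpowV.
rewrite (eq_cint (fun x _ => E1 x)).
have p2 : 1 / 2 < complex.Re s - 1 by lra.
have Res1 : complex.Re (s - 1) = complex.Re s - 1 by case: (s).
have Ere := @gamma_kernel_swap R (fun u => complex.Re (cpow u (s - 1))) _ p2
  (measurable_Re_cpow _) _.
have Eim := @gamma_kernel_swap R (fun u => complex.Im (cpow u (s - 1))) _ p2
  (measurable_Im_cpow _) _.
have s12 : 1 < complex.Re (s - (2^-1)%:C) by rewrite Re2; lra.
have h12 := cintble_gamma (@ltr01 R) s12.
have -> : cGamma (s - (2^-1)%:C) =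
    cint D (fun u => cpow u (s - 1) * (expR (- (1 * u)) * u `^ (- 2^-1))%:C).
  apply: eq_cint => u; rewrite inE /= in_itv /= andbT => u0.
  rewrite mul1r rmorphM /= -cpow_real (mulrC (expR _)%:C) mulrA -cpowD//.
  by congr (cpow _ _ * _); rewrite rmorphN /=; ring.
rewrite -cintZ//; last first.
  apply: (eq_cintble mD _ h12) => u; rewrite inE /D /= in_itv /= andbT => u0.
  rewrite rmorphM /= -cpow_real (mulrC (expR _)%:C) mulrA -cpowD//.
  by congr (cpow _ _ * _); rewrite rmorphN /=; ring.
have rc (z : R[i]) (a : R) : complex.Re (z * a%:C) = complex.Re z * a.
  by case: z => ? ? /=; rewrite mulr0 subr0.
have ic (z : R[i]) (a : R) : complex.Im (z * a%:C) = complex.Im z * a.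
  by case: z => ? ? /=; rewrite mulr0 add0r.
have rc' (z : R[i]) (a : R) : complex.Re (a%:C * z) = complex.Re z * a by rewrite mulrC rc.
have ic' (z : R[i]) (a : R) : complex.Im (a%:C * z) = complex.Im z * a by rewrite mulrC ic.
(* By definition the components of a nested [cint] are nested real integrals of components, so each
   one falls under the real exchange. *)
transitivity (Rintegral mu setT (fun x => Rintegral mu D
      (fun u => complex.Re (cpow u (s - 1) * (expR (- ((1 + x ^+ 2) * u)))%:C))) +i*
    Rintegral mu setT (fun x => Rintegral mu D
      (fun u => complex.Im (cpow u (s - 1) * (expR (- ((1 + x ^+ 2) * u)))%:C)))).
  by [].
have -> : Rintegral mu setT (fun x => Rintegral mu D
      (fun u => complex.Re (cpow u (s - 1) * (expR (- ((1 + x ^+ 2) * u)))%:C))) =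
    Rintegral mu D (fun u => complex.Re ((Num.sqrt pi)%:C *
      (cpow u (s - 1) * (expR (- (1 * u)) * u `^ (- 2^-1))%:C))).
  transitivity (Rintegral mu setT (fun x => Rintegral mu D
    (fun u => complex.Re (cpow u (s - 1)) * expR (- ((1 + x ^+ 2) * u))))).
    by apply: eq_Rintegral => x _; apply: eq_Rintegral => u _; rewrite rc.
  rewrite Ere; last by move=> u u0; rewrite -Res1; exact: Re_cpow_le.
  by apply: eq_Rintegral => u _; rewrite [RHS]rc' rc mul1r; ring.
have -> : Rintegral mu setT (fun x => Rintegral mu D
      (fun u => complex.Im (cpow u (s - 1) * (expR (- ((1 + x ^+ 2) * u)))%:C))) =
    Rintegral mu D (fun u => complex.Im ((Num.sqrt pi)%:C *
      (cpow u (s - 1) * (expR (- (1 * u)) * u `^ (- 2^-1))%:C))).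
  transitivity (Rintegral mu setT (fun x => Rintegral mu D
    (fun u => complex.Im (cpow u (s - 1)) * expR (- ((1 + x ^+ 2) * u))))).
    by apply: eq_Rintegral => x _; apply: eq_Rintegral => u _; rewrite ic.
  rewrite Eim; last by move=> u u0; rewrite -Res1; exact: Im_cpow_le.
  by apply: eq_Rintegral => u _; rewrite [RHS]ic' ic mul1r; ring.
by [].
Qed.

End BetaIntegral.

(** * Moments and first-order estimates of Laplace transforms *)

Section GammaNonzero.
Variable R : realType.
Local Notation mu := (@lebesgue_measure R).
Implicit Types (s w : R[i]) (x u p h : R).
Let D : set (measurableTypeR R) := `]0, +oo[%classic.
Let mD : measurable D. Proof. exact: measurable_itv. Qed.

(** This is Gamma(p + 1) for real p. *)
Definition gmom p : R := Rintegral mu D (fun u => u `^ p * expR (- u)).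

Lemma integrable_gmom p : 0 < p ->
  mu.-integrable D (EFin \o (fun u => u `^ p * expR (- u))).
Proof.
move=> p0; apply: (integrable_eqr mD (integrable_gamma (@ltr01 R) p0)) => u _.
by rewrite mul1r.
Qed.

Lemma eq0_small (a C : R) : (forall h, 0 < h -> `|a| <= h * C) -> a = 0.
Proof.
move=> H; apply/eqP; rewrite -normr_le0 leNgt; apply/negP => a0.
have C0 : 0 < C by have := H 1 ltr01; lra.
have h0 : 0 < `|a| / (2 * C) by rewrite divr_gt0// mulr_gt0.
have := H _ h0; have -> : `|a| / (2 * C) * C = `|a| / 2 by field; rewrite gt_eqF.
by lra.
Qed.

Lemma expRN_quad x : 0 <= x -> 0 <= x - (1 - expR (- x)) <= x ^+ 2.
Proof.
move=> x0; have h1 := expR_ge1Dx (- x); have h2 := expR_ge1Dx x.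
have E : expR x * expR (- x) = 1 by rewrite -expRD subrr expR0.
have e0 := expR_gt0 (- x).
have h3 : (1 + x) * expR (- x) <= 1 by rewrite -[leRHS]E ler_wpM2r// ltW.
apply/andP; split; first by lra.
nra.
Qed.

(** For F(A) the integral of q(u) exp(- A u), this is F'(1) = - int u q(u) exp(- u) du in the form
    of a first-order expansion with an explicit error; the error comes from 0 <= x - (1 - exp(- x))
    <= x^2 at x = h u. *)
Lemma laplace_difference (q : R -> R) p h : 0 < p -> 0 < h ->
  measurable_fun [set: R] q -> (forall u, 0 < u -> `|q u| <= u `^ p) ->
  `|h * Rintegral mu D (fun u => u * q u * expR (- u)) -
    (Rintegral mu D (fun u => q u * expR (- u)) -
     Rintegral mu D (fun u => q u * expR (- ((1 + h) * u))))| <=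
  h ^+ 2 * gmom (p + 2).
Proof.
move=> p0 h0 mq qp.
have meas (f : R -> R) : measurable_fun [set: R] f -> measurable_fun D f by move=> ?; exact: measurable_funTS.
have mexp A : measurable_fun [set: R] (fun u : R => expR (- (A * u))).
  by apply: measurableT_comp => //; apply: measurable_funN; apply: measurable_funM.
have pw u : 0 < u -> u * u `^ p = u `^ (p + 1).
  by move=> u0; rewrite powRD ?(gt_eqF u0) ?implybT// powRr1 ?ltW// mulrC.
have pw2 u : 0 < u -> u ^+ 2 * u `^ p = u `^ (p + 2).
  move=> u0; rewrite powRD ?(gt_eqF u0) ?implybT// mulrC; congr (_ * _).
  by rewrite -powR_mulrn ?ltW.
have iA A : 0 < A -> mu.-integrable D (EFin \o (fun u => q u * expR (- (A * u)))).
  move=> A0; apply: (le_integrable mD _ _ (integrable_gamma A0 p0)).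
    by apply/measurable_EFinP; apply: meas; apply: measurable_funM.
  move=> u; rewrite /D /= in_itv /= andbT => u0.
  by rewrite lee_fin !normrM ler_wpM2r// (ger0_norm (powR_ge0 _ _)) qp.
have i1 : mu.-integrable D (EFin \o (fun u => q u * expR (- u))).
  by apply: (integrable_eqr mD (iA 1 ltr01)) => u _; rewrite /= mul1r.
have p1 : 0 < p + 1 by lra.
have p2 : 0 < p + 2 by lra.
have iu : mu.-integrable D (EFin \o (fun u => u * q u * expR (- u))).
  apply: (le_integrable mD _ _ (integrable_gamma (@ltr01 R) p1)).
    apply/measurable_EFinP; apply: meas; apply: measurable_funM; first exact: measurable_funM.
    by apply: measurableT_comp => //; exact: measurable_funN.
  move=> u; rewrite /D /= in_itv /= andbT => u0.
  rewrite lee_fin mul1r -pw// !normrM ler_wpM2r// ler_wpM2l// (ger0_norm (powR_ge0 _ _)).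
  exact: qp.
have h1 : 0 < 1 + h by lra.
rewrite -RintegralZl// -RintegralB//; [|exact: iA].
have ihu : mu.-integrable D (EFin \o (fun u => h * (u * q u * expR (- u)))).
  by apply: (integrable_eqr mD (integrableZl mD h iu)).
have iB : mu.-integrable D (EFin \o (fun u => q u * expR (- u) - q u * expR (- ((1 + h) * u)))).
  by apply: (integrable_eqr mD (integrableB mD i1 (iA _ h1))).
rewrite -RintegralB//.
apply: le_trans (le_normr_Rintegral mD _) _.
  by apply: (integrable_eqr mD (integrableB mD ihu iB)).
rewrite /gmom -RintegralZl//; last exact: integrable_gmom.
apply: le_Rintegral => //.
- apply: (integrable_eqr mD (integrable_abse (integrableB mD ihu iB))) => // u _.
- by apply: (integrable_eqr mD (integrableZl mD (h ^+ 2) (integrable_gmom p2))).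
move=> u; rewrite /D /= in_itv /= andbT => u0.
have -> : expR (- ((1 + h) * u)) = expR (- u) * expR (- (h * u)).
  by rewrite -expRD; congr expR; ring.
have -> : h * (u * q u * expR (- u)) - (q u * expR (- u) - q u * (expR (- u) * expR (- (h * u)))) =
  q u * expR (- u) * (h * u - (1 - expR (- (h * u)))) by ring.
have /andP[g1 g2] := expRN_quad (ltW (mulr_gt0 h0 u0)).
rewrite !normrM (ger0_norm (expR_ge0 _)) (ger0_norm g1) -pw2//.
have -> : h ^+ 2 * (u ^+ 2 * u `^ p * expR (- u)) = u `^ p * expR (- u) * (h * u) ^+ 2 by ring.
by apply: ler_pM => //; rewrite ler_wpM2r ?expR_ge0// qp.
Qed.

Lemma gmom_scale p h : 0 < p -> 0 < h ->
  Rintegral mu D (fun u => u `^ p * expR (- ((1 + h) * u))) =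
  gmom p * (1 + h) `^ (- (p + 1)).
Proof.
move=> p0 h0; have h1 : 0 < 1 + h by lra.
have s1 : 1 < complex.Re ((p + 1)%:C : R[i]) by rewrite /=; lra.
have E A : 0 < A -> cint D (fun u => cpow u ((p + 1)%:C - 1) * (expR (- (A * u)))%:C) =
    Rintegral mu D (fun u => u `^ p * expR (- (A * u))) +i* 0.
  move=> A0; rewrite /cint; congr (_ +i* _).
    apply: eq_Rintegral => u _.
    by rewrite (_ : _ - 1 = p%:C) ?cpow_real /= ?mulr0 ?subr0// rmorphD /= addrK.
  rewrite /Rintegral integral0_eq// => u _.
  by rewrite (_ : _ - 1 = p%:C) ?cpow_real /= ?mulr0 ?mul0r ?addr0// rmorphD /= addrK.
have := cGamma_scale h1 s1; rewrite (E _ h1).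
rewrite (_ : cGamma _ = gmom p +i* 0); last first.
  rewrite -[RHS](_ : cint D (fun u => cpow u ((p + 1)%:C - 1) * (expR (- (1 * u)))%:C) = _).
    by apply: eq_cint => u _; rewrite mul1r.
  rewrite (E 1 ltr01) /gmom; congr (_ +i* _); apply: eq_Rintegral => u _.
  by rewrite mul1r.
rewrite -rmorphN cpow_real => /eqP; rewrite eq_complex /= mul0r subr0.
by move=> /andP[/eqP].
Qed.

Lemma powRN_diff a h : 0 < a -> 0 < h ->
  `|a * h - (1 - (1 + h) `^ (- a))| <= a * (1 + a) * h ^+ 2.
Proof.
move=> a0 h0; have h1 : 0 < 1 + h by lra.
have l1 : ln (1 + h) <= h by apply: le_ln1Dx; lra.
have l2 : h / (1 + h) <= ln (1 + h).
  have : ln (1 + (- (h / (1 + h)))) <= - (h / (1 + h)).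
    by apply: le_ln1Dx; rewrite ltrNl opprK ltr_pdivrMr//; lra.
  have -> : 1 + - (h / (1 + h)) = (1 + h)^-1 by field; rewrite gt_eqF.
  by rewrite lnV ?posrE// lerN2.
have -> : (1 + h) `^ (- a) = expR (- (a * ln (1 + h))).
  by rewrite /powR gt_eqF//; congr expR; ring.
set L := ln (1 + h) in l1 l2 *.
have L0 : 0 <= L by apply: le_trans l2; rewrite divr_ge0 ?(ltW h0) ?(ltW h1).
have aL : 0 <= a * L by rewrite mulr_ge0 // ltW.
have /andP[g1 g2] := expRN_quad aL.
have hh : h - h ^+ 2 <= h / (1 + h).
  rewrite ler_pdivlMr//; have := exprn_gt0 3 h0; nra.
have aLh : a * L <= a * h by rewrite ler_wpM2l// ltW.
have aLh2 : a * (h - h ^+ 2) <= a * L.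
  by rewrite ler_wpM2l ?(ltW a0)//; lra.
have ah0 : 0 <= a * h by rewrite mulr_ge0 ?(ltW a0) ?(ltW h0).
have L2 : (a * L) ^+ 2 <= (a * h) ^+ 2 by rewrite ler_pXn2r ?nnegrE.
have E : a * (1 + a) * h ^+ 2 = a * h ^+ 2 + (a * h) ^+ 2 by ring.
rewrite E ler_norml; have := sqr_ge0 (a * h).
have : 0 <= a * h ^+ 2 by rewrite mulr_ge0 ?(ltW a0) ?sqr_ge0.
move: g1 g2 L2 aLh aLh2; rewrite mulrBr => *.
by apply/andP; split; lra.
Qed.

(** Let F(A) be the integral of u^p exp(- A u). Both sides are the coefficient of h in F(1) - F(1 +
    h): the left one by [laplace_difference], the right one because F(1 + h) = F(1) (1 + h)^(- p -
    1) by scaling. *)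
Lemma gmom_rec p : 0 < p -> gmom (p + 1) = (p + 1) * gmom p.
Proof.
move=> p0; apply/eqP; rewrite -subr_eq0; apply/eqP.
apply: (@eq0_small _ (gmom (p + 2) + (p + 1) * (2 + p) * `|gmom p|)) => h h0.
have H : forall u, 0 < u -> `|u `^ p| <= u `^ p by move=> u _; rewrite ger0_norm ?powR_ge0.
have := @laplace_difference (@powR R ^~ p) p h p0 h0 (measurable_powR p) H.
rewrite gmom_scale//.
have -> : Rintegral mu D (fun u => u * u `^ p * expR (- u)) = gmom (p + 1).
  apply: eq_Rintegral => u; rewrite inE /D /= in_itv /= andbT => u0.
  by rewrite powRD ?(gt_eqF u0) ?implybT// powRr1 ?ltW// (mulrC u).
rewrite -/(gmom p) => H1.
have p1 : 0 < p + 1 by lra.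
have H2 := powRN_diff p1 h0.
have H3 : `|((p + 1) * h - (1 - (1 + h) `^ (- (p + 1)))) * gmom p| <=
    (p + 1) * (1 + (p + 1)) * h ^+ 2 * `|gmom p|.
  by rewrite normrM ler_wpM2r.
rewrite -(ler_pM2l h0) -{1}(gtr0_norm h0) -normrM.
set x := (1 + h) `^ _ in H1 H3.
move: (gmom (p + 1)) (gmom p) x (gmom (p + 2)) H1 H3 => G1 G0 x G2 H1 H3.
have -> : h * (G1 - (p + 1) * G0) =
  (h * G1 - (G0 - G0 * x)) - ((p + 1) * h - (1 - x)) * G0 by ring.
apply: le_trans (ler_normB _ _) _.
by move: H1 H3; lra.
Qed.

Lemma gmom_gt0 p : 0 < p -> 0 < gmom p.
Proof.
move=> p0; have fi := integrable_gmom p0.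
have f0 u : 0 <= u `^ p * expR (- u) by rewrite mulr_ge0 ?powR_ge0 ?expR_ge0.
pose E : set (measurableTypeR R) := `[1, 2]%classic.
have mE : measurable E by exact: measurable_itv.
rewrite -lte_fin /gmom /Rintegral fineK; last exact: integrable_fin_num.
apply: (@lt_le_trans _ _ (\int[mu]_(u in E) (expR (- 2))%:E)%E).
  rewrite integral_cst//= [X in (_ * X)%E](_ : _ = mu `[1, 2]%classic)//.
  rewrite lebesgue_measure_itv /= lte_fin ltr1n -EFinB -EFinM lte_fin.
  by rewrite mulr_gt0 ?expR_gt0//; lra.
apply: (@le_trans _ _ (\int[mu]_(u in E) (u `^ p * expR (- u))%:E)%E); last first.
  apply: ge0_subset_integral => //.
  - by have [] := integrableP _ _ _ fi.
  - by move=> u _; rewrite lee_fin.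
  - by move=> u; rewrite /E /D /= !in_itv /= andbT => /andP[u1 _]; lra.
apply: ge0_le_integral => //.
- have [mf _] := integrableP _ _ _ fi; apply: measurable_funS mf => //.
  by move=> u; rewrite /E /D /= !in_itv /= andbT => /andP[u1 _]; lra.
- move=> u; rewrite /E /= in_itv /= => /andP[u1 u2]; rewrite lee_fin.
  rewrite -[leLHS]mul1r ler_pM ?expR_ge0// ?ler_expR; last by lra.
  by rewrite -(powRr0 u) ler_powR// ltW.
Qed.

End GammaNonzero.

(** * Absence of zeros of the Gamma function *)

Section GammaZeroFree.
Variable R : realType.
Local Notation mu := (@lebesgue_measure R).
Implicit Types (s w : R[i]) (x u p q t : R).
Let D : set (measurableTypeR R) := `]0, +oo[%classic.
Let mD : measurable D. Proof. exact: measurable_itv. Qed.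

Let ReC (a : R) (z : R[i]) : complex.Re (z * a%:C) = complex.Re z * a.
Proof. by case: z => x y /=; rewrite mulr0 subr0. Qed.

Let ImC (a : R) (z : R[i]) : complex.Im (z * a%:C) = complex.Im z * a.
Proof. by case: z => x y /=; rewrite mulr0 add0r. Qed.

(** If Gamma(s) = 0, scaling makes the integral of u^(s - 1) exp(- A u) vanish for every A > 0. So
    does its derivative at A = 1, which is - Gamma(s + 1). *)
Lemma cGamma_shift0 s : 1 < complex.Re s -> cGamma s = 0 -> cGamma (s + 1) = 0.
Proof.
move=> s1 G0; have p0 : 0 < complex.Re (s - 1) by case: (s) s1 => a b /=; lra.
have scale0 h : 0 < h ->
    Rintegral mu D (fun u => complex.Re (cpow u (s - 1)) * expR (- (h * u))) = 0 /\
    Rintegral mu D (fun u => complex.Im (cpow u (s - 1)) * expR (- (h * u))) = 0.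
  move=> h0; have := cGamma_scale h0 s1; rewrite G0 mul0r => /eqP.
  rewrite eq_complex => /andP[/eqP e1 /eqP e2]; split.
    by rewrite -[RHS]e1; apply: eq_Rintegral => u _; rewrite ReC.
  by rewrite -[RHS]e2; apply: eq_Rintegral => u _; rewrite ImC.
have one (q : R -> R) : measurable_fun [set: R] q ->
    (forall u, 0 < u -> `|q u| <= u `^ complex.Re (s - 1)) ->
    (forall h, 0 < h -> Rintegral mu D (fun u => q u * expR (- (h * u))) = 0) ->
    Rintegral mu D (fun u => u * q u * expR (- u)) = 0.
  move=> mq qp q0; apply: (@eq0_small _ _ (gmom (complex.Re (s - 1) + 2))) => h h0.
  have := laplace_difference p0 h0 mq qp; rewrite (q0 (1 + h)); last by lra.
  have -> : Rintegral mu D (fun u => q u * expR (- u)) = 0.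
    by rewrite -(q0 1 ltr01); apply: eq_Rintegral => u _; rewrite mul1r.
  by rewrite !subr0 normrM (gtr0_norm h0) expr2 -mulrA ler_pM2l.
have E1 := one _ (@measurable_Re_cpow R (s - 1)) (fun u _ => Re_cpow_le u (s - 1)) (fun h h0 => (scale0 h h0).1).
have E2 := one _ (@measurable_Im_cpow R (s - 1)) (fun u _ => Im_cpow_le u (s - 1)) (fun h h0 => (scale0 h h0).2).
have C u : 0 < u -> cpow u (s + 1 - 1) = cpow u (s - 1) * u%:C.
  by move=> u0; rewrite addrAC (cpowD (s - 1) 1 u0) cpowr1.
apply/eqP; rewrite eq_complex; apply/andP; split; apply/eqP.
  rewrite -[RHS]E1; apply: eq_Rintegral => u; rewrite inE /D /= in_itv /= andbT => u0.
  transitivity (complex.Re (cpow u (s - 1) * u%:C * (expR (- u))%:C)); first by rewrite -C.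
  by rewrite ReC ReC (mulrC u).
rewrite -[RHS]E2; apply: eq_Rintegral => u; rewrite inE /D /= in_itv /= andbT => u0.
transitivity (complex.Im (cpow u (s - 1) * u%:C * (expR (- u))%:C)); first by rewrite -C.
by rewrite ImC ImC (mulrC u).
Qed.

Lemma cos_ge_quadratic x : 1 - x ^+ 2 / 2 <= cos x.
Proof.
have sin_le (y : R) : 0 <= y -> sin y <= y.
  move=> y0; have [->|yn] := eqVneq y 0; first by rewrite sin0.
  have {yn}y0 : 0 < y by rewrite lt_neqAle eq_sym yn.
  have dsin z : z \in `]0, y[ -> is_derive z 1 (@sin R) (cos z) by move=> _; exact: is_derive_sin.
  have [|c _] := MVT y0 dsin.
    by apply: continuous_subspaceT => z; exact: continuous_sin.
  by rewrite sin0 !subr0 => ->; rewrite ler_piMl ?(ltW y0)// cos_le1.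
have sq (y : R) : sin y ^+ 2 <= y ^+ 2.
  wlog y0 : y / 0 <= y.
    move=> H; have [/H//|y0] := leP 0 y.
    by have := H (- y); rewrite sinN !sqrrN; apply; rewrite oppr_ge0 ltW.
  have m1 : - y <= sin y.
    have [yp|yp] := leP y pi; first by rewrite (@le_trans _ _ 0) ?oppr_le0// sin_ge0_pi// y0.
    by rewrite (le_trans _ (sin_geN1 y))// lerN2 (le_trans _ (ltW yp))// (le_trans _ (pi_ge2 R))// ler1n.
  have h1 : 0 <= y - sin y by rewrite subr_ge0 sin_le.
  have h2 : 0 <= y + sin y by lra.
  by have := mulr_ge0 h1 h2; rewrite -subr_sqr subr_ge0.
have -> : cos x = 1 - 2 * sin (x / 2) ^+ 2.
  rewrite {1}(_ : x = x / 2 + x / 2); last by field.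
  by rewrite cosD -!expr2 cos2sin2; ring.
by have := sq (x / 2); rewrite expr_div_n; lra.
Qed.

(** With y = ln x / 2 this reads y^2 <= (2 sinh y)^2. The bound is a combination of 1, x and 1 / x,
    so that its integral against u^(q - 1) exp(- u) is a combination of moments. *)
Lemma ln_sqr_le x : 0 < x -> ln x ^+ 2 <= 4 * (x - 2 + x^-1).
Proof.
move=> x0; pose y := ln x / 2; pose w := expR y.
have w0 : 0 < w := expR_gt0 y.
have xw : x = w ^+ 2.
  by rewrite -[LHS]lnK ?posrE// /w -expRM_natl; congr expR; rewrite /y; field.
have lx : ln x = 2 * y by rewrite /y; field.
have h1 : 1 + y <= w := expR_ge1Dx y.
have h2 : 1 - y <= w^-1 by rewrite -expRN; exact: expR_ge1Dx.
have ww : w * w^-1 = 1 by rewrite divff// gt_eqF.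
have v0 : 0 < w^-1 by rewrite invr_gt0.
rewrite lx xw -exprVn; set v := w^-1 in h2 ww v0 *.
suff : y ^+ 2 <= (w - v) ^+ 2.
  have -> : (w - v) ^+ 2 = w ^+ 2 - 2 * (w * v) + v ^+ 2 by ring.
  by rewrite ww mulr1 (_ : (2 * y) ^+ 2 = 4 * y ^+ 2) ?ler_pM2l//; ring.
have [y0|y0] := leP 0 y.
  have w1 : 1 <= w by lra.
  have v1 : v <= 1 by rewrite -ww ler_peMl// ltW.
  by rewrite ler_pXn2r ?nnegrE//; lra.
have v1 : 1 <= v by lra.
have w1 : w <= 1 by rewrite -ww ler_peMr// ltW.
rewrite -[leLHS]sqrrN -[leRHS]sqrrN ler_pXn2r ?nnegrE//; lra.
Qed.

(** Multiplication by q^(- i t) turns the oscillating factor of the real part into cos (t ln (u /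
    q)), which is close to 1 near the peak of u^(q - 1) exp(- u). The lower bound 1 - 2 t^2 (u / q -
    2 + q / u) for this cosine integrates to (q - 1 - 2 t^2) Gamma(q - 1). *)
Lemma cGamma_neq0_large s : 2 < complex.Re s ->
  2 * complex.Im s ^+ 2 < complex.Re s - 1 -> cGamma s != 0.
Proof.
case: s => q t /= q2 qt; have q0 : 0 < q by lra.
have s1 : 1 < complex.Re (q +i* t) by rewrite /=; lra.
pose c := cpow q (0 -i* t).
have gi := cintble_gamma (@ltr01 R) s1.
apply/eqP => G0.
have := cintZ c mD gi; rewrite (cGamma_scale (@ltr01 R) s1) G0 mul0r mulr0.
move=> /eqP; rewrite eq_complex => /andP[/eqP E _].
have [ci _] := cintbleZ c mD gi.
have iz k p : 0 < p -> mu.-integrable D (EFin \o (fun u => k * (u `^ p * expR (- u)))).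
  by move=> p0; apply: (integrable_eqr mD (integrableZl mD k (integrable_gmom p0))).
have p0 : 0 < q - 2 by lra.
have p1 : 0 < q - 1 by lra.
have i1 := iz (1 + 4 * t ^+ 2) _ p1.
have i2 := iz (2 * t ^+ 2 / q) _ q0.
have i3 := iz (2 * t ^+ 2 * q) _ p0.
have i23 : mu.-integrable D (EFin \o (fun u => 2 * t ^+ 2 / q * (u `^ q * expR (- u)) + 2 * t ^+ 2 * q * (u `^ (q - 2) * expR (- u)))).
  by apply: (integrable_eqr mD (integrableD mD i2 i3)).
pose G := gmom (q - 2).
have G_gt0 : 0 < G by apply: gmom_gt0; lra.
have G1 : gmom (q - 1) = (q - 1) * G.
  by rewrite (_ : q - 1 = q - 2 + 1) ?gmom_rec//; ring.
have G2 : gmom q = q * ((q - 1) * G).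
  by rewrite -G1 -{1}(subrK 1 q) gmom_rec// subrK.
have FE : Rintegral mu D (fun u => (1 + 4 * t ^+ 2) * (u `^ (q - 1) * expR (- u)) -
   (2 * t ^+ 2 / q * (u `^ q * expR (- u)) + 2 * t ^+ 2 * q * (u `^ (q - 2) * expR (- u)))) = (q - 1 - 2 * t ^+ 2) * G.
  rewrite RintegralB// RintegralD// !RintegralZl//; try exact: integrable_gmom.
  rewrite -![Rintegral _ _ _]/(gmom _) G1 G2 -/G; field; rewrite gt_eqF//.
have : (q - 1 - 2 * t ^+ 2) * G <= 0; last first.
  by rewrite pmulr_lle0//; lra.
rewrite -FE (_ : 0 = complex.Re (0 : R[i]))// -E; apply: le_Rintegral => //.
  by apply: (integrable_eqr mD (integrableB mD i1 i23)).
move=> u uD; have {uD}u0 : 0 < u by move: uD; rewrite /D /= in_itv /= andbT.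
have -> : complex.Re (c * (cpow u (q +i* t - 1) * (expR (- (1 * u)))%:C)) =
    u `^ (q - 1) * expR (- u) * cos (t * ln (u / q)).
  rewrite mul1r mulrA [in RHS]mulrAC ReC; congr (_ * _).
  rewrite /c !cpowE /= powRr0 lnM ?posrE ?invr_gt0// lnV ?posrE// subr0 mulrDr cosD.
  by rewrite mulNr mulrN cosN !sinN; ring.
have -> : u `^ q = u `^ (q - 1) * u.
  by rewrite -{3}[u]powRr1 ?ltW// -powRD ?subrK// (gt_eqF u0) implybT.
have -> : u `^ (q - 2) = u `^ (q - 1) * u^-1.
  rewrite -[u^-1]powR_inv1 ?ltW// -powRD; first by congr powR; ring.
  by rewrite (gt_eqF u0) implybT.
have x0 : 0 < u / q by rewrite divr_gt0.
have h1 := cos_ge_quadratic (t * ln (u / q)).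
have h2 : t ^+ 2 * ln (u / q) ^+ 2 <= t ^+ 2 * (4 * (u / q - 2 + (u / q)^-1)).
  by rewrite ler_wpM2l ?sqr_ge0// ln_sqr_le.
have P0 : 0 <= u `^ (q - 1) * expR (- u) by rewrite mulr_ge0 ?powR_ge0 ?expR_ge0.
apply: le_trans (ler_wpM2l P0 (_ : 1 - t ^+ 2 * (4 * (u / q - 2 + (u / q)^-1)) / 2 <= _)); last first.
  by apply: le_trans h1; rewrite exprMn; lra.
by rewrite invf_div le_eqVlt; apply/orP; left; apply/eqP; field; rewrite !gt_eqF.
Qed.

Lemma cGamma_neq0 s : 1 < complex.Re s -> cGamma s != 0.
Proof.
move=> s1; apply/eqP => G0.
have shift n : cGamma (s + n%:R) = 0 /\ 1 < complex.Re (s + n%:R).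
  elim: n => [|n [IH1 IH2]]; first by rewrite addr0.
  rewrite -natr1 addrA; split; first exact: cGamma_shift0.
  by move: IH2; case: (s + _) => a b /=; lra.
have shiftE n : s + n%:R = (complex.Re s + n%:R) +i* complex.Im s.
  by rewrite -(rmorph_nat (real_complex R)); case: (s) => a b; apply/eqP; rewrite eq_complex /= addr0 !eqxx.
have [n nP] : exists n : nat, 2 * complex.Im s ^+ 2 + 2 < n%:R.
  exists (Num.bound (2 * complex.Im s ^+ 2 + 2)).
  by apply: archi_boundP; have := sqr_ge0 (complex.Im s); lra.
have [G1 _] := shift n; move: G1; apply/eqP; apply: cGamma_neq0_large; rewrite shiftE /=.
  by have := sqr_ge0 (complex.Im s); lra.
by lra.
Qed.

End GammaZeroFree.

(** * Constant term of the Eisenstein series *)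

Section EsumIntegral.
Variable R : realType.
Local Notation mu := (@lebesgue_measure R).

(** The enumeration is chosen before the summand, so that one and the same series represents the sum
    at every point x; [P] marks the indices in use. *)
Lemma countable_esum_series (T : pointedType) (X : set T) : countable X ->
  exists (e : nat -> T) (P : pred nat), (forall n, P n -> X (e n)) /\
    forall a : T -> \bar R, (forall i, X i -> 0 <= a i)%E ->
      (\esum_(i in X) a i = \sum_(n <oo) (if P n then a (e n) else 0))%E.
Proof.
move=> /countable_bijP[B /card_esym/card_set_bijP[e [eF eI eS]]].
exists e, (mem B); split; first by move=> n; rewrite /= inE => /eF.
move=> a a0; have a0' n : (0 <= (if n \in B then a (e n) else 0))%E.
  by case: ifPn => //; rewrite inE => /eF/a0.
transitivity (\esum_(n in B) a (e n))%E; first exact: reindex_esum.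
by rewrite esum_mkcond nneseries_esumT.
Qed.

Lemma integral_esum (T : choiceType) (X : set T) (D : set (measurableTypeR R))
    (f : T -> R -> \bar R) : countable X -> measurable D ->
  (forall i, X i -> measurable_fun D (f i)) ->
  (forall i x, X i -> 0 <= f i x)%E ->
  measurable_fun D (fun x => \esum_(i in X) f i x)%E /\
  (\int[mu]_(x in D) (\esum_(i in X) f i x) = \esum_(i in X) \int[mu]_(x in D) f i x)%E.
Proof.
(* An empty index type is treated apart; otherwise the enumeration uses a point of it as default
   value. *)
elim/choicePpointed: T => T in X f *.
  rewrite (_ : X = set0); last by apply/seteqP; split => // t _; have := no t.
  move=> _ mD _ _; rewrite esum_set0; split.
    by rewrite (_ : (fun _ => _) = cst 0%E)//; apply/funext => x; rewrite esum_set0.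
  by under eq_integral do rewrite esum_set0; rewrite integral0.
move=> /countable_esum_series[e [P [PX H]]] mD mf f0.
pose F n x := if P n then f (e n) x else 0%E.
have F0 n x : (0 <= F n x)%E by rewrite /F; case: ifPn => // /PX; exact: f0.
have mF n : measurable_fun D (F n).
  by rewrite /F; case Pn : (P n); [exact: (mf _ (PX n Pn))|exact: measurable_cst].
have -> : (fun x => \esum_(i in X) f i x)%E = (fun x => \sum_(n <oo) F n x)%E.
  by apply/funext => x; rewrite H// => i Xi; exact: f0.
split; first by apply: ge0_emeasurable_sum => // n x Dx _; exact: F0.
rewrite integral_nneseries// H; last by move=> i Xi; apply: integral_ge0 => x _; exact: f0.
apply: eq_eseriesr => n _; rewrite /F; case: ifPn => // _.
by rewrite integral0.
Qed.

End EsumIntegral.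

(** * Unfolding along integer translations *)

Section Unfolding.
Variable R : realType.
Local Notation mu := (@lebesgue_measure R).
Local Notation rows := (@rows R).

(* Representatives of [rows] modulo the right action of the stabilizer of
   infinity, that is of the double cosets of [G3] other than the trivial one. *)
Definition rows01 : set (R * R) := [set q | rows q /\ 0 <= q.2 < 1].

Lemma rows_translate (q : R * R) (m : int) : rows q -> rows (q.1, q.2 + m%:~R).
Proof.
move=> [q0 [g [gG g0 g1]]]; split => //=; exists (g *m translation m%:~R).
rewrite [g]mkP mul_mk_translation !mkE; split=> //; last by rewrite g0 g1; ring.
by rewrite -mul_mk_translation -mkP; apply: G3M => //; exact: G3T.
Qed.

Lemma rows_countable : countable rows.
Proof.
pose f (w : seq 'I_4) : R * R := (word R w 1 0, word R w 1 1 / word R w 1 0).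
apply: (@sub_countable _ _ _ (f @` setT)).
  apply: subset_card_le => -[c p] /= [c0 [g [[w gw] g0 g1]]]; exists w => //=.
  rewrite /f -gw g0 g1 /=; congr (_, _); rewrite /= in c0 *; field.
  by rewrite gt_eqF.
exact: card_le_trans (card_image_le _ _) (countableP _).
Qed.

Lemma rows_bij : set_bij (rows01 `*` [set: int]) rows (fun t => (t.1.1, t.1.2 + t.2%:~R)).
Proof.
split.
- by move=> [q m] /= [[qr _] _]; exact: rows_translate.
- move=> [[c p] m] [[c' p'] m']; rewrite !inE /= => -[[_ /andP[h1 h2]] _] [[_ /andP[h1' h2']] _] [-> E].
  have mm : m = m'.
    have H (a b : int) (x y : R) : 0 <= x -> y < 1 -> x + a%:~R = y + b%:~R -> (a <= b)%R.
      move=> x0 y1 xy; have : (a%:~R : R) < (b + 1)%:~R by rewrite intrD; lra.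
      by rewrite ltr_int ltzD1.
    by apply/eqP; rewrite eq_le (H _ _ p p')//= (H _ _ p' p).
  by rewrite mm in E *; congr (_, _, _); apply: addIr E.
- move=> [c p] qr; exists ((c, p - (Num.floor p)%:~R), Num.floor p); last by rewrite /= subrK.
  split => //; split.
    by have := rows_translate (- Num.floor p) qr; rewrite /= rmorphN.
  by rewrite /= subr_ge0 floor_le_tmp ltrBlDl -intrD1 floorD1_gt.
Qed.

End Unfolding.

Section UnfoldingIntegral.
Variable R : realType.
Local Notation mu := (@lebesgue_measure R).
Local Notation rows := (@rows R).
Local Notation rows01 := (@rows01 R).
Let I01 : set (measurableTypeR R) := `[0, 1]%classic.
Let mI01 : measurable I01. Proof. exact: measurable_itv. Qed.

Lemma integral_periodize (g : R -> R) (p : R) : measurable_fun [set: R] g -> (forall x, 0 <= g x) ->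
  (\esum_(m in [set: int]) \int[mu]_(x in I01) (g (x + (p + m%:~R)))%:E = \int[mu]_x (g x)%:E)%E.
Proof.
move=> mg g0.
(* Half-open, so that each z lies in exactly one translate; the endpoint 1 does not affect the
   integrals. *)
pose J : set (measurableTypeR R) := `[0, 1[%classic.
have mJ : measurable J by exact: measurable_itv.
pose F (m : int) (z : R) : \bar R := (\1_J (z - (p + m%:~R)) * g z)%:E.
have F0 m z : (0 <= F m z)%E by rewrite lee_fin mulr_ge0.
have mF m : measurable_fun [set: measurableTypeR R] (F m).
  apply/measurable_EFinP; apply: measurable_funM => //.
  have mi : measurable_fun [set: measurableTypeR R] (\1_J : measurableTypeR R -> R) by exact: measurable_indic.
  apply: (measurableT_comp mi).
  exact: measurable_funB.
have E m : (\int[mu]_(x in I01) (g (x + (p + m%:~R)))%:E = \int[mu]_x F m x)%E.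
  rewrite (ge0_integral_affine (p + m%:~R) (@ltr01 R) (mF m) (F0 m)) mul1e.
  rewrite (_ : I01 = [set` `[0, 1]]) // -integral_itv_bndo_bndc; last first.
    apply/measurable_EFinP; apply: (measurableT_comp mg).
    by apply: measurable_funTS; exact: measurable_funD.
  rewrite integral_mkcond; apply: eq_integral => x _.
  rewrite patchE /F mul1r addrK indicE; case: ifPn => _; first by rewrite mul1r.
  by rewrite mul0r.
rewrite (eq_esum (fun m _ => E m)).
have [_ <-] := @integral_esum R int [set: int] setT F (countableP _) measurableT
   (fun m _ => mF m) (fun m z _ => F0 m z).
apply: eq_integral => z _; pose m0 := Num.floor (z - p).
rewrite (esumID [set m0]); last by move=> i _; exact: F0.
rewrite setTI esum_set1// esum1 ?adde0.
  rewrite /F indicE mem_set ?mul1r// /J /= in_itv /=.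
  have := floor_le_tmp (z - p); have := floorD1_gt (z - p); rewrite -/m0 intrD1 => h1 h2.
  by apply/andP; split; lra.
move=> m [_ /= mm]; rewrite /F indicE memNset ?mul0r// /J /= in_itv /= => /andP[h1 h2].
apply: mm; apply/esym; apply: floor_def; rewrite intrD1.
by apply/andP; split; lra.
Qed.

Lemma integral_unfold (h : R -> R -> R) : (forall c, measurable_fun [set: R] (h c)) ->
  (forall c x, 0 <= h c x) ->
  measurable_fun I01 (fun x => \esum_(q in rows) (h q.1 (x + q.2))%:E)%E /\
  (\int[mu]_(x in I01) (\esum_(q in rows) (h q.1 (x + q.2))%:E) =
   \esum_(q in rows01) \int[mu]_x (h q.1 x)%:E)%E.
Proof.
move=> mh h0.
have mq (q : R * R) : measurable_fun I01 (fun x => (h q.1 (x + q.2))%:E).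
  apply/measurable_EFinP; apply: (measurableT_comp (mh _)).
  by apply: measurable_funTS; exact: measurable_funD.
have [m1 E1] := @integral_esum R _ rows I01 (fun q x => (h q.1 (x + q.2))%:E) (@rows_countable R) mI01
  (fun q _ => mq q) (fun q x _ => h0 _ _).
split => //; rewrite E1 (reindex_esum _ _ _ _ (@rows_bij R)).
rewrite (_ : _ `*` _ = rows01 `*`` (fun=> [set: int])); last first.
  by apply/seteqP; split => -[q m].
rewrite -(@esum_esum _ _ _ _ _ (fun (q : R * R) (m : int) =>
   \int[mu]_(x in I01) (h q.1 (x + (q.2 + m%:~R)))%:E)%E); last first.
  by move=> q m _ _; apply: integral_ge0 => x _; rewrite lee_fin.
by apply: eq_esum => q _; rewrite integral_periodize.
Qed.

End UnfoldingIntegral.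

(** * Cosets of the stabilizer of infinity *)

Section StabilizerCosets.
Variable R : realType.
Implicit Types (g h : 'M[R]_2) (z : R[i]) (q : R * R).
Local Notation G3 := (@G3 R).
Local Notation rows := (@rows R).

Definition stab_coset g : set 'M[R]_2 := [set h *m g | h in stab G3 None].

Definition row_mx_of q : 'M[R]_2 :=
  xget 1%:M [set g | [/\ G3 g, g 1 0 = q.1 & g 1 1 = q.1 * q.2]].

Lemma row_mx_ofP q : rows q ->
  [/\ G3 (row_mx_of q), row_mx_of q 1 0 = q.1 & row_mx_of q 1 1 = q.1 * q.2].
Proof. by move=> [_ [g gq]]; rewrite /row_mx_of; case: xgetP => [h _ //|/(_ g)]. Qed.

Lemma stab_coset_row g h : stab_coset g h ->
  exists2 e : bool, h 1 0 = (-1) ^+ e * g 1 0 & h 1 1 = (-1) ^+ e * g 1 1.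
Proof.
move=> [k /G3_stab_None[m [->|->]] <-]; rewrite [g]mkP.
  by exists false; rewrite mul_translation_mk !mkE mul1r.
by exists true; rewrite mulNmx mul_translation_mk !mxE !mulN1r.
Qed.

Lemma stab_coset_id g : stab_coset g g.
Proof.
exists 1%:M; last by rewrite mul1mx.
by apply/G3_stab_None; exists 0; left; rewrite translationE mk1.
Qed.

Lemma stab_coset_eq g h : G3 g -> G3 h -> h 1 0 * g 1 1 - h 1 1 * g 1 0 = 0 ->
  stab_coset g = stab_coset h.
Proof.
have sub g' h' : G3 g' -> G3 h' -> h' 1 0 * g' 1 1 - h' 1 1 * g' 1 0 = 0 ->
    stab_coset h' `<=` stab_coset g'.
  move=> gG hG gh _ [k [kG kN] <-].
  have [[m hm]|] := G3_rows gG hG; last first.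
    by rewrite gh normr0; have := sqrt3_gt R; lra.
  have [t [tG tN] ->] : exists2 t, stab G3 None t & h' = t *m g'.
    by case: hm => ->; [exists (translation m%:~R)|exists (- translation m%:~R)];
      rewrite ?mulNmx//; apply/G3_stab_None; exists m; [left|right].
  exists (k *m t); last by rewrite mulmxA.
  split; first exact: G3M.
  by rewrite mob_bdM ?G3_SL2// tN.
move=> gG hG gh; apply/seteqP; split; apply: sub => //.
by apply/eqP; rewrite -oppr_eq0 -[X in X == _]/(- _); apply/eqP; rewrite -[RHS]gh; ring.
Qed.

Lemma stab_coset_G3 g h : G3 g -> stab_coset g h -> G3 h.
Proof. by move=> gG [k [kG _] <-]; exact: G3M. Qed.

Lemma stab_coset_den g h z : stab_coset g h -> den h z = den g z.
Proof.
by move=> [k /G3_stab_None[m [->|->]] <-]; rewrite ?mulNmx ?den_N den_translation.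
Qed.

Lemma stab_coset_height g z : G3 g -> 0 < complex.Im z ->
  complex.Im (mob (invmx 1%:M *m xget 1%:M (stab_coset g)) z) = complex.Im z / den g z.
Proof.
move=> gG z0; have hC : stab_coset g (xget 1%:M (stab_coset g)).
  exact: (xgetPex _ (ex_intro _ _ (stab_coset_id g))).
rewrite invmx1 mul1mx mob_Im ?(stab_coset_den _ hC)//.
exact: G3_SL2 (stab_coset_G3 gG hC).
Qed.

(** A coset is determined by its bottom row up to sign. [None] stands for the stabilizer itself,
    where c = 0, and [Some (c, p)] has the sign fixed by c > 0. The height does not depend on the
    representative picked by [xget]. *)
Lemma esum_stab_cosets (a : R -> \bar R) z : (forall x, 0 <= a x)%E -> 0 < complex.Im z ->
  (\esum_(C in stab_cosets G3 None) a (complex.Im (mob (invmx 1%:M *m xget 1%:M C) z)) =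
   a (complex.Im z) + \esum_(q in rows) a (complex.Im z / rnorm q z)%R)%E.
Proof.
move=> a0 z0; pose e (o : option (R * R)) :=
  stab_coset (if o is Some q then row_mx_of q else 1%:M).
pose P : set (option (R * R)) := None |` (Some @` rows).
have Pe : set_bij P (stab_cosets G3 None) e.
  split.
  - move=> _ [->|[q qr <-]] /=; first by exists 1%:M => //; exact: G3_1.
    by exists (row_mx_of q) => //; have [] := row_mx_ofP qr.
  - have inj1 q : rows q -> e None = e (Some q) -> False.
      move=> qr E; have := stab_coset_id (row_mx_of q); rewrite -/(e (Some q)) -E.
      have [_ q0 _] := row_mx_ofP qr; move=> /stab_coset_row[s + _].
      by rewrite q0 mk1 mkE mulr0 => H; case: qr; rewrite H ltxx.
    move=> o o'; rewrite !inE => -[->|[q qr <-]] [->|[q' qr' <-]] //.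
    + by move=> /(inj1 _ qr').
    + by move=> /esym/(inj1 _ qr).
    move=> E; have := stab_coset_id (row_mx_of q); rewrite -/(e (Some q)) E.
    have [_ e1 e2] := row_mx_ofP qr; have [_ e1' e2'] := row_mx_ofP qr'.
    move=> /stab_coset_row[s]; rewrite e1 e2 e1' e2'.
    have [q0 _] := qr; have [q0' _] := qr'; case: s; rewrite ?mulN1r ?mul1r.
      by move=> H; exfalso; lra.
    move=> H1; rewrite H1 => /(mulfI (lt0r_neq0 q0')).
    by move: H1; case: (q) (q') => [c p] [c' p'] /= -> ->.
  - move=> _ [g gG <-]; have [g0|g0] := eqVneq (g 1 0) 0.
      exists None; first by left.
      apply: stab_coset_eq => //; first exact: G3_1.
      by rewrite g0 mk1 !mkE mulr0 mul0r subrr.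
    have qr := G3_rowsP gG g0; exists (Some (`|g 1 0|, g 1 1 / g 1 0)).
      by right; exists (`|g 1 0|, g 1 1 / g 1 0).
    have [hG h0 h1] := row_mx_ofP qr; apply: stab_coset_eq => //.
    by rewrite h0 h1 /=; field.
rewrite (reindex_esum _ _ _ _ Pe) (esumID [set None])//.
have -> : P `&` [set None] = [set None].
  by apply/seteqP; split => o; [case|move=> ->; split => //; left].
have -> : P `&` ~` [set None] = Some @` rows.
  apply/seteqP; split => [t [[->|//] []]//|_ [q qr <-]].
  by split => //; right; exists q.
rewrite esum_set1// esum_image; last by move=> q q' _ _ [].
congr (_ + _)%E.
  rewrite stab_coset_height//; last exact: G3_1.
  by rewrite /den mk1 !mkE !mul0r expr0n addr0 add0r expr1n divr1.
apply: eq_esum => q qr; have [hG h0 h1] := row_mx_ofP qr.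
rewrite stab_coset_height// /den h0 h1 /rnorm; congr (a (_ / _)); ring.
Qed.

End StabilizerCosets.

(** * Convergence of the sum over double cosets *)

Section Summability.
Variable R : realType.
Local Notation rows01 := (@rows01 R).

(** Each of the cells of length X^-2 that meet [0, 1[ contains at most one p. *)
Lemma rows01_count (X : R) (s : seq (R * R)) : uniq s -> 0 <= X ->
  (forall q, q \in s -> rows01 q /\ q.1 <= X) -> (size s <= (Num.truncn (X ^+ 2)).+1)%N.
Proof.
move=> us X0 sX; rewrite -(size_map (row_index X 0)) -(size_iota 0 (Num.truncn _).+1).
apply: uniq_leq_size.
  rewrite map_inj_in_uniq// => q q' /sX[[qr /andP[q0 _]] qX] /sX[[qr' /andP[q0' _]] qX'].
  exact: row_index_inj.
move=> _ /mapP[q /sX[[qr /andP[q0 q1]] qX] ->]; rewrite mem_iota add0n /=.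
by have := row_index_lt X0 q0 q1; rewrite subr0 mul1r.
Qed.

Lemma dyadic_ceil (c : R) : 1 <= c -> exists j : nat, c <= 2 ^+ j <= 2 * c.
Proof.
move=> c1; have ex : exists j : nat, c <= 2 ^+ j.
  exists (Num.truncn c).+1; apply/ltW/(lt_le_trans (truncnS_gt c)).
  by rewrite -natrX ler_nat ltnW// ltn_expl.
case: (ex_minnP ex) => -[|j] h1 h2; first by exists 0%N; rewrite h1 /= expr0; lra.
exists j.+1; rewrite h1 /= exprS ler_pM2l// ltW// ltNge.
by apply/negP => /h2; rewrite ltnn.
Qed.

Lemma rows01_summable (a : R) : 2 < a ->
  (\esum_(q in rows01) (q.1 `^ (- a))%:E < +oo)%E.
Proof.
(* Dyadic decomposition: at most 4^j + 1 <= 2 * 4^j rows have c <= 2^j, and a row with c <= 2^j <= 2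
   c contributes at most [w j]. The resulting ratio x = 4 * 2^(- a) is below 1 because a > 2. *)
move=> a2; pose b : R := 2 `^ (- a); pose x := 4 * b.
have b0 : 0 < b by rewrite powR_gt0.
have x1 : x < 1.
  have : b < 2 `^ (- 2) by rewrite /b /powR pnatr_eq0 /= ltr_expR ltr_pM2r ?ltrN2// ln_gt0// ltr1n.
  by rewrite powRN (_ : 2 `^ 2 = 4) /x; [lra|rewrite (powR_mulrn 2)// -natrX].
have x0 : 0 < x by rewrite mulr_gt0.
pose w j := 2 `^ a * b ^+ j.
have w0 j : 0 <= w j by rewrite mulr_ge0 ?powR_ge0// exprn_ge0// ltW.
pose M := 2 `^ a * 2 / (1 - x).
apply: (@le_lt_trans _ _ M%:E); last exact: ltry.
apply: ge_ereal_sup => _ [F [finF FX] <-].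
rewrite fsbig_finite//= sumEFin lee_fin.
set s : seq (R * R) := finmap.enum_fset (fset_set F).
have us : uniq s by exact: finmap.fset_uniq.
have sX q : q \in s -> rows01 q by move=> qs; apply: FX; move: qs; rewrite in_fset_set// inE.
have c1 q : q \in s -> 1 <= q.1.
  by move=> /sX[/rows_ge qr _]; have := sqrt3_gt R; lra.
have [J JP] : exists J : nat, forall q, q \in s -> exists2 j : 'I_J, q.1 <= 2 ^+ j & q.1 `^ (- a) <= w j.
  have one q : q \in s -> exists j : nat, q.1 <= 2 ^+ j /\ q.1 `^ (- a) <= w j.
    move=> /c1 q1; have [j /andP[j1 j2]] := dyadic_ceil q1; exists j; split => //.
    have q0 : 0 < q.1 by lra.
    have -> : w j = (2 ^+ j / 2) `^ (- a).
      rewrite powRM ?invr_ge0 ?exprn_ge0// mulrC /w; congr (_ * _).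
        by rewrite -powR_inv1// -powRrM mulN1r opprK.
      rewrite /b -[RHS]/(_ `^ _) -(powR_mulrn _ (ltW b0)) -(powR_mulrn j (ler0n R 2)) -!powRrM.
      by congr powR; ring.
    rewrite !powRN lef_pV2 ?posrE ?powR_gt0// ?divr_gt0 ?exprn_gt0//.
    have j3 : 2 ^+ j / 2 <= q.1 by rewrite ler_pdivrMr//; lra.
    by rewrite ge0_ler_powR ?nnegrE ?divr_ge0 ?exprn_ge0 ?(ltW q0)//; lra.
  elim: (s) one => [|q t IH] one; first by exists 0%N.
  have [J JP] := IH (fun q' (qt : q' \in t) => one q' (@mem_behead _ (q :: t) q' qt)).
  have [j [j1 j2]] := one q (mem_head q t).
  exists (maxn J j.+1) => q'; rewrite inE => /orP[/eqP ->|/JP[i i1 i2]].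
    by exists (Ordinal (leq_maxr J j.+1)).
  by exists (widen_ord (leq_maxl J j.+1) i).
(* A row is charged at every level j with c <= 2^j, not only at its own, so that after exchanging
   the sums each level is bounded by [rows01_count]. *)
have H1 : \sum_(q <- s) q.1 `^ (- a) <= \sum_(q <- s) \sum_(j < J) (w j * (q.1 <= 2 ^+ j)%R%:R : R).
  rewrite big_seq [leRHS]big_seq; apply: ler_sum => q qs.
  have [j j1 j2] := JP q qs; rewrite (bigD1 j)//= j1 mulr1.
  by apply: le_trans j2 _; rewrite lerDl sumr_ge0// => i _; rewrite mulr_ge0.
apply: (le_trans H1); rewrite exchange_big /=.
apply: (@le_trans _ _ (\sum_(j < J) 2 `^ a * 2 * x ^+ j)).
  apply: ler_sum => j _; rewrite -mulr_sumr -natr_sum /w.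
  have -> : 2 `^ a * 2 * x ^+ j = 2 `^ a * b ^+ j * (2 * 4 ^+ j) by rewrite exprMn; ring.
  rewrite ler_wpM2l ?mulr_ge0 ?powR_ge0 ?exprn_ge0 ?(ltW b0)//.
  rewrite -big_mkcond /= sum1_count -size_filter.
  apply: (@le_trans _ _ ((Num.truncn ((2 ^+ j : R) ^+ 2)).+1)%:R).
    rewrite ler_nat; apply: rows01_count; rewrite ?filter_uniq ?exprn_ge0//.
    by move=> q; rewrite mem_filter => /andP[qj /sX].
  have h4 : (2 ^+ j) ^+ 2 = 4 ^+ j :> R by rewrite exprAC -natrX.
  rewrite h4 -natr1; have : (Num.truncn (4 ^+ j : R))%:R <= 4 ^+ j :> R by rewrite truncn_le exprn_ge0.
  have : 1 <= 4 ^+ j :> R by rewrite exprn_ege1// ler1n.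
  by lra.
rewrite -mulr_sumr /M ler_wpM2l ?mulr_ge0 ?powR_ge0//.
rewrite -[leRHS]mul1r ler_pdivlMr ?subr_gt0// mulrC -opprB mulNr -subrX1 opprB.
by rewrite lerBlDr lerDl exprn_ge0 ?ltW.
Qed.

End Summability.

(** * The increasing sequence of lower left entries *)

Section Enumeration.
Variable R : realType.
Local Notation r := (Num.sqrt 3 : R).
Local Notation rows := (@rows R).
Local Notation rows01 := (@rows01 R).

(** Unboundedness and local finiteness provide a successor function, iterated from 0, which lies
    below C. An element never reached would have infinitely many elements of C below it. *)
Lemma increasing_enum (C : set R) : (forall c, C c -> 0 < c) ->
  (forall X, finite_set [set c | C c /\ c <= X]) ->
  (forall X, exists2 c, C c & X < c) ->
  exists g : nat -> R, [/\ g 0%N = 0, (forall k, g k < g k.+1),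
    (forall k, C (g k.+1)) & forall c, C c -> exists k, c = g k.+1].
Proof.
move=> C0 Cfin Cunb.
have H x : exists c, [/\ C c, x < c & forall c', C c' -> x < c' -> c <= c'].
  have [c0 c0C xc0] := Cunb x.
  have fin : finite_set [set c | [/\ C c, x < c & c <= c0]].
    by apply: sub_finite_set (Cfin c0) => c [].
  have [|c [cC xc cc0] cm] := finite_set_argmin id fin; first by exists c0; split.
  exists c; split => // c' c'C xc'; have [c'c0|c'c0] := leP c' c0; first exact: cm.
  exact: le_trans cc0 (ltW c'c0).
have [nx nxP] := choice H.
pose g k := iter k nx 0.
have gS k : g k.+1 = nx (g k) by [].
have ginc k : g k < g k.+1 by rewrite gS; have [] := nxP (g k).
have gC k : C (g k.+1) by rewrite gS; have [] := nxP (g k).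
exists g; split => // c cC.
have [k ck] : exists k, c <= g k.
  apply: contrapT => nk; have gc k : g k < c by rewrite ltNge; apply/negP => ?; apply: nk; exists k.
  have [s sE] := (finite_seqP _).1 (Cfin c).
  have ghomo : {homo g : i j / (i < j)%N >-> i < j} by apply: homo_ltn => // y x z; exact: lt_trans.
  have ginj : injective g.
    by move=> i j gij; case: (ltngtP i j) => // /ghomo; rewrite gij ltxx.
  have : (size [seq g k | k <- iota 1 (size s).+1] <= size s)%N.
    apply: uniq_leq_size; first by rewrite map_inj_uniq// iota_uniq.
    move=> _ /mapP[k + ->]; rewrite mem_iota => /andP[k1 _].
    have : [set c' | C c' /\ c' <= c] (g k) by split; [rewrite -(prednK k1); exact: gC|exact: ltW].
    by rewrite sE.
  by rewrite size_map size_iota ltnn.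
have ex : exists k, c <= g k by exists k.
case: (ex_minnP ex) => -[|j] cj jmin; first by have := C0 _ cC; rewrite ltNge cj.
exists j; apply/eqP; rewrite eq_le cj gS /=.
have [_ _ ] := nxP (g j); apply=> //.
by rewrite ltNge; apply/negP => /jmin; rewrite ltnn.
Qed.

Lemma increasing_gt0 (g : nat -> R) k : g 0%N = 0 -> (forall k, g k < g k.+1) ->
  (1 <= k)%N -> 0 < g k.
Proof.
move=> g0 ginc k0; rewrite -g0.
have ghomo : {homo g : i j / (i < j)%N >-> i < j} by apply: homo_ltn => // y x z; exact: lt_trans.
exact: ghomo.
Qed.

Definition row_column (c : R) : set (R * R) := [set q | rows01 q /\ q.1 = c].

Lemma finite_row_column c : finite_set (row_column c).
Proof.
apply: sub_finite_set (@rows_finite R c 0 1) => q [[qr /andP[q0 q1]] qc]; split => //.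
by rewrite qc.
Qed.

(** The Dirichlet coefficient d(c): the number of double cosets with lower left entry c. *)
Definition row_count (c : R) : nat := size (finmap.enum_fset (fset_set (row_column c))).

Lemma rows_to01 q : rows q -> exists p, rows01 (q.1, p).
Proof.
move=> qr; have [_ _ /(_ _ qr)[[[c p] m] [q0 _] <-]] := rows_bij R.
by exists p.
Qed.

Lemma lower_left_unbounded (X : R) : exists2 c, (exists p, rows01 (c, p)) & X < c.
Proof.
have [n nX] : exists n : nat, X < n%:R.
  by exists (Num.truncn X).+1; exact: truncnS_gt.
pose g : 'M[R]_2 := gS R *m translation (n : int)%:~R *m gU R.
have gG : G3 g by apply: G3M; [apply: G3M; [exact: G3S|exact: G3T]|exact: G3U].
have g10 : g 1 0 = 4 * r / 3 * 2 + 4 * r / 3 * n%:R * 4.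
  by rewrite /g mul_mk_translation mulmk mkE; ring.
have r1 := sqrt3_gt R; have n0 : 0 <= n%:R :> R by [].
have big : n%:R < g 1 0 by rewrite g10; nra.
have g0 : 0 < g 1 0 by lra.
have [p] := rows_to01 (G3_rowsP gG (lt0r_neq0 g0)); rewrite /= gtr0_norm// => qr.
by exists (g 1 0); [exists p|exact: lt_trans big].
Qed.

Lemma rows01_enum : exists g : nat -> R,
  [/\ g 1%N = 4 * r / 3, g 2%N = 4, (forall k, g k < g k.+1) &
      [/\ g 0%N = 0, (forall k, (0 < row_count (g k.+1))%N) &
      forall q, rows01 q -> exists k, q.1 = g k.+1]].
Proof.
pose C := [set c : R | exists p, rows01 (c, p)].
have Cge c : C c -> 4 * r / 3 <= c by move=> [p [/rows_ge]].
have r1 := sqrt3_gt R; have r2 := sqrt3_lt R.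
have C0 c : C c -> 0 < c by move=> /Cge; lra.
have Cfin X : finite_set [set c | C c /\ c <= X].
  apply: sub_finite_set (finite_image fst (@rows_finite R X 0 1)) => c [[p [qr /andP[p0 p1]]] cX].
  by exists (c, p).
have [g [g0 ginc gC Cg]] := increasing_enum C0 Cfin lower_left_unbounded.
have ghomo : {homo g : i j / (i <= j)%N >-> i <= j}.
  by apply: homo_leq => // [y x z|i]; [exact: le_trans|exact: ltW].
have C1 : C (4 * r / 3).
  have g10 : gS R 1 0 = 4 * r / 3 by rewrite mkE.
  have [|p] := rows_to01 (G3_rowsP (G3S R) _); first by rewrite g10 gt_eqF//; lra.
  by rewrite /= g10 gtr0_norm; [exists p|lra].
have C2 : C 4.
  have g10 : gU R 1 0 = 4 by rewrite mkE.
  have [|p] := rows_to01 (G3_rowsP (G3U R) _); first by rewrite g10 pnatr_eq0.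
  by rewrite /= g10 gtr0_norm//; exists p.
have g1 : g 1%N = 4 * r / 3.
  have [k gk] := Cg _ C1; apply/eqP; rewrite eq_le (Cge _ (gC 0%N)) andbT gk.
  exact: ghomo.
have g2 : g 2%N = 4.
  have [k gk] := Cg _ C2; apply/eqP; rewrite eq_le; apply/andP; split.
    rewrite gk; apply: ghomo; case: k gk => // gk.
    by move: g1; rewrite -gk => H; exfalso; lra.
  (* A value below 4 would be 0 or 4 / sqrt 3 by [G3_second_row], but it exceeds g 1. *)
  rewrite leNgt; apply/negP => g24.
  have [p [[/= _ [h [hG h0 _]]] _]] := gC 1%N.
  have h24 : `|h 1 0| < 4 by rewrite h0 gtr0_norm//; exact: C0 (gC 1%N).
  have := ginc 1%N; rewrite g1 => g12.
  by case: (G3_second_row hG h24); rewrite h0 ?gtr0_norm ?C0// => H; lra.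
exists g; split => //; split => // [k|[c p] qr]; last by apply: Cg; exists p.
have [p qr] := gC k; rewrite /row_count finmap.cardfs_gt0.
apply/finmap.fset0Pn; exists (g k.+1, p); rewrite in_fset_set ?inE//.
exact: finite_row_column.
Qed.

(** Grouping the rows by c, with finite fibres, turns the unordered sum into an ordered series with
    multiplicities. *)
Lemma rows01_series (g : nat -> R) (a : R -> R) : g 0%N = 0 -> (forall k, g k < g k.+1) ->
  (forall q, rows01 q -> exists k, q.1 = g k.+1) -> (forall c, 0 <= a c) ->
  (\esum_(q in rows01) (a q.1)%:E < +oo)%E ->
  (fun N => \sum_(1 <= k < N) (row_count (g k))%:R * a (g k)) @ \oo -->
  fine (\esum_(q in rows01) (a q.1)%:E).
Proof.
move=> g0 ginc gS a0 fin.
have ghomo : {homo g : i j / (i < j)%N >-> i < j} by apply: homo_ltn => // y x z; exact: lt_trans.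
have E : (\esum_(q in rows01) (a q.1)%:E = \sum_(k <oo) ((row_count (g k.+1))%:R * a (g k.+1))%:E)%E.
  have -> : rows01 = \bigcup_k row_column (g k.+1).
    apply/seteqP; split => [q qr|q [k _ []]//].
    by have [k qk] := gS q qr; exists k.
  rewrite nneseries_sum_bigcup; last by move=> q; rewrite lee_fin.
    apply: eq_eseriesr => k _; rewrite esum_fset; last by move=> q _; rewrite lee_fin.
      rewrite fsbig_finite /=; last exact: finite_row_column.
      rewrite (eq_big_seq (fun=> (a (g k.+1))%:E)); last first.
        by move=> q; rewrite in_fset_set ?inE; [move=> [_ ->]|exact: finite_row_column].
      by rewrite sumEFin big_const_seq count_predT iter_addr addr0 mulr_natl.
    exact: finite_row_column.
  apply/trivIsetP => i j _ _ ij; apply/seteqP; split => // q [[_ qi] [_ qj]].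
  have := ij; rewrite neq_ltn => /orP[] ij'.
    by have := ghomo i.+1 j.+1 ij'; rewrite -qi -qj ltxx.
  by have := ghomo j.+1 i.+1 ij'; rewrite -qi -qj ltxx.
(* Passing from N to N + 1 aligns the sums over 1 <= k < N + 1 with the series indexed by [k.+1]. *)
rewrite -(cvg_shiftS (fun N => \sum_(1 <= k < N) _)).
have nn k : true -> (0 <= ((row_count (g k.+1))%:R * a (g k.+1))%:E)%E.
  by rewrite lee_fin mulr_ge0.
have F0 : (0 <= \esum_(q in rows01) (a q.1)%:E)%E by apply: esum_ge0 => q _; rewrite lee_fin.
have LE : (\esum_(q in rows01) (a q.1)%:E = (fine (\esum_(q in rows01) (a q.1)%:E))%:E)%E.
  by rewrite fineK// ge0_fin_numE.
have : (fun n => \sum_(0 <= k < n) ((row_count (g k.+1))%:R * a (g k.+1))%:E)%E @ \oo -->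
    (fine (\esum_(q in rows01) (a q.1)%:E))%:E.
  by rewrite -LE E; apply: is_cvg_nneseries => k _ _; exact: nn.
move=> /fine_cvgP[_]; apply: cvg_trans; apply: near_eq_cvg; near=> n.
by rewrite /= sumEFin big_add1.
Unshelve. all: by end_near.
Qed.

End Enumeration.

(** * Averages over a period of sums over rows *)

Section RealAverages.
Variable R : realType.
Local Notation mu := (@lebesgue_measure R).
Local Notation rows := (@rows R).
Local Notation rows01 := (@rows01 R).
Let I01 : set (measurableTypeR R) := `[0, 1]%classic.
Let mI01 : measurable I01. Proof. exact: measurable_itv. Qed.

(** An integrable function is finite almost everywhere, so [fine] alters it only on a null set. This
    is needed because [rsum] applies [fine] at each point, while finiteness is obtained from the
    integral. *)
Lemma integral_fine (D : set (measurableTypeR R)) (f : R -> \bar R) : measurable D -> mu.-integrable D f ->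
  mu.-integrable D (EFin \o (fun x => fine (f x))) /\
  Rintegral mu D (fun x => fine (f x)) = fine (\int[mu]_(x in D) f x).
Proof.
move=> mD fi; have [mf _] := integrableP _ _ _ fi.
have mg : measurable_fun D (EFin \o (fun x => fine (f x))).
  by apply/measurable_EFinP; exact: (measurableT_comp (fine_measurable measurableT) mf).
split.
  by apply: (le_integrable mD mg _ fi) => x _ /=; case: (f x) => [u| |]; rewrite /= ?normr0 ?leey.
rewrite /Rintegral; congr fine; apply: ae_eq_integral => //.
by apply: filterS (integrable_ae mD fi) => x H xD; rewrite /= fineK//; exact: H.
Qed.

Lemma esum_scale_lty (T : choiceType) (X : set T) (f : T -> R) (M : R) : 0 <= M ->
  (forall i, 0 <= f i) -> (\esum_(i in X) (f i)%:E < +oo)%E ->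
  (\esum_(i in X) (M * f i)%:E < +oo)%E.
Proof.
move=> M0 f0; have e0 : (0 <= \esum_(i in X) (f i)%:E)%E by apply: esum_ge0 => i _; rewrite lee_fin.
case E : (\esum_(i in X) (f i)%:E)%E e0 => [S| |] // S0 _.
apply: (@le_lt_trans _ _ (M * S)%:E); last exact: ltry.
apply: ge_ereal_sup => _ [F [finF FX] <-].
have : (\sum_(i \in F) (f i)%:E <= S%:E)%E by rewrite -E; apply: ereal_sup_ubound; exists F.
rewrite !fsbig_finite// !sumEFin !lee_fin -mulr_sumr => H.
exact: ler_wpM2l.
Qed.

Lemma cvg_weighted_sumB (d u v w : nat -> R) (l1 l2 : R) :
  (fun N => \sum_(1 <= k < N) d k * u k) @ \oo --> l1 ->
  (fun N => \sum_(1 <= k < N) d k * v k) @ \oo --> l2 ->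
  (forall k, (1 <= k)%N -> w k = u k - v k) ->
  (fun N => \sum_(1 <= k < N) d k * w k) @ \oo --> l1 - l2.
Proof.
move=> c1 c2 E; rewrite (_ : (fun _ => _) =
  (fun N => \sum_(1 <= k < N) d k * u k - \sum_(1 <= k < N) d k * v k)); first exact: cvgB.
apply/funext => N; rewrite -sumrB; apply: eq_big_nat => k /andP[k1 _].
by rewrite E// mulrBr.
Qed.

Local Notation pos u := (Num.max u 0).

Let pos_ge0 (u : R) : 0 <= pos u. Proof. by rewrite le_max lexx orbT. Qed.

Let posB (u : R) : pos u - pos (- u) = u.
Proof. by case: (leP u 0); case: (leP (- u) 0) => h1 h2; lra. Qed.

Let pos_le (u b : R) : `|u| <= b -> pos u <= b /\ pos (- u) <= b.
Proof.
by rewrite ler_norml !ge_max => /andP[h1 h2]; split; apply/andP; split; lra.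
Qed.

Variable g : nat -> R.
Hypothesis g0 : g 0%N = 0.
Hypothesis ginc : forall k, g k < g k.+1.
Hypothesis gS : forall q, rows01 q -> exists k, q.1 = g k.+1.

Let g_gt0 k : (1 <= k)%N -> 0 < g k.
Proof. exact: increasing_gt0. Qed.

Lemma rows01_abs_series (psi : R -> R) (a M : R) : 2 < a -> 0 <= M ->
  (forall c, 0 < c -> `|psi c| <= M * c `^ (- a)) ->
  exists l : R, (fun N => \sum_(1 <= k < N) (row_count (g k))%:R * psi (g k)) @ \oo --> l.
Proof.
move=> a2 M0 psiM.
have fin (f : R -> R) : (forall c, 0 < c -> f c <= M * c `^ (- a)) ->
    (\esum_(q in rows01) (f q.1)%:E < +oo)%E.
  move=> fM; apply: le_lt_trans (esum_scale_lty M0 _ (rows01_summable a2)); last first.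
    by move=> q; rewrite powR_ge0.
  by apply: le_esum => q [[q0 _] _]; rewrite lee_fin; exact: fM.
have c1 := rows01_series g0 ginc gS (fun c => pos_ge0 (psi c))
  (fin (fun c => pos (psi c)) (fun c c0 => (pos_le (psiM c c0)).1)).
have c2 := rows01_series g0 ginc gS (fun c => pos_ge0 (- psi c))
  (fin (fun c => pos (- psi c)) (fun c c0 => (pos_le (psiM c c0)).2)).
by eexists; apply: (cvg_weighted_sumB c1 c2) => k _; rewrite /= posB.
Qed.

(** The two [fine] terms have the shape of [rsum], with u the contribution of the trivial coset.
    Domination by c^(- a) b(x) with a > 2 makes the sums of positive and of negative parts
    separately integrable, so that both can be unfolded and then subtracted. *)
Lemma average_rows (phi : R -> R -> R) (b : R -> R) (a u : R) : 2 < a ->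
  (forall c, measurable_fun [set: R] (phi c)) ->
  (forall c x, 0 < c -> `|phi c x| <= c `^ (- a) * b x) ->
  mu.-integrable setT (EFin \o b) ->
  (fun N => \sum_(1 <= k < N) (row_count (g k))%:R * Rintegral mu setT (phi (g k))) @ \oo -->
  Rintegral mu I01 (fun x =>
    fine ((pos u)%:E + \esum_(q in rows) (pos (phi q.1 (x + q.2)))%:E)%E -
    fine ((pos (- u))%:E + \esum_(q in rows) (pos (- phi q.1 (x + q.2)))%:E)%E) - u.
Proof.
move=> a2 mphi phib ib.
have part (f : R -> R -> R) (v : R) : (forall c, measurable_fun [set: R] (f c)) ->
    (forall c x, 0 <= f c x) -> (forall c x, 0 < c -> f c x <= c `^ (- a) * b x) -> 0 <= v ->
    [/\ (forall c, 0 < c -> mu.-integrable setT (EFin \o f c)),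
      (fun N => \sum_(1 <= k < N) (row_count (g k))%:R * Rintegral mu setT (f (g k))) @ \oo -->
        Rintegral mu I01 (fun x => fine (v%:E + \esum_(q in rows) (f q.1 (x + q.2))%:E)%E) - v &
      mu.-integrable I01 (EFin \o (fun x => fine (v%:E + \esum_(q in rows) (f q.1 (x + q.2))%:E)%E))].
  move=> mf f0 fb v0.
  have fi c : 0 < c -> mu.-integrable setT (EFin \o f c).
    move=> c0; apply: (le_integrable measurableT _ _ (integrableZl measurableT (c `^ (- a)) ib)).
      by apply/measurable_EFinP; exact: mf.
    move=> x _; rewrite /= lee_fin ger0_norm//.
    by apply: le_trans (fb _ _ c0) _; exact: ler_norm.
  have [mB EB] := integral_unfold mf f0.
  have E : (\esum_(q in rows01) \int[mu]_x (f q.1 x)%:E =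
      \esum_(q in rows01) (Rintegral mu setT (f q.1))%:E)%E.
    apply: eq_esum => q [[q0 _] _].
    by rewrite /Rintegral fineK//; apply: integrable_fin_num => //; exact: fi.
  have fin : (\esum_(q in rows01) (Rintegral mu setT (f q.1))%:E < +oo)%E.
    pose M := `|Rintegral mu setT b|.
    apply: le_lt_trans (esum_scale_lty (normr_ge0 _ : 0 <= M) _ (rows01_summable a2)); last first.
      by move=> q; rewrite powR_ge0.
    apply: le_esum => q [[q0 _] _]; rewrite lee_fin.
    apply: (@le_trans _ _ (q.1 `^ (- a) * Rintegral mu setT b)); last first.
      by rewrite mulrC ler_wpM2r ?powR_ge0// ler_norm.
    rewrite -RintegralZl//; apply: le_Rintegral => //; first exact: fi.
      by apply: (integrable_eqr measurableT (integrableZl measurableT (q.1 `^ (- a)) ib)).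
    by move=> x _; exact: fb.
  have B0 x : (0 <= \esum_(q in rows) (f q.1 (x + q.2))%:E)%E by apply: esum_ge0 => q _; rewrite lee_fin.
  have mv : measurable_fun I01 (fun _ : R => v%:E) by exact: measurable_cst.
  have EA : (\int[mu]_(x in I01) (v%:E + \esum_(q in rows) (f q.1 (x + q.2))%:E) =
      v%:E + \esum_(q in rows01) (Rintegral mu setT (f q.1))%:E)%E.
    rewrite ge0_integralD//; congr (_ + _)%E; last by rewrite EB E.
    rewrite -[LHS]/(\int[mu]_(x in I01) cst v%:E x)%E integral_cst//.
    rewrite [X in (_ * X)%E](_ : _ = mu `[0, 1]%classic)// lebesgue_measure_itv /= lte_fin ltr01 oppr0 adde0.
    by rewrite mule1.
  have iA : mu.-integrable I01 (fun x => v%:E + \esum_(q in rows) (f q.1 (x + q.2))%:E)%E.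
    apply/integrableP; split; first exact: emeasurable_funD.
    under eq_integral => x _ do rewrite gee0_abs ?adde_ge0//.
    by rewrite EA lte_add_pinfty// ltry.
  have [h1 h2] := integral_fine mI01 iA.
  split => //; rewrite h2 EA fineD//; last first.
    by rewrite ge0_fin_numE//; apply: esum_ge0 => q _; rewrite lee_fin Rintegral_ge0.
  have -> (w : R) : fine v%:E + w - v = w by rewrite /= addrAC subrr add0r.
  have I0 c : 0 <= Rintegral mu setT (f c) by apply: Rintegral_ge0 => x _; exact: f0.
  exact: (rows01_series g0 ginc gS I0 fin).
have mpos c : measurable_fun [set: R] (fun x => pos (phi c x)).
  by apply: measurable_maxr.
have mneg c : measurable_fun [set: R] (fun x => pos (- phi c x)).
  by apply: measurable_maxr => //; exact: measurable_funN.
have [i1 c1 I1] := part (fun c x => pos (phi c x)) (pos u) mpos (fun _ _ => pos_ge0 _)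
  (fun c x c0 => (pos_le (phib c x c0)).1) (pos_ge0 _).
have [i2 c2 I2] := part (fun c x => pos (- phi c x)) (pos (- u)) mneg (fun _ _ => pos_ge0 _)
  (fun c x c0 => (pos_le (phib c x c0)).2) (pos_ge0 _).
rewrite RintegralB// -{3}(posB u).
have -> (x y z t : R) : x - y - (z - t) = (x - z) - (y - t) by ring.
apply: (cvg_weighted_sumB c1 c2) => k k1.
rewrite -RintegralB//; [|exact/i1/g_gt0|exact/i2/g_gt0].
by apply: eq_Rintegral => x _; rewrite posB.
Qed.

End RealAverages.

(** * Heights and averages of the Eisenstein series *)

Section ScatteringTerm.
Variable R : realType.
Local Notation mu := (@lebesgue_measure R).
Local Notation G3 := (@G3 R).
Local Notation rows := (@rows R).
Local Notation rows01 := (@rows01 R).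
Implicit Types (x y c p : R) (q : R * R) (s : R[i]).
Let I01 : set (measurableTypeR R) := `[0, 1]%classic.

(* The height of the image of [x + iy] under a matrix with bottom row (c, 0). *)
Definition height (y c x : R) : R := (c ^+ 2)^-1 * (y^-1 * kern (y^-1 * x)).

Let kern_ge0 (x : R) : 0 <= kern x. Proof. exact: ltW (kern_gt0 x). Qed.

Lemma height_rnorm y q x : 0 < y -> rows q -> y / rnorm q (x +i* y) = height y q.1 (x + q.2).
Proof.
move=> y0 [q0 _]; rewrite /height /rnorm /kern /=.
have h1 : (x + q.2) ^+ 2 + y ^+ 2 != 0 by rewrite gt_eqF// ltr_wpDl ?sqr_ge0 ?exprn_gt0.
have h2 : y ^+ 2 + (x + q.2) ^+ 2 != 0 by rewrite addrC.
have h3 : 1 + (y^-1 * (x + q.2)) ^+ 2 != 0 by rewrite gt_eqF// ltr_pwDl ?sqr_ge0.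
have -> : 1 + (y^-1 * (x + q.2)) ^+ 2 = ((x + q.2) ^+ 2 + y ^+ 2) / y ^+ 2.
  by field; rewrite gt_eqF.
by field; rewrite h1 !gt_eqF.
Qed.

Lemma measurable_height y c : measurable_fun [set: R] (height y c).
Proof.
apply: measurable_funM => //; apply: measurable_funM => //.
apply: (measurableT_comp (@measurable_kern R)).
exact: measurable_funM.
Qed.

Lemma powR_height y c x p : 0 < y -> 0 < c ->
  height y c x `^ p = c `^ (- (2 * p)) * (y^-1 * kern (y^-1 * x)) `^ p.
Proof.
move=> y0 c0; rewrite /height powRM ?invr_ge0 ?sqr_ge0//; last first.
  by rewrite mulr_ge0 ?kern_ge0 ?invr_ge0 ?(ltW y0).
congr (_ * _); rewrite -mulrN -(powR_mulrn 2 (ltW c0)) -powRN -!powRrM.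
by congr powR; ring.
Qed.

Lemma cpow_height y c x s : 0 < y -> 0 < c ->
  cpow (height y c x) s =
  cpow c (- (2 * s)) * cpow y^-1 s * cpow (kern (y^-1 * x + 0)) s.
Proof.
move=> y0 c0; rewrite addr0 /height.
have vy0 : 0 < y^-1 by rewrite invr_gt0.
have vc0 : 0 < (c ^+ 2)^-1 by rewrite invr_gt0 exprn_gt0.
have k0 := kern_gt0 (y^-1 * x).
rewrite (cpowM s vc0 (mulr_gt0 vy0 k0)) (cpowM s vy0 k0) mulrA; congr (_ * _ * _).
rewrite cpowV ?exprn_gt0// expr2 cpowM// -cpowD//; congr cpow; ring.
Qed.

Lemma cint_height y c s : 0 < y -> 0 < c -> 1 < complex.Re s ->
  cint setT (fun x => cpow (height y c x) s) =
  cpow c (- (2 * s)) * (cpow y (1 - s) * kern_int s).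
Proof.
move=> y0 c0 s1; have vy0 : 0 < y^-1 by rewrite invr_gt0.
have ik := cintble_kern s1.
transitivity (cint setT (fun x => cpow c (- (2 * s)) * cpow y^-1 s * cpow (kern (y^-1 * x + 0)) s)).
  by apply: eq_cint => x _; exact: cpow_height.
rewrite cintZ//; last exact: (cintble_affine 0 vy0 ik).
rewrite /kern_int (cint_affine 0 vy0 ik) cpowD// cpowr1// cpowV//.
have yC : (y^-1)%:C = (y%:C)^-1 :> R[i] by rewrite fmorphV.
have y0C : y%:C != 0 :> R[i] by rewrite eq_complex /= eqxx andbT gt_eqF.
by rewrite yC; field.
Qed.

Variable g : nat -> R.
Hypothesis g0 : g 0%N = 0.
Hypothesis ginc : forall k, g k < g k.+1.
Hypothesis gS : forall q, rows01 q -> exists k, q.1 = g k.+1.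

(** Here [rho] stands for the real or the imaginary part; the term subtracted at the end comes from
    the trivial coset. *)
Lemma eisenstein_average (rho : R[i] -> R) (s : R[i]) (y : R) : 0 < y -> 1 < complex.Re s ->
  measurable_fun [set: R] (fun v => rho (cpow v s)) ->
  (forall v, `|rho (cpow v s)| <= v `^ complex.Re s) ->
  (fun N => \sum_(1 <= k < N) (row_count (g k))%:R *
     Rintegral mu setT (fun x => rho (cpow (height y (g k) x) s))) @ \oo -->
  Rintegral mu I01 (fun x => rsum (stab_cosets G3 (mob_bd 1%:M None))
    (fun C => rho (cpow (complex.Im (mob (invmx 1%:M *m xget 1%:M C) (mob 1%:M (x +i* y)))) s)))
  - rho (cpow y s).
Proof.
move=> y0 s1 mrho brho.
pose b x := (y^-1 * kern (y^-1 * x)) `^ complex.Re s.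
have vy0 : 0 < y^-1 by rewrite invr_gt0.
have ib : mu.-integrable setT (EFin \o b).
  (* The bound b is integrable because the power of [kern] with the real exponent Re s is. *)
  have s1' : 1 < complex.Re ((complex.Re s)%:C : R[i]) by [].
  have [ik _] := cintbleZ (cpow y^-1 (complex.Re s)%:C) measurableT (cintble_affine 0 vy0 (cintble_kern s1')).
  apply: (integrable_eqr measurableT ik) => x _; rewrite !cpow_real addr0 /b /=.
  by rewrite mulr0 subr0 powRM ?(ltW vy0) ?kern_ge0.
have H c x : 0 < c -> `|rho (cpow (height y c x) s)| <= c `^ (- (2 * complex.Re s)) * b x.
  by move=> c0; rewrite -powR_height.
have a2 : 2 < 2 * complex.Re s by lra.
have mphi c : measurable_fun [set: R] (fun x => rho (cpow (height y c x) s)).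
  exact: (measurableT_comp mrho (measurable_height y c)).
have := average_rows (u := rho (cpow y s)) g0 ginc gS a2 mphi H ib.
rewrite [X in _ --> X - _ -> _](_ : _ = Rintegral mu I01 (fun x =>
  rsum (stab_cosets G3 (mob_bd 1%:M None))
    (fun C => rho (cpow (complex.Im (mob (invmx 1%:M *m xget 1%:M C) (mob 1%:M (x +i* y)))) s)))) //.
apply: eq_Rintegral => x _; rewrite mob1 mob_bd1 /rsum.
rewrite (@esum_stab_cosets _ (fun v => (Num.max (rho (cpow v s)) 0)%:E)) //; last first.
  by move=> v; rewrite lee_fin le_max lexx orbT.
rewrite (@esum_stab_cosets _ (fun v => (Num.max (- rho (cpow v s)) 0)%:E)) //; last first.
  by move=> v; rewrite lee_fin le_max lexx orbT.
congr (fine (_ + _)%E - fine (_ + _)%E);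
  by apply: eq_esum => q qr; rewrite /= -height_rnorm.
Qed.

End ScatteringTerm.

(** * The scattering coefficient as a Dirichlet series *)

Section ScatteringMatrix.
Variable R : realType.
Local Notation mu := (@lebesgue_measure R).
Local Notation G3 := (@G3 R).
Local Notation rows01 := (@rows01 R).
Implicit Types (x y : R) (s : R[i]).

Lemma cvg_complex (u : nat -> R[i]) (l : R[i]) :
  (fun N => complex.Re (u N)) @ \oo --> complex.Re l ->
  (fun N => complex.Im (u N)) @ \oo --> complex.Im l ->
  (fun N => u N : R[i]^o) @ \oo --> (l : R[i]^o).
Proof.
move=> /cvgrPdist_lt cr /cvgrPdist_lt ci; apply/cvgrPdist_lt => e e0.
have [e' e'0 eE] : exists2 e' : R, 0 < e' & e = e'%:C.
  move: e0; case: (e) => a b; rewrite ltcE /= => /andP[/eqP -> a0].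
  by exists a.
have e2 : 0 < e' / 2 by rewrite divr_gt0.
near=> N.
rewrite eE normc_def ltcR.
have -> : complex.Re (l - u N) = complex.Re l - complex.Re (u N) by case: (l) (u N) => ? ? [].
have -> : complex.Im (l - u N) = complex.Im l - complex.Im (u N) by case: (l) (u N) => ? ? [].
have h1 : `|complex.Re l - complex.Re (u N)| < e' / 2 by near: N; exact: cr.
have h2 : `|complex.Im l - complex.Im (u N)| < e' / 2 by near: N; exact: ci.
move: h1 h2; set a := _ - _; set b := _ - _ => h1 h2.
rewrite -[ltRHS]gtr0_norm// -sqrtr_sqr ltr_sqrt ?exprn_gt0//.
rewrite -(real_normK (num_real a)) -(real_normK (num_real b)).
have := normr_ge0 a; have := normr_ge0 b; nra.
Unshelve. all: by end_near.
Qed.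

Variable g : nat -> R.
Hypothesis g0 : g 0%N = 0.
Hypothesis ginc : forall k, g k < g k.+1.
Hypothesis gS : forall q, rows01 q -> exists k, q.1 = g k.+1.

Definition scattering_sum s (N : nat) : R[i] :=
  \sum_(1 <= k < N) (row_count (g k))%:R%:C * cpow (g k) (- (2 * s)).

Let g_gt0 k : (1 <= k)%N -> 0 < g k.
Proof. exact: increasing_gt0. Qed.

Let ReCM (a : R) (z : R[i]) : complex.Re (a%:C * z) = a * complex.Re z.
Proof. by case: z => x y /=; rewrite mul0r subr0. Qed.

Let ImCM (a : R) (z : R[i]) : complex.Im (a%:C * z) = a * complex.Im z.
Proof. by case: z => x y /=; rewrite mul0r addr0. Qed.

Lemma scattering_sum_Re s N (K : R[i]) : complex.Re (scattering_sum s N * K) =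
  \sum_(1 <= k < N) (row_count (g k))%:R * complex.Re (cpow (g k) (- (2 * s)) * K).
Proof.
by rewrite mulr_suml raddf_sum; apply: eq_bigr => k _; rewrite -ReCM mulrA.
Qed.

Lemma scattering_sum_Im s N (K : R[i]) : complex.Im (scattering_sum s N * K) =
  \sum_(1 <= k < N) (row_count (g k))%:R * complex.Im (cpow (g k) (- (2 * s)) * K).
Proof.
by rewrite mulr_suml raddf_sum; apply: eq_bigr => k _; rewrite -ImCM mulrA.
Qed.

Lemma scattering_sum_cvg s : 1 < complex.Re s -> exists S : R[i],
  (fun N => complex.Re (scattering_sum s N)) @ \oo --> complex.Re S /\
  (fun N => complex.Im (scattering_sum s N)) @ \oo --> complex.Im S.
Proof.
move=> s1; have a2 : 2 < 2 * complex.Re s by lra.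
have E : complex.Re (- (2 * s)) = - (2 * complex.Re s).
  by rewrite (_ : 2 * s = s + s); [case: (s) => x y /=; ring|ring].
have [l1 c1] := rows01_abs_series g0 ginc gS a2 ler01
  (fun c _ => ltac:(by rewrite mul1r -E; exact: Re_cpow_le) :
    `|complex.Re (cpow c (- (2 * s)))| <= 1 * c `^ (- (2 * complex.Re s))).
have [l2 c2] := rows01_abs_series g0 ginc gS a2 ler01
  (fun c _ => ltac:(by rewrite mul1r -E; exact: Im_cpow_le) :
    `|complex.Im (cpow c (- (2 * s)))| <= 1 * c `^ (- (2 * complex.Re s))).
exists (l1 +i* l2); split.
  rewrite (_ : (fun _ => _) = fun N => \sum_(1 <= k < N) (row_count (g k))%:R * complex.Re (cpow (g k) (- (2 * s))))//.
  by apply/funext => N; rewrite -[scattering_sum s N]mulr1 scattering_sum_Re; apply: eq_bigr => k _; rewrite mulr1.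
rewrite (_ : (fun _ => _) = fun N => \sum_(1 <= k < N) (row_count (g k))%:R * complex.Im (cpow (g k) (- (2 * s))))//.
by apply/funext => N; rewrite -[scattering_sum s N]mulr1 scattering_sum_Im; apply: eq_bigr => k _; rewrite mulr1.
Qed.

(** Removing y^s from the average leaves, in each component, a limit of sums of d(c) c^(- 2 s) K.
    These sums tend to S K as well, and limits are unique. *)
Lemma eisenstein_constant_term s (S : R[i]) y : 1 < complex.Re s -> 0 < y ->
  (fun N => complex.Re (scattering_sum s N)) @ \oo --> complex.Re S ->
  (fun N => complex.Im (scattering_sum s N)) @ \oo --> complex.Im S ->
  cint `[0, 1] (fun x => eisenstein G3 1%:M (mob 1%:M (x +i* y)) s) =
  cpow y s + kern_int s * S * cpow y (1 - s).
Proof.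
move=> s1 y0 cr ci; set K := cpow y (1 - s) * kern_int s.
have J k : (1 <= k)%N -> cint setT (fun x => cpow (height y (g k) x) s) = cpow (g k) (- (2 * s)) * K.
  by move=> k1; apply: cint_height => //; exact: g_gt0.
have c1 := eisenstein_average g0 ginc gS y0 s1 (@measurable_Re_cpow R s) (fun v => Re_cpow_le v s).
have c2 := eisenstein_average g0 ginc gS y0 s1 (@measurable_Im_cpow R s) (fun v => Im_cpow_le v s).
have d1 : (fun N => complex.Re (scattering_sum s N * K)) @ \oo --> complex.Re (S * K).
  have -> : (fun N => complex.Re (scattering_sum s N * K)) = (fun N =>
      complex.Re (scattering_sum s N) * complex.Re K - complex.Im (scattering_sum s N) * complex.Im K).
    by apply/funext => N; case: (scattering_sum _ _) => a b; case: (K).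
  have -> : complex.Re (S * K) = complex.Re S * complex.Re K - complex.Im S * complex.Im K.
    by case: (S) => a b; case: (K).
  by apply: cvgB; apply: cvgMl.
have d2 : (fun N => complex.Im (scattering_sum s N * K)) @ \oo --> complex.Im (S * K).
  have -> : (fun N => complex.Im (scattering_sum s N * K)) = (fun N =>
      complex.Re (scattering_sum s N) * complex.Im K + complex.Im (scattering_sum s N) * complex.Re K).
    by apply/funext => N; case: (scattering_sum _ _) => a b; case: (K).
  have -> : complex.Im (S * K) = complex.Re S * complex.Im K + complex.Im S * complex.Re K.
    by case: (S) => a b; case: (K).
  by apply: cvgD; apply: cvgMl.
set X := cint _ _.
have e1 : complex.Re X - complex.Re (cpow y s) = complex.Re (S * K).
  apply: (cvg_unique _ _ d1) => //.
  rewrite (_ : (fun N => complex.Re _) = (fun N => \sum_(1 <= k < N) (row_count (g k))%:R *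
     Rintegral mu setT (fun x => complex.Re (cpow (height y (g k) x) s)))); first exact: c1.
  apply/funext => N; rewrite scattering_sum_Re; apply: eq_big_nat => k /andP[k1 _].
  by rewrite -J.
have e2 : complex.Im X - complex.Im (cpow y s) = complex.Im (S * K).
  apply: (cvg_unique _ _ d2) => //.
  rewrite (_ : (fun N => complex.Im _) = (fun N => \sum_(1 <= k < N) (row_count (g k))%:R *
     Rintegral mu setT (fun x => complex.Im (cpow (height y (g k) x) s)))); first exact: c2.
  apply/funext => N; rewrite scattering_sum_Im; apply: eq_big_nat => k /andP[k1 _].
  by rewrite -J.
have -> : kern_int s * S * cpow y (1 - s) = S * K by rewrite /K; ring.
apply/eqP; rewrite addrC -subr_eq eq_complex -e1 -e2.
by case: (X) (cpow y s) => a b [c d]; rewrite /= !eqxx.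
Qed.

End ScatteringMatrix.

Theorem mainTheorem4 (R : realType) :
  exists (G : set 'M[R]_2) (n1 : nat) (sigma : 'I_n1 -> 'M[R]_2)
    (phi : R[i] -> 'M[R[i]]_n1) (d g : nat -> R) (l : R),
    [/\ fuchsian G, first_kind G & finite_covolume G] /\
    [/\ (1 <= n1)%N, cusp_system G sigma,
        scattering_matrix G sigma phi & scattering_det_series phi d g] /\
    shortest_geodesic_length G l /\
    expR l = (g 2%N / g 1%N) ^+ 2.
Proof.
have [g [g1 g2 ginc [g0 dpos gS]]] := rows01_enum R.
(* The condition on Re s is kept under the existential, so that [choice] yields a function S on the
   whole plane, arbitrary for Re s <= 1. *)
have H s : exists S : R[i], 1 < complex.Re s ->
    (fun N => complex.Re (scattering_sum g s N)) @ \oo --> complex.Re S /\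
    (fun N => complex.Im (scattering_sum g s N)) @ \oo --> complex.Im S.
  have [s1|s1] := ltP 1 (complex.Re s); last by exists 0.
  by have [S SP] := scattering_sum_cvg g0 ginc gS s1; exists S.
have [S SP] := choice H.
have r1 := sqrt3_gt R.
(* With a single cusp the scattering matrix has one entry, which is also its determinant. *)
exists (@G3 R), 1%N, (fun=> 1%:M), (fun s => (kern_int s * S s)%:M),
  (fun k => (row_count (g k))%:R), g, (ln 3); split.
  by split; [exact: G3_fuchsian|exact: G3_first_kind|exact: G3_finite_covolume].
split; last first.
  split; first exact: G3_shortest.
  by rewrite g1 g2 lnK ?posrE//; field: (sqrt3_sq R).
split => //; first exact: G3_cusp_system.
  move=> s s1 i j y y0; have [cr ci] := SP s s1.
  by rewrite (eisenstein_constant_term g0 ginc gS s1 y0 cr ci) (ord1 i) (ord1 j) !mxE eqxx mul1r.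
split.
- by case=> // k _; rewrite pnatr_eq0 -lt0n.
- by rewrite g1; lra.
- by move=> k _.
(* The abscissa 2 is the one required by [gamma_ratio]. *)
exists 2 => s s2; have s1 : 1 < complex.Re s by lra.
exists (S s); first have [cr ci] := SP s s1.
  rewrite (_ : (fun _ => _) = scattering_sum g s); first exact: cvg_complex.
  apply/funext => N; apply: eq_big_nat => k /andP[k1 _]; rewrite cpowN//.
  exact: increasing_gt0.
rewrite det_scalar1 expr1 mul1r powR12_sqrt ?pi_ge0//.
have n0 := cGamma_neq0 s1.
(* Clearing the denominator Gamma(s), nonzero by [n0], reduces the quotient of Gamma values to
   [gamma_ratio]. *)
by congr (_ * _); apply: (mulfI n0); rewrite gamma_ratio//; field.
Qed.
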